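(* (a) $\lim_{n\to\infty}\frac1n\sum_{k=1}^n\mathsf a'_k=\infty$ Lebesgue-almost everywhere. (b) (Trimmed strong law) Lebesgue-almost everywhere, \[ \lim_{n\to\infty}\frac{\log 2}{n\log\log n}\Big(\sum_{k=1}^n\mathsf a'_k-\mathsf M'_n\Big)=1 . \]
   Context: $I=(0,1]$, $\lambda$ is Lebesgue measure on $I$, and $\mathsf a_n(x)$ denotes the $n$-th continued fraction digit of $x\in I$. $\mathbb P$ is the set of primes. The prime digits are $\mathsf a'_n(x):=\mathsf a_n(x)$ if $\mathsf a_n(x)\in\mathbb P$ and $\mathsf a'_n(x):=0$ otherwise; $\mathsf M'_n:=\max_{1\le k\le n}\mathsf a'_k$. *)

(* Defs.v *)
From HB Require Import structures.
From mathcomp Require Import all_boot all_order all_algebra.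
From mathcomp Require Import all_classical all_reals all_analysis.
Set Implicit Arguments. Unset Strict Implicit. Unset Printing Implicit Defensive.
Import Order.TTheory GRing.Theory Num.Theory.
Local Open Scope ring_scope.

Section CF.
Variable R : realType.

(* Gauss map T x = 1/x - floor(1/x) (with the MathComp convention 0^-1 = 0,
   so T 0 = 0; this only matters on the null set of rationals). *)
Definition gauss (x : R) : R := x^-1 - (Num.truncn (x^-1))%:R.

Definition cf_digit (n : nat) (x : R) : nat := Num.truncn ((iter n.-1 gauss x)^-1).

Definition prime_digit (n : nat) (x : R) : nat :=
  if prime (cf_digit n x) then cf_digit n x else 0%N.

Definition prime_digit_sum (n : nat) (x : R) : nat :=
  (\sum_(1 <= k < n.+1) prime_digit k x)%N.

Definition prime_digit_max (n : nat) (x : R) : nat :=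
  (\max_(1 <= k < n.+1) prime_digit k x)%N.

End CF.

(* Main.v *)
(** Under Lebesgue measure the digits form a chain driven by s_n = q_(n-1) / q_n: given
    a_1, ..., a_n, one has a_(n+1) = k with probability
    (1 + s_n) / ((k + s_n) (k + 1 + s_n)), and then s_(n+1) = 1 / (k + s_n).  The
    corresponding Markov operator L contracts Lipschitz constants by the factor 11/12, which
    gives exponential decorrelation of the digits.  The kernel
    K(s, x) = (1 + s) (1 + x) / (1 + s x)^2 satisfies L_s K = L_x K; hence the limit of
    L_s^n K(., x) does not depend on x, and a telescoping Riemann sum identifies it as
    1 / log 2.  So P(a_n = p) is asymptotic to 1 / (p^2 log 2), and by Mertens the prime
    digits at most t have mean about (log log t) / log 2.

    Truncate at t = N / (log N)^(1/3).  By Chebyshev's bound on the number of primes, the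
    variance of the truncated sum is O(N^2 (log N)^(-4/3)) and the probability that two of N
    prime digits exceed t is O((log N)^(-4/3)).  Along N = exp(j^(9/10)) both are summable
    after normalisation, so almost surely the sum minus its maximum eventually agrees with
    the truncated sum up to t, and the latter is close to its mean; consecutive N have ratio
    tending to 1, which fills the gaps.  The untrimmed averages diverge because the trimmed
    ones do. *)

Require Import Defs.
From HB Require Import structures.
From mathcomp Require Import all_boot all_order all_algebra.
From mathcomp Require Import all_classical all_reals all_analysis.
From mathcomp Require Import measurable_realfun zify ring lra.
Import Order.TTheory GRing.Theory Num.Theory numFieldNormedType.Exports.
Local Open Scope classical_set_scope.
Local Open Scope ring_scope.
Set Implicit Arguments. Unset Strict Implicit. Unset Printing Implicit Defensive.

(** The cut is a compromise. For [t = N / (log N)^a] the variance of the truncated sum, divided by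
    [N^2], has order [(log N)^(-1-a)], and two digits beyond [t] have probability of order
    [(log N)^(-2(1-a))]. The exponents agree for [a = 1/3], with common value [4/3]. Along
    [N = exp(j^b)] this is summable when [b > 3/4], while consecutive [N] have ratio tending to 1
    when [b < 1]; with [b = 9/10] all exponents become integers in terms of [v = j^(1/10)]. Since
    the normalisation is [N log log N], every error only has to be [O(N)]: Mertens' theorem with an
    unspecified constant suffices, and so does removing a maximum that lies below the cut. The
    digits are not stationary under Lebesgue measure. Instead of passing to the invariant measure,
    the proof follows the conditional laws indexed by the state [s], Lebesgue measure being [s = 0].
    The operator is kept a finite sum; after [n] steps the neglected branches cost [O(n)] over the
    number of branches, which tends to infinity at the end of each argument, with [n] fixed. *)

Lemma natr_ge1 (R : realType) (k : nat) : (0 < k)%N -> 1 <= k%:R :> R.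
Proof. by move=> k0; rewrite (ler_nat R 1%N). Qed.

Lemma ln2_le1 (R : realType) : ln 2 <= 1 :> R.
Proof. by have := @le_ln1Dx R 1; rewrite (_ : 1 + 1 = 2)//; apply; lra. Qed.

(** * Sums over primes *)

Section PrimeNat.
Implicit Types (m n p k : nat).

Lemma prime_dvd_fact p n : prime p -> (p %| n`!)%N -> (p <= n)%N.
Proof.
move=> pp; elim: n => [|n IH]; first by rewrite fact0 dvdn1 => /eqP p1; move: pp; rewrite p1.
by rewrite factS Euclid_dvdM// => /orP[/dvdn_leq -> //|/IH/leqW].
Qed.

Lemma prod_primes_dvd m k N :
  (forall p, prime p -> (m <= p < k)%N -> (p %| N)%N) ->
  ((\prod_(m <= p < k | prime p) p)%N %| N)%N.
Proof.
elim: k => [|k IH] hN; first by rewrite big_geq// dvd1n.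
have [km|mk] := ltnP k m; first by rewrite big_geq// dvd1n.
have {}IH : ((\prod_(m <= p < k | prime p) p)%N %| N)%N.
  by apply: IH => p pp /andP[mp pk]; apply: hN => //; rewrite mp ltnW.
rewrite big_mkcond big_nat_recr//= -big_mkcond; case: ifPn => [kp|_]; last by rewrite muln1.
rewrite Gauss_dvd ?IH ?hN ?mk ?leqnn//.
rewrite big_nat_cond; apply: (big_rec (fun x => coprime x k)) => [|i x /andP[/andP[_ ik] ip] cx].
  exact: coprime1n.
rewrite coprimeMl cx andbT prime_coprime//.
by rewrite dvdn_prime2// ltn_eqF.
Qed.

(** Erdos' argument: with [m] the upper half of [n], the primes in []m, 2m]] divide the central
    binomial coefficient, which is at most [4^m], and strong induction handles those up to [m]. The
    constant 6 makes [6m + 2m <= 6n] hold for every [n >= 2], odd [n] included. *)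
Lemma primorial_le n : (\prod_(0 <= p < n.+1 | prime p) p <= 2 ^ (6 * n))%N.
Proof.
elim/ltn_ind: n => n IH.
have [n1|n2] := leqP n 1.
  rewrite big_nat_cond big1 ?expn_gt0// => p /andP[/andP[_ pn] pp].
  by have := prime_gt1 pp; lia.
set m := uphalf n.
have mn : (m < n)%N by rewrite /m uphalf_half; lia.
have n2m : (n <= m.*2)%N by rewrite /m; lia.
have dvdC : ((\prod_(m.+1 <= p < m.*2.+1 | prime p) p)%N %| 'C(m.*2, m))%N.
  apply: prod_primes_dvd => p pp /andP[mp pm].
  have : (p %| (m.*2)`!)%N by rewrite dvdn_fact// prime_gt0//; lia.
  rewrite -(@bin_fact m.*2 m); last by lia.
  rewrite !Euclid_dvdM// (_ : m.*2 - m = m)%N; last by lia.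
  by rewrite orbb => /orP[//|/(prime_dvd_fact pp)]; lia.
have leC : ('C(m.*2, m) <= 2 ^ m.*2)%N.
  have := expnDn 1 1 m.*2; rewrite addn1 => ->.
  have mlt : (m < m.*2.+1)%N by lia.
  rewrite (bigD1 (Ordinal mlt))//= !exp1n !muln1.
  exact: leq_addr.
have C0 : (0 < 'C(m.*2, m))%N by rewrite bin_gt0; lia.
have le2 : (\prod_(0 <= p < n.+1 | prime p) p <=
    (\prod_(0 <= p < m.+1 | prime p) p) * \prod_(m.+1 <= p < m.*2.+1 | prime p) p)%N.
  rewrite -big_cat_nat//=; last by lia.
  rewrite [leqRHS](@big_cat_nat _ _ _ n.+1)//=.
  rewrite leq_pmulr// prodn_cond_gt0// => p; exact: prime_gt0.
apply: leq_trans le2 _; apply: leq_trans (leq_mul (IH m mn) (leq_trans (dvdn_leq C0 dvdC) leC)) _.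
by rewrite -expnD leq_exp2l// /m uphalf_half; lia.
Qed.

End PrimeNat.

Section PrimeSums.
Variable R : realType.
Implicit Types (m n p k t : nat).

Lemma ln_ge0n n : 0 <= ln n%:R :> R.
Proof. by case: n => [|n]; [rewrite ln0|rewrite ln_ge0// (ler_nat R 1%N)]. Qed.

Lemma ln_prod_nat (r : seq nat) (P : pred nat) : (forall p, P p -> (0 < p)%N) ->
  ln (\prod_(p <- r | P p) p)%N%:R = \sum_(p <- r | P p) ln p%:R :> R.
Proof.
move=> P0; elim: r => [|p r IH]; first by rewrite !big_nil ln1.
rewrite !big_cons; case: ifPn => // Pp.
by rewrite natrM lnM ?posrE ?ltr0n ?prodn_cond_gt0 ?IH// P0.
Qed.

Definition chebyshev_theta n : R := \sum_(0 <= p < n.+1 | prime p) ln p%:R.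

Lemma chebyshev_theta_le n : chebyshev_theta n <= 6 * n%:R.
Proof.
rewrite /chebyshev_theta -ln_prod_nat; last by move=> p; exact: prime_gt0.
have ln2 := ln2_le1 R.
apply: (@le_trans _ _ (ln (2 ^ (6 * n))%:R)).
  rewrite ler_ln ?posrE ?ltr0n ?expn_gt0 ?prodn_cond_gt0//; last by move=> p; exact: prime_gt0.
  by rewrite ler_nat primorial_le.
rewrite natrX lnXn// -[leLHS]mulr_natl natrM.
by rewrite ler_piMr// mulr_ge0.
Qed.

(** The range of primes is frozen at [n] so that the induction on [k] adds the factorisation of a
    single integer; the case of interest is [k = n]. *)
Lemma ln_fact_logn n k : (k <= n)%N ->
  ln k`!%:R = \sum_(0 <= p < n.+1 | prime p) (logn p k`!)%:R * ln p%:R :> R.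
Proof.
elim: k => [_|k IH kn].
  by rewrite ln1 big1// => p _; rewrite logn1 mul0r.
rewrite factS natrM lnM ?posrE ?ltr0n ?fact_gt0// IH ?(ltnW kn)//.
have -> : ln k.+1%:R = \sum_(0 <= p < n.+1 | prime p) (logn p k.+1)%:R * ln p%:R :> R.
  rewrite -[k.+1 in LHS]partnT// (widen_partn _ kn).
  rewrite [in LHS](bigID prime)/= [X in (_ * X)%N]big1 ?muln1; last first.
    by move=> p pp; rewrite lognE (negbTE pp).
  elim: (index_iota _ _) => [|p r IHr]; first by rewrite !big_nil ln1.
  rewrite !big_cons; case: ifPn => // pp.
  have r0 : (0 < \prod_(q <- r | prime q) q ^ logn q k.+1)%N.
    by rewrite prodn_cond_gt0// => q qp; rewrite expn_gt0 prime_gt0.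
  have p0 := prime_gt0 pp.
  by rewrite natrM lnM ?posrE ?ltr0n ?expn_gt0 ?p0// IHr natrX lnXn ?ltr0n// mulr_natl.
rewrite -big_split/=; apply: eq_bigr => p pp.
by rewrite lognM ?fact_gt0// natrD mulrDl.
Qed.

End PrimeSums.

(** * Mertens' theorems and Chebyshev-type bounds *)

Section Mertens.
Variable R : realType.
Implicit Types (m n p k t : nat).

Lemma ln_succ_le n : (0 < n)%N -> ln n.+1%:R <= ln n%:R + n%:R^-1 :> R.
Proof.
move=> n0; have n1 := natr_ge1 R n0.
have -> : n.+1%:R = n%:R * (1 + n%:R^-1) :> R.
  by rewrite mulrDr mulr1 divff ?gt_eqF ?natr1//; lra.
have i0 : 0 < n%:R^-1 :> R by rewrite invr_gt0; lra.
rewrite lnM ?posrE ?addr_gt0//; last lra.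
by rewrite lerD2l le_ln1Dx//; lra.
Qed.

Lemma ln_succ_ge n : (0 < n)%N -> ln n%:R + n.+1%:R^-1 <= ln n.+1%:R :> R.
Proof.
move=> n0; have n1 := natr_ge1 R n0; have n2 : 2 <= n.+1%:R :> R by rewrite ler_nat.
have -> : n%:R = n.+1%:R * (1 - n.+1%:R^-1) :> R.
  by rewrite mulrBr mulr1 divff ?gt_eqF -?natr1 ?addrK//; lra.
have i1 : n.+1%:R^-1 < 1 :> R by rewrite invf_lt1; lra.
rewrite lnM ?posrE ?subr_gt0//.
have := @le_ln1Dx R (- n.+1%:R^-1); rewrite ltrN2 => /(_ i1).
by set c := _^-1; set b := ln (1 - c); lra.
Qed.

Lemma ln_fact_itv n : n%:R * ln n%:R - n%:R <= (ln n`!%:R : R) <= n%:R * ln n%:R.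
Proof.
case: n => [|n]; first by rewrite !mul0r subr0 fact0 ln1 lexx.
elim: n => [|n /andP[IH1 IH2]]; first by rewrite (_ : 1`! = 1)%N// ln1 !mulr0; lra.
rewrite factS natrM lnM ?posrE ?ltr0n ?fact_gt0//.
have h1 := ln_succ_le (ltn0Sn n); have h2 := ln_succ_ge (ltn0Sn n).
have n1 := natr_ge1 R (ltn0Sn n).
have nn : n.+1%:R * n.+1%:R^-1 = 1 :> R by rewrite divff// gt_eqF//; lra.
have i0 : 0 < n.+2%:R^-1 :> R by rewrite invr_gt0.
have := ler_wpM2l (ler0n R n.+1) h1; rewrite mulrDr nn => h3.
have h4 : n.+1%:R * ln n.+1%:R <= n.+1%:R * ln n.+2%:R :> R.
  by rewrite ler_wpM2l//; apply: le_trans h2; rewrite lerDl ltW.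
have -> : n.+2%:R = n.+1%:R + 1 :> R by rewrite natr1.
rewrite !mulrDl !mul1r natr1.
move: IH1 IH2 h3 h4; set a := n.+1%:R * ln n.+1%:R; set b := n.+1%:R * ln n.+2%:R => *.
by apply/andP; split; lra.
Qed.

Lemma logn_fact_ge p n : prime p -> n%:R / p%:R - 1 <= (logn p n`!)%:R :> R.
Proof.
move=> pp; case: n => [|n]; first by rewrite mul0r fact0 logn1; lra.
rewrite logn_fact// big_ltn// expn1 natrD.
have p0 : 0 < p%:R :> R by rewrite ltr0n prime_gt0.
apply: (@le_trans _ _ (n.+1 %/ p)%:R); last by rewrite lerDl.
rewrite lerBlDr ler_pdivrMr// natr1 -natrM ler_nat ltnW//.
by rewrite ltn_ceil// prime_gt0.
Qed.

Lemma logn_fact_le p n : prime p -> (logn p n`!)%:R <= n%:R / (p%:R - 1) :> R.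
Proof.
move=> pp; rewrite logn_fact//.
have p1 : 1 < p%:R :> R by rewrite (ltr_nat R 1%N) prime_gt1.
have geo m : \sum_(1 <= k < m.+1) (p%:R ^+ k)^-1 = (p%:R - 1)^-1 - (p%:R ^+ m * (p%:R - 1))^-1 :> R.
  elim: m => [|m IH]; first by rewrite big_geq// mul1r subrr.
  rewrite big_nat_recr//= IH exprS; field.
  by rewrite expf_eq0 negb_and; apply/and3P; split; rewrite ?orbT ?gt_eqF//; lra.
apply: (@le_trans _ _ (n%:R * \sum_(1 <= k < n.+1) (p%:R ^+ k)^-1)).
  rewrite natr_sum mulr_sumr; apply: ler_sum => k _.
  rewrite ler_pdivlMr ?exprn_gt0//; last lra.
  by rewrite -natrX -natrM ler_nat leq_trunc_div.
rewrite geo ler_wpM2l// gerDl oppr_le0 invr_ge0 mulr_ge0 ?exprn_ge0//; lra.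
Qed.

Definition prime_log_sum n : R := \sum_(0 <= p < n.+1 | prime p) ln p%:R / p%:R.

(** Keeping only the first term of Legendre's formula gives
    [log n! >= n * prime_log_sum n - theta(n)]; the left side is at most [n log n], and Chebyshev's
    bound on theta contributes the 6. *)
Lemma prime_log_sum_le n : (0 < n)%N -> prime_log_sum n <= ln n%:R + 6.
Proof.
move=> n0; have n1 := natr_ge1 R n0.
have /andP[_ h1] := ln_fact_itv n.
have h2 := chebyshev_theta_le R n.
have h3 : n%:R * prime_log_sum n - chebyshev_theta R n <= ln n`!%:R.
  rewrite (@ln_fact_logn R n n)// /prime_log_sum /chebyshev_theta mulr_sumr -sumrB.
  apply: ler_sum => p pp.
  apply: le_trans (ler_wpM2r (ln_ge0n R p) (logn_fact_ge n pp)).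
  by rewrite le_eqVlt; apply/orP; left; apply/eqP; ring.
have n00 : 0 < n%:R :> R by lra.
rewrite -(ler_pM2l n00) mulrDr; lra.
Qed.

Lemma sum_prime_recr (F : nat -> R) m n : (m <= n)%N ->
  \sum_(m <= p < n.+1 | prime p) F p =
  \sum_(m <= p < n | prime p) F p + (if prime n then F n else 0).
Proof. by move=> mn; rewrite big_mkcond big_nat_recr//= -big_mkcond. Qed.

Lemma sum_prime_ge2 (F : nat -> R) n :
  \sum_(0 <= p < n.+1 | prime p) F p = \sum_(2 <= p < n.+1 | prime p) F p.
Proof.
have [n1|n2] := ltnP n 1.
  rewrite [RHS]big_geq//; last lia.
  by rewrite big_nat_cond big1// => p /andP[/andP[_ pn] /prime_gt1]; lia.
rewrite (@big_cat_nat _ _ _ 2)//= big_nat_cond big1 ?add0r// => p.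
by move=> /andP[/andP[_ pn] /prime_gt1]; lia.
Qed.

(** This controls the correction [1/(p-1) - 1/p] in the lower half of Mertens' first theorem. The
    subtracted [(ln n + 2) / n] lets the induction close: its decrease at each step dominates the
    new summand. *)
Lemma sum_ln_over_square_le n : (0 < n)%N ->
  \sum_(2 <= k < n.+1) ln k%:R / (k%:R * (k%:R - 1)) <= 2 - (ln n%:R + 2) / n%:R :> R.
Proof.
elim: n => // -[_ _|n IH _]; first by rewrite big_geq// ln1; lra.
rewrite big_nat_recr//; have {}IH := IH isT.
have n1 := natr_ge1 R (ltn0Sn n).
have h1 := ln_succ_le (ltn0Sn n).
apply: le_trans (lerD IH (lexx _)) _; rewrite -lerBrDl -subr_ge0.
rewrite -[n.+2%:R]natr1 in h1 *; move: (n.+1%:R) n1 h1 => t t1 h1.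
set a := ln t in h1 *; set b := ln (t + 1) in h1 *.
have -> : 2 - (b + 2) / (t + 1) - (2 - (a + 2) / t) - b / ((t + 1) * (t + 1 - 1)) =
    (2 - (t + 1) * (b - a)) / ((t + 1) * t).
  by field; do ?[apply/andP; split]; lra.
apply: divr_ge0; last by apply: mulr_ge0; lra.
rewrite subr_ge0; have h2 : b - a <= t^-1 by lra.
have h3 := ler_wpM2l (_ : 0 <= t + 1) h2; apply: le_trans (h3 _) _; first lra.
by rewrite ler_pdivrMr; lra.
Qed.

Lemma prime_log_sum_ge n : (0 < n)%N -> ln n%:R - 3 <= prime_log_sum n.
Proof.
move=> n0; have n1 := natr_ge1 R n0.
have /andP[h1 _] := ln_fact_itv n.
have h2 := sum_ln_over_square_le n0.
have h3 : ln n`!%:R <= n%:R * (prime_log_sum n +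
    \sum_(2 <= k < n.+1) ln k%:R / (k%:R * (k%:R - 1))).
  apply: (@le_trans _ _ (n%:R * (prime_log_sum n +
    \sum_(2 <= k < n.+1 | prime k) ln k%:R / (k%:R * (k%:R - 1))))).
    rewrite -sum_prime_ge2 -big_split/= mulr_sumr (@ln_fact_logn R n n)//.
    apply: ler_sum => p pp.
    apply: le_trans (ler_wpM2r (ln_ge0n R p) (logn_fact_le n pp)) _.
    have p1 : 1 < p%:R :> R by rewrite (ltr_nat R 1%N) prime_gt1.
    rewrite le_eqVlt; apply/orP; left; apply/eqP; field.
    by apply/andP; split; lra.
  rewrite ler_wpM2l// lerD2l big_mkcond/= big_nat_cond [leRHS]big_nat_cond.
  apply: ler_sum => k /andP[/andP[k2 _] _]; case: ifP => // _.
  have k2' : 2 <= k%:R :> R by rewrite ler_nat.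
  by rewrite divr_ge0 ?ln_ge0n ?mulr_ge0//; lra.
have h4 : \sum_(2 <= k < n.+1) ln k%:R / (k%:R * (k%:R - 1)) <= 2 :> R.
  apply: le_trans h2 _; rewrite gerBl divr_ge0// addr_ge0//.
  exact: ln_ge0n.
have n00 : 0 < n%:R :> R by lra.
have h5 := le_trans h3 (ler_wpM2l (ltW n00) (lerD (lexx (prime_log_sum n)) h4)).
have {}h5 := le_trans h1 h5.
rewrite -(ler_pM2l n00); lra.
Qed.

Definition prime_recip_sum n : R := \sum_(0 <= p < n.+1 | prime p) p%:R^-1.

Lemma ln_gt0n n : (1 < n)%N -> 0 < ln n%:R :> R.
Proof. by move=> n1; rewrite ln_gt0// (ltr_nat R 1%N). Qed.

Lemma prime_recip_sum_abel n : (1 < n)%N ->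
  prime_recip_sum n = prime_log_sum n / ln n%:R +
    \sum_(2 <= k < n) prime_log_sum k * ((ln k%:R)^-1 - (ln k.+1%:R)^-1).
Proof.
elim: n => // -[//|[_ _|n IH _]].
  rewrite [X in _ + X]big_geq// addr0 /prime_recip_sum /prime_log_sum !sum_prime_ge2.
  rewrite !(big_mkcond prime) !big_nat1/= mulrAC divff ?mul1r//.
  by rewrite gt_eqF// ln_gt0n.
have [l1 l2] := (ln_gt0n (isT : (1 < n.+2)%N), ln_gt0n (isT : (1 < n.+3)%N)).
rewrite /prime_recip_sum sum_prime_recr// -/(prime_recip_sum n.+2).
rewrite [\sum_(2 <= k < n.+3) _]big_nat_recr//= IH//.
rewrite [prime_log_sum n.+3]/prime_log_sum sum_prime_recr// -/(prime_log_sum n.+2).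
set S := \sum_(2 <= _ < _) _; set A := prime_log_sum _.
set a := ln n.+2%:R in l1 *; set b := ln n.+3%:R in l2 *.
have n3 : n.+3%:R != 0 :> R by rewrite pnatr_eq0.
case: ifP => _; last by rewrite !addr0; ring.
by field; do ?[apply/andP; split]; rewrite ?gt_eqF//; lra.
Qed.

Lemma lnB_le (x y : R) : 0 < x -> 0 < y -> ln y - ln x <= y / x - 1.
Proof.
move=> x0 y0; rewrite -ln_div ?posrE//.
have yx0 : 0 < y / x by rewrite divr_gt0.
have := @le_ln1Dx R (y / x - 1); rewrite [1 + _]addrC subrK; apply.
by rewrite ltrBrDr addrC subrr.
Qed.

Lemma loglog_step_le n : (1 < n)%N ->
  1 - ln n%:R / ln n.+1%:R <= ln (ln n.+1%:R) - ln (ln n%:R) :> R.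
Proof.
move=> n1; have [l1 l2] := (ln_gt0n n1, ln_gt0n (ltnW n1 : (1 < n.+1)%N)).
by have := lnB_le l2 l1; lra.
Qed.

(** The tangent bound for the increment of [ln ln] from [n+1] to [n+2] has denominator [ln (n+1)],
    as on the right; the numerators compare because [ln] is concave. *)
Lemma loglog_step_ge n : (1 < n)%N ->
  ln (ln n.+2%:R) - ln (ln n.+1%:R) <= 1 - ln n%:R / ln n.+1%:R :> R.
Proof.
move=> n1; have l2 := ln_gt0n (ltnW n1 : (1 < n.+1)%N).
have l3 := ln_gt0n (ltnW (ltnW n1) : (1 < n.+2)%N).
apply: le_trans (lnB_le l2 l3) _.
have h1 := ln_succ_le (ltn0Sn n); have h2 := ln_succ_ge (ltnW n1).
have {h1 h2} h : ln n.+2%:R - ln n.+1%:R <= ln n.+1%:R - ln n%:R :> R.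
  by move: h1 h2; set c := _^-1; lra.
move: l2 l3 h; set b := ln n.+1%:R; set c := ln n.+2%:R; set a := ln n%:R => b0 c0 h.
have -> : c / b - 1 = (c - b) / b by field; rewrite gt_eqF.
have -> : 1 - a / b = (b - a) / b by field; rewrite gt_eqF.
by rewrite ler_pM2r ?invr_gt0.
Qed.

(** Inserting [prime_log_sum k = ln k + O(1)] in the partial summation leaves the sum [w] of
    [1 - ln k / ln (k+1)], squeezed between increments of [ln ln]; the bounded error multiplies
    weights that telescope. *)
Lemma mertens2 : exists C : R, 0 <= C /\ forall n, (1 < n)%N ->
  `|prime_recip_sum n - ln (ln n%:R)| <= C.
Proof.
have l2 := ln_gt0n (isT : (1 < 2)%N); have l3 := ln_gt0n (isT : (1 < 3)%N).
pose w n := \sum_(2 <= k < n) (1 - ln k%:R / ln k.+1%:R) : R.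
have wE n : (1 < n)%N -> ln (ln n.+1%:R) - ln (ln 3) <= w n <= ln (ln n%:R) - ln (ln 2).
  elim: n => // -[//|[_ _|n IH _]]; first by rewrite /w big_geq// !subrr lexx.
  have /andP[i1 i2] := IH isT; rewrite /w big_nat_recr// -/(w n.+2).
  have := loglog_step_ge (isT : (1 < n.+2)%N); have := loglog_step_le (isT : (1 < n.+2)%N).
  set d := 1 - _ => h1 h2; apply/andP; split.
    by apply: le_trans (lerD i1 h2); lra.
  by apply: le_trans (lerD i2 h1) _; lra.
have teleV n : (1 < n)%N -> \sum_(2 <= k < n) ((ln k%:R)^-1 - (ln k.+1%:R)^-1) =
    (ln 2)^-1 - (ln n%:R)^-1 :> R.
  elim: n => // -[//|[_ _|n IH _]]; first by rewrite big_geq// subrr.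
  by rewrite big_nat_recr// IH//= addrA subrK.
have main n : (1 < n)%N -> w n + 1 - 3 / ln 2 <= prime_recip_sum n <= w n + 1 + 6 / ln 2.
  move=> n1; rewrite prime_recip_sum_abel//.
  have ln0 := ln_gt0n n1.
  have a1 := prime_log_sum_ge (ltnW n1); have a2 := prime_log_sum_le (ltnW n1).
  have V0 k : (1 < k)%N -> 0 <= (ln k%:R)^-1 - (ln k.+1%:R)^-1 :> R.
    move=> k1; have k2 : (1 < k.+1)%N by exact: ltnW.
    rewrite subr_ge0 lef_pV2 ?posrE ?ln_gt0n// ler_ln ?posrE ?ltr0n ?(ltnW k1)//.
    by rewrite ler_nat.
  have E (c : R) : \sum_(2 <= k < n) (ln k%:R + c) * ((ln k%:R)^-1 - (ln k.+1%:R)^-1) =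
      w n + c * ((ln 2)^-1 - (ln n%:R)^-1).
    rewrite -teleV// mulr_sumr -big_split/=; apply: eq_big_nat => k /andP[k1 _].
    have k0 := ln_gt0n k1; have k2 := ln_gt0n (ltnW k1 : (1 < k.+1)%N).
    by field; rewrite !gt_eqF.
  have := E 6; have := E (- 3).
  set s1 := \sum_(2 <= k < n) _; set s2 := \sum_(2 <= k < n) _; set s3 := \sum_(2 <= k < n) _.
  move=> e1 e2.
  have s13 : s1 <= s3.
    rewrite /s1 /s3 big_nat_cond [leRHS]big_nat_cond; apply: ler_sum => k /andP[/andP[k1 _] _].
    by rewrite ler_wpM2r ?V0//; apply: prime_log_sum_ge; exact: ltnW.
  have s32 : s3 <= s2.
    rewrite /s2 /s3 big_nat_cond [leRHS]big_nat_cond; apply: ler_sum => k /andP[/andP[k1 _] _].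
    by rewrite ler_wpM2r ?V0//; apply: prime_log_sum_le; exact: ltnW.
  have b1 : 1 - 3 / ln n%:R <= prime_log_sum n / ln n%:R.
    by rewrite ler_pdivlMr// mulrBl mul1r divfK ?gt_eqF.
  have b2 : prime_log_sum n / ln n%:R <= 1 + 6 / ln n%:R.
    by rewrite ler_pdivrMr// mulrDl mul1r divfK ?gt_eqF.
  move: b1 b2 s13 s32 e1 e2; set u := (ln n%:R)^-1; set v := (ln 2)^-1.
  by move=> *; apply/andP; split; lra.
exists (`|ln (ln 3)| + `|ln (ln 2)| + 1 + 6 / ln 2); split.
  by rewrite !addr_ge0// divr_ge0// ltW.
move=> n n1; have /andP[m1 m2] := main n n1; have /andP[w1 w2] := wE n n1.
have n2 : (1 < n.+1)%N by exact: ltnW.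
have mono : ln (ln n%:R) <= ln (ln n.+1%:R) :> R.
  rewrite ler_ln ?posrE ?ln_gt0n// ler_ln ?posrE ?ltr0n ?(ltnW n1)//.
  by rewrite ler_nat.
have a3 := ler_norm (ln (ln 3) : R); have a2 := ler_norm (- ln (ln 2) : R).
rewrite normrN in a2.
have p3 : 0 <= `|ln (ln 3)| :> R by []; have p2 : 0 <= `|ln (ln 2)| :> R by [].
have i2 : 0 <= (ln 2)^-1 :> R by rewrite invr_ge0 ltW.
rewrite ler_norml; move: m1 m2 i2; set v := (ln 2)^-1 => *.
by apply/andP; split; lra.
Qed.

(** Chebyshev's bound gains a factor [ln t] over the sum of inverse squares of all integers beyond
    [t]; this gain is what makes two digits beyond the cut rare. *)
Lemma prime_square_tail t P : (1 < t)%N ->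
  \sum_(t.+1 <= p < P | prime p) (p%:R ^+ 2)^-1 <= 12 / (t%:R * ln t%:R) :> R.
Proof.
move=> t1; have lt0 := ln_gt0n t1; have t1' := natr_ge1 R (ltnW t1).
suff h : \sum_(t.+1 <= p < P | prime p) ln p%:R / p%:R ^+ 2 <= 12 / t%:R :> R.
  rewrite invfM mulrA ler_pdivlMr// mulr_suml; apply: le_trans h.
  rewrite big_nat_cond [leRHS]big_nat_cond; apply: ler_sum => p /andP[/andP[tp _] _].
  rewrite mulrC ler_wpM2r ?invr_ge0 ?exprn_ge0// ler_ln ?posrE ?ltr0n ?(ltnW t1)//; last lia.
  by rewrite ler_nat ltnW.
have [Pt|tP] := leqP P t; first by rewrite big_geq ?divr_ge0// ltnW.
(* Partial summation as an induction: the boundary term [theta(x) / x^2] is kept exact and the rest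
   is majorised by a telescoping sum; 12 is twice the Chebyshev constant. *)
have key n : \sum_(t.+1 <= p < (t + n).+1 | prime p) ln p%:R / p%:R ^+ 2 <=
   chebyshev_theta R (t + n) / (t + n)%:R ^+ 2 + 12 * (t%:R^-1 - (t + n)%:R^-1).
  elim: n => [|n IH].
    rewrite addn0 subrr mulr0 addr0 big_geq// divr_ge0 ?exprn_ge0//.
    by apply: sumr_ge0 => p _; exact: ln_ge0n.
  rewrite addnS sum_prime_recr; last lia.
  apply: le_trans (lerD IH (lexx _)) _.
  have -> : chebyshev_theta R (t + n).+1 = chebyshev_theta R (t + n) +
      (if prime (t + n).+1 then ln (t + n).+1%:R else 0) by exact: sum_prime_recr.
  have := chebyshev_theta_le R (t + n).
  have : 1 <= (t + n)%:R :> R by rewrite natr_ge1//; lia.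
  rewrite -[(t + n).+1%:R]natr1; set th := chebyshev_theta R _; move: (t + n)%:R => x x1 thx.
  set l := (if _ then _ else _); set l' := (if _ then _ else _).
  have -> : l = l' / (x + 1) ^+ 2 by rewrite /l /l'; case: ifP => // _; rewrite mul0r.
  rewrite -subr_ge0.
  have -> : (th + l') / (x + 1) ^+ 2 + 12 * (t%:R^-1 - (x + 1)^-1) -
     (th / x ^+ 2 + 12 * (t%:R^-1 - x^-1) + l' / (x + 1) ^+ 2) =
     (12 * x * (x + 1) - th * (2 * x + 1)) / (x ^+ 2 * (x + 1) ^+ 2).
    by field; do ?[apply/andP; split]; lra.
  apply: divr_ge0; last by apply: mulr_ge0; apply: exprn_ge0; lra.
  have : th * (2 * x + 1) <= 6 * x * (2 * x + 1) by rewrite ler_wpM2r//; lra.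
  by nra.
have := key (P - t.+1)%N; have -> : (t + (P - t.+1)).+1 = P by lia.
move=> /le_trans; apply.
have := chebyshev_theta_le R (t + (P - t.+1)).
have : 1 <= (t + (P - t.+1))%:R :> R by rewrite natr_ge1//; lia.
set th := chebyshev_theta R _; move: (t + _)%:R => x x1 thx.
have : th / x ^+ 2 <= 12 / x.
  rewrite ler_pdivrMr; last by rewrite exprn_gt0//; lra.
  have -> : 12 / x * x ^+ 2 = 12 * x by field; lra.
  lra.
by set u := th / _; set v := x^-1; lra.
Qed.

Definition prime_count n : R := \sum_(0 <= p < n.+1 | prime p) 1.

(** Split at [sqrt n]: below it the trivial count gives 4 of the 16, and above it [ln p >= ln n / 2]
    turns the count into [chebyshev_theta], giving [2 * 6 = 12]. *)
Lemma prime_count_le n : (1 < n)%N -> prime_count n <= 16 * n%:R / ln n%:R.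
Proof.
move=> n1; have lnn := ln_gt0n n1; have n1' := natr_ge1 R (ltnW n1).
pose r : R := Num.sqrt n%:R; have r2 : r ^+ 2 = n%:R by rewrite sqr_sqrtr//; lra.
have r0 : 0 <= r by exact: sqrtr_ge0.
have r1 : 1 <= r by move: r2 r0; rewrite expr2 => *; nra.
have rn : r <= n%:R by rewrite -r2 expr2; nra.
pose m := Num.truncn r.
have /andP[mr rm] := truncn_itv r0; rewrite -/m in mr rm.
have mn : (m <= n)%N by rewrite -(ler_nat R); lra.
have lnr : ln n%:R = 2 * ln r by rewrite -r2 lnXn ?mulr_natl//; lra.
have lr : ln r <= r by apply/ltW/ln_sublinear; lra.
have h1 : \sum_(0 <= p < m.+1 | prime p) 1 <= 4 * n%:R / ln n%:R :> R.
  rewrite ler_pdivlMr//.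
  apply: (@le_trans _ _ (2 * r * (2 * r))); last by rewrite -r2 expr2; lra.
  apply: ler_pM; [by apply: sumr_ge0|exact: ltW| |lra].
  apply: (@le_trans _ _ (\sum_(0 <= p < m.+1) (1 : R))).
    by rewrite big_mkcond; apply: ler_sum => p _; case: ifP.
  by rewrite sumr_const_nat subn0 -[_ *+ _]/(_%:R) -natr1; lra.
have h2 : \sum_(m.+1 <= p < n.+1 | prime p) 1 <= 2 / ln n%:R * chebyshev_theta R n.
  rewrite /chebyshev_theta (@big_cat_nat _ _ _ m.+1 0 n.+1)//= mulrDr.
  apply: (@le_trans _ _ (2 / ln n%:R * \sum_(m.+1 <= p < n.+1 | prime p) ln p%:R)).
    rewrite mulr_sumr big_nat_cond [leRHS]big_nat_cond.
    apply: ler_sum => p /andP[/andP[mp _] _].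
    rewrite mulrAC ler_pdivlMr// mul1r lnr ler_wpM2l// ler_ln ?posrE ?ltr0n; [|lra|lia].
    by rewrite ltW// (lt_le_trans rm)// ler_nat.
  by rewrite lerDr mulr_ge0 ?divr_ge0//; [exact: ltW|apply: sumr_ge0 => p _; exact: ln_ge0n].
rewrite /prime_count (@big_cat_nat _ _ _ m.+1 0 n.+1)//=.
apply: le_trans (lerD h1 h2) _.
have h3 := ler_wpM2l (_ : 0 <= 2 / ln n%:R) (chebyshev_theta_le R n).
apply: le_trans (lerD (lexx _) (h3 _)) _; first by rewrite divr_ge0// ltW.
by rewrite le_eqVlt; apply/orP; left; apply/eqP; ring.
Qed.

End Mertens.

(** * The transfer operator of the Gauss map *)

Section Transfer.
Variable R : realType.
Implicit Types (s x y : R) (g : R -> R) (k m n N : nat).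

Definition branch_prob k s : R := (1 + s) / ((k%:R + s) * (k%:R + 1 + s)).
Definition tail_prob k s : R := (1 + s) / (k%:R + s).

(* All branches [k >= N] are sent to the point [0 = lim (k + s)^-1]: the operator stays
   Markov while being a finite sum. *)
Definition transfer N g s : R :=
  \sum_(1 <= k < N) branch_prob k s * g (k%:R + s)^-1 + tail_prob N s * g 0.

Definition unit_lipschitz (M : R) g := forall x y, 0 <= x <= 1 -> 0 <= y <= 1 ->
  `|g x - g y| <= M * `|x - y|.

Lemma branch_probE k s : (0 < k)%N -> 0 <= s ->
  branch_prob k s = tail_prob k s - tail_prob k.+1 s.
Proof.
move=> /(natr_ge1 R) k0 s0; rewrite /branch_prob /tail_prob -natr1.
by field; apply/andP; split; lra.
Qed.

Lemma branch_prob_ge0 k s : 0 <= s -> 0 <= branch_prob k s.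
Proof.
by move=> s0; rewrite /branch_prob divr_ge0 ?mulr_ge0 ?addr_ge0 ?ler0n.
Qed.

Lemma tail_prob_ge0 k s : 0 <= s -> 0 <= tail_prob k s.
Proof. by move=> s0; rewrite /tail_prob divr_ge0 ?addr_ge0 ?ler0n. Qed.

Lemma tail_prob1 s : 0 <= s -> tail_prob 1 s = 1.
Proof. by move=> s0; rewrite /tail_prob divff//; lra. Qed.

Lemma sum_branch_prob m N s : (0 < m <= N)%N -> 0 <= s ->
  \sum_(m <= k < N) branch_prob k s = tail_prob m s - tail_prob N s.
Proof.
move=> /andP[m0 mN] s0; elim: N mN => [|N IH].
  by rewrite leqn0 => /eqP m0'; rewrite m0' in m0.
rewrite leq_eqVlt => /predU1P[->|]; first by rewrite big_geq// subrr.
rewrite ltnS => mN; rewrite big_nat_recr//= IH// branch_probE ?(leq_trans m0)//.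
by ring.
Qed.

Lemma tail_prob_le N s : (0 < N)%N -> 0 <= s <= 1 -> tail_prob N s <= 2 / N%:R.
Proof.
move=> /(natr_ge1 R) N0 /andP[s0 s1]; rewrite /tail_prob ler_pdivrMr; last lra.
rewrite mulrAC ler_pdivlMr; last lra.
by nra.
Qed.

Lemma branch_prob_le k s : (0 < k)%N -> 0 <= s <= 1 -> branch_prob k s <= 2 / k%:R ^+ 2.
Proof.
move=> /(natr_ge1 R) k0 /andP[s0 s1]; rewrite /branch_prob.
rewrite ler_pdivrMr; last by rewrite mulr_gt0//; lra.
rewrite mulrAC ler_pdivlMr; last by rewrite exprn_gt0//; lra.
rewrite expr2; nra.
Qed.

Lemma inv_branch_itv k s : (0 < k)%N -> 0 <= s -> 0 <= (k%:R + s)^-1 <= 1.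
Proof.
move=> /(natr_ge1 R) k0 s0; rewrite invr_ge0 invf_le1 ?addr_ge0//; last lra.
by apply/andP; split; lra.
Qed.

Lemma transfer_ge N g a s : (0 < N)%N -> 0 <= s <= 1 ->
  (forall x, 0 <= x <= 1 -> a <= g x) -> a <= transfer N g s.
Proof.
move=> N0 /andP[s0 s1] ag; rewrite /transfer.
have -> : a = \sum_(1 <= k < N) branch_prob k s * a + tail_prob N s * a.
  by rewrite -mulr_suml sum_branch_prob// tail_prob1// -mulrDl subrK mul1r.
rewrite lerD//; last by rewrite ler_wpM2l ?tail_prob_ge0// ag// lexx ler01.
rewrite big_nat_cond [leRHS]big_nat_cond ler_sum// => k /andP[/andP[k0 _] _].
by rewrite ler_wpM2l ?branch_prob_ge0// ag// inv_branch_itv.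
Qed.

Lemma transferB N g h s :
  transfer N (fun x => g x - h x) s = transfer N g s - transfer N h s.
Proof.
rewrite /transfer mulrBr opprD addrACA; congr (_ + _).
by rewrite -sumrB; apply: eq_bigr => k _; rewrite mulrBr.
Qed.

Lemma transferZ N c g s : transfer N (fun x => c * g x) s = c * transfer N g s.
Proof.
rewrite /transfer mulrDr mulr_sumr mulrCA; congr (_ + _).
by apply: eq_bigr => k _; rewrite mulrCA.
Qed.

Lemma transfer_sum N (I : Type) (r : seq I) (P : pred I) (F : I -> R -> R) s :
  transfer N (fun x => \sum_(i <- r | P i) F i x) s =
  \sum_(i <- r | P i) transfer N (F i) s.
Proof.
rewrite /transfer big_split/= -mulr_sumr; congr (_ + _).
by rewrite exchange_big/=; apply: eq_bigr => k _; rewrite mulr_sumr.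
Qed.

Lemma transferN N g s : transfer N (fun x => - g x) s = - transfer N g s.
Proof.
rewrite -[RHS]mulN1r -transferZ; congr transfer.
by apply/funext => x; rewrite mulN1r.
Qed.

Lemma transfer_le N g a s : (0 < N)%N -> 0 <= s <= 1 ->
  (forall x, 0 <= x <= 1 -> g x <= a) -> transfer N g s <= a.
Proof.
move=> N0 s01 ga; rewrite -lerN2 -transferN; apply: transfer_ge => // x x01.
by rewrite lerN2 ga.
Qed.

Lemma transfer_mono N g h s : (0 < N)%N -> 0 <= s <= 1 ->
  (forall x, 0 <= x <= 1 -> g x <= h x) -> transfer N g s <= transfer N h s.
Proof.
move=> N0 s01 gh; rewrite -subr_ge0 -transferB; apply: transfer_ge => // x x01.
by rewrite subr_ge0 gh.
Qed.

Lemma transfer_dist N g h e s : (0 < N)%N -> 0 <= s <= 1 ->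
  (forall x, 0 <= x <= 1 -> `|g x - h x| <= e) ->
  `|transfer N g s - transfer N h s| <= e.
Proof.
move=> N0 s01 gh; rewrite -transferB ler_norml; apply/andP; split.
  by apply: transfer_ge => // x /gh; rewrite ler_norml => /andP[].
by apply: transfer_le => // x /gh; rewrite ler_norml => /andP[].
Qed.

Lemma iter_transfer_itv N n g a b s : (0 < N)%N -> 0 <= s <= 1 ->
  (forall x, 0 <= x <= 1 -> a <= g x <= b) -> a <= iter n (transfer N) g s <= b.
Proof.
move=> N0 s01 gab; elim: n s s01 => [|n IH] s s01; first exact: gab.
rewrite iterS transfer_ge ?transfer_le// => x /IH /andP[] //.
Qed.

Lemma iter_transfer_dist N n g h e s : (0 < N)%N -> 0 <= s <= 1 ->
  (forall x, 0 <= x <= 1 -> `|g x - h x| <= e) ->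
  `|iter n (transfer N) g s - iter n (transfer N) h s| <= e.
Proof.
by move=> N0 s01 gh; elim: n s s01 => [|n IH] s s01; [exact: gh|exact: transfer_dist].
Qed.

Lemma iter_transfer_mono N n g h s : (0 < N)%N -> 0 <= s <= 1 ->
  (forall x, 0 <= x <= 1 -> g x <= h x) ->
  iter n (transfer N) g s <= iter n (transfer N) h s.
Proof.
by move=> N0 s01 gh; elim: n s s01 => [|n IH] s s01; [exact: gh|exact: transfer_mono].
Qed.

Lemma iter_transfer_sum N n (I : Type) (r : seq I) (P : pred I) (F : I -> R -> R) s :
  iter n (transfer N) (fun x => \sum_(i <- r | P i) F i x) s =
  \sum_(i <- r | P i) iter n (transfer N) (F i) s.
Proof.
elim: n s => [|n IH] s //=; rewrite -transfer_sum; congr transfer.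
by apply/funext => x; exact: IH.
Qed.

Lemma iter_transferZ N n c g s :
  iter n (transfer N) (fun x => c * g x) s = c * iter n (transfer N) g s.
Proof.
elim: n s => [|n IH] s //=; rewrite -transferZ; congr transfer.
by apply/funext => x; exact: IH.
Qed.

(** Abel summation with the tail weight as boundary term: differences of weights are traded for
    differences of values, which a Lipschitz bound controls. *)
Lemma sum_telescope_tail (S G : nat -> R) N : (0 < N)%N ->
  \sum_(1 <= k < N) (S k - S k.+1) * G k + S N * G N =
  S 1%N * G 1%N + \sum_(1 <= k < N) S k.+1 * (G k.+1 - G k).
Proof.
elim: N => // -[_ _|N IH _]; first by rewrite !big_geq// addr0 add0r.
rewrite big_nat_recr//= [in RHS]big_nat_recr//= addrA -IH//.
by ring.
Qed.

(** The term [(N+2)^-2] serves twice: it closes the induction, and in the contraction estimate it is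
    the contribution of the jump from the last branch to the tail value [g 0]. *)
Lemma inv_cube_sum_le N :
  \sum_(1 <= k < N.+1) ((k%:R + 1) ^+ 3)^-1 + ((N%:R + 2) ^+ 2)^-1 <= 1 / 4 :> R.
Proof.
elim: N => [|N IH]; first by rewrite big_geq// !add0r; lra.
apply: le_trans IH; rewrite big_nat_recr//= -addrA lerD2l -[N.+1%:R]natr1.
have : 0 <= N%:R :> R by [].
move: (N%:R) => t t0; rewrite -subr_ge0.
have -> : ((t + 2) ^+ 2)^-1 - (((t + 1 + 1) ^+ 3)^-1 + ((t + 1 + 2) ^+ 2)^-1) =
  ((t + 2) ^+ 2 - (t + 2) - 1) / ((t + 2) ^+ 3 * (t + 3) ^+ 2).
  by field; do ?[apply/andP; split]; lra.
rewrite divr_ge0//; first by nra.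
by rewrite mulr_ge0// exprn_ge0//; lra.
Qed.

End Transfer.

(** * Contraction of Lipschitz constants *)

Section Contraction.
Variable R : realType.
Implicit Types (s x y : R) (g : R -> R) (k m n N : nat).

Lemma tail_probB k s x : (0 < k)%N -> 0 <= s -> 0 <= x ->
  tail_prob k.+1 s - tail_prob k.+1 x =
  k%:R * (s - x) / ((k%:R + 1 + s) * (k%:R + 1 + x)).
Proof.
move=> /(natr_ge1 R) k0 s0 x0; rewrite /tail_prob -natr1.
by field; apply/andP; split; lra.
Qed.

(** The difference splits into moving the points with fixed weights, which costs [2/3], and moving
    the weights with fixed points, which costs [1/4] after Abel summation; [2/3 + 1/4 = 11/12]. *)
Lemma unit_lipschitz_transfer M N g : (1 < N)%N -> 0 <= M ->
  unit_lipschitz M g -> unit_lipschitz (11 / 12 * M) (transfer N g).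
Proof.
move=> N1 M0 gM s x s01 x01; have N0 := ltnW N1.
have [/andP[s0 s1] /andP[x0 x1]] := (s01, x01).
(* The tail value is treated as the value of a branch [N], so that the tail weight becomes the
   boundary term of the Abel summation. *)
pose G k := if (k < N)%N then g (k%:R + x)^-1 else g 0.
have Gbig y : \sum_(1 <= k < N) branch_prob k y * g (k%:R + x)^-1 + tail_prob N y * g 0 =
    \sum_(1 <= k < N) branch_prob k y * G k + tail_prob N y * G N.
  rewrite {2}/G ltnn; congr (_ + _); apply: eq_big_nat => k /andP[_ kN].
  by rewrite /G kN.
have Gabel y : 0 <= y -> \sum_(1 <= k < N) branch_prob k y * G k + tail_prob N y * G N =
    G 1%N + \sum_(1 <= k < N) tail_prob k.+1 y * (G k.+1 - G k).
  move=> y0; rewrite -[G 1%N]mul1r -(tail_prob1 y0).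
  rewrite -(@sum_telescope_tail _ (fun k => tail_prob k y))//.
  congr (_ + _); apply: eq_big_nat => k /andP[k0 _].
  by rewrite branch_probE.
have -> : transfer N g s - transfer N g x =
    \sum_(1 <= k < N) branch_prob k s * (g (k%:R + s)^-1 - g (k%:R + x)^-1) +
    \sum_(1 <= k < N) (tail_prob k.+1 s - tail_prob k.+1 x) * (G k.+1 - G k).
  transitivity (transfer N g s - (\sum_(1 <= k < N) branch_prob k s * g (k%:R + x)^-1
      + tail_prob N s * g 0) +
    ((\sum_(1 <= k < N) branch_prob k s * g (k%:R + x)^-1 + tail_prob N s * g 0) -
     transfer N g x)); first by rewrite addrA subrK.
  congr (_ + _).
    rewrite /transfer opprD addrACA subrr addr0 -sumrB.
    by apply: eq_bigr => k _; rewrite mulrBr.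
  rewrite /transfer !Gbig !Gabel// opprD addrACA subrr add0r -sumrB.
  by apply: eq_bigr => k _; rewrite mulrBl.
have sx0 : 0 <= `|s - x| by [].
have dg k : (0 < k)%N -> `|g (k%:R + s)^-1 - g (k%:R + x)^-1| <=
    M * `|s - x| * ((k%:R + s) * (k%:R + x))^-1.
  move=> k0; apply: le_trans (gM _ _ (inv_branch_itv k0 s0) (inv_branch_itv k0 x0)) _.
  have k1 := natr_ge1 R k0.
  rewrite -mulrA ler_wpM2l//.
  have -> : (k%:R + s)^-1 - (k%:R + x)^-1 = (x - s) * ((k%:R + s) * (k%:R + x))^-1.
    by field; apply/andP; split; lra.
  by rewrite normrM distrC [`|_^-1|]ger0_norm// invr_ge0 mulr_ge0//; lra.
have first_sum : `|\sum_(1 <= k < N) branch_prob k s * (g (k%:R + s)^-1 - g (k%:R + x)^-1)|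
    <= 2 / 3 * (M * `|s - x|).
  rewrite big_ltn//; apply: le_trans (ler_normD _ _) _.
  (* The branch [k = 1] has weight [1/(2+s)] and difference quotient at most 1, giving [1/2]; the
     branches [k >= 2] have total weight at most [2/3] and quotient at most [1/4], giving [1/6]. *)
  have -> : 2 / 3 * (M * `|s - x|) = 1 / 2 * (M * `|s - x|) + 1 / 6 * (M * `|s - x|).
    by field.
  apply: lerD.
    rewrite normrM [`|branch_prob 1 s|]ger0_norm ?branch_prob_ge0//.
    apply: le_trans (ler_wpM2l (branch_prob_ge0 _ s0) (dg 1%N isT)) _.
    rewrite mulrCA [leRHS]mulrC ler_wpM2l ?mulr_ge0// /branch_prob.
    have -> : (1 + s) / ((1 + s) * (1 + 1 + s)) * ((1 + s) * (1 + x))^-1 =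
      1 / ((2 + s) * (1 + s) * (1 + x)).
      by field; apply/and3P; split; lra.
    rewrite ler_pdivrMr; last by rewrite !mulr_gt0//; lra.
    have h1 : 1 <= (1 + s) * (1 + x) by nra.
    by rewrite -(mulrA (2 + s)); nra.
  apply: le_trans (ler_norm_sum _ _ _) _.
  apply: (@le_trans _ _ (\sum_(2 <= k < N) branch_prob k s * (1 / 4 * (M * `|s - x|)))).
    rewrite big_nat_cond [leRHS]big_nat_cond ler_sum// => k /andP[/andP[k2 _] _].
    rewrite normrM [`|branch_prob k s|]ger0_norm ?branch_prob_ge0//.
    rewrite ler_wpM2l ?branch_prob_ge0//.
    apply: le_trans (dg k (ltnW k2)) _; rewrite mulrC ler_wpM2r ?mulr_ge0//.
    have k2R : 2 <= k%:R :> R by rewrite ler_nat.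
    rewrite div1r lef_pV2 ?posrE//; first by nra.
    by rewrite mulr_gt0//; lra.
  rewrite -mulr_suml sum_branch_prob// [in leRHS]mulrC mulrA [leRHS]mulrC.
  rewrite ler_wpM2r ?mulr_ge0//.
  have := tail_prob_ge0 N s0.
  have : tail_prob 2 s <= 2 / 3.
    by rewrite /tail_prob ler_pdivrMr; lra.
  lra.
have second_sum : `|\sum_(1 <= k < N) (tail_prob k.+1 s - tail_prob k.+1 x) * (G k.+1 - G k)|
    <= 1 / 4 * (M * `|s - x|).
  case: N N1 {N0 Gbig Gabel first_sum} @G => // -[//|N] _ G.
  apply: le_trans (ler_norm_sum _ _ _) _.
  apply: le_trans (ler_wpM2r _ (inv_cube_sum_le R N)); last by rewrite mulr_ge0.
  rewrite [leLHS]big_nat_recr//= [leRHS]mulrDl; apply: lerD.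
    rewrite mulr_suml big_nat_cond [leRHS]big_nat_cond ler_sum// => k /andP[/andP[k0 kN] _].
    have k1 := natr_ge1 R k0.
    have [k1N k2N] : (k.+1 < N.+2)%N /\ (k < N.+2)%N by split=> //; exact: ltnW.
    rewrite normrM tail_probB// /G k1N k2N.
    have := gM _ _ (inv_branch_itv (ltn0Sn k) x0) (inv_branch_itv k0 x0).
    have -> : (k.+1%:R + x)^-1 - (k%:R + x)^-1 = - ((k%:R + x) * (k%:R + 1 + x))^-1.
      by rewrite -natr1; field; apply/andP; split; lra.
    rewrite normrN [`|_^-1|]ger0_norm; last by rewrite invr_ge0 mulr_ge0//; lra.
    move=> gk; rewrite !normrM [`|k%:R|]ger0_norm//.
    rewrite [`|_^-1|]ger0_norm; last by rewrite invr_ge0 mulr_ge0//; lra.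
    apply: le_trans (ler_wpM2l _ gk) _; first by rewrite !mulr_ge0// invr_ge0 mulr_ge0//; lra.
    rewrite [leLHS](_ : _ = (M * `|s - x|) * (k%:R /
       ((k%:R + 1 + s) * (k%:R + 1 + x) * ((k%:R + x) * (k%:R + 1 + x))))); last first.
      by field; apply/and3P; split; lra.
    rewrite [leRHS]mulrC ler_wpM2l ?mulr_ge0//.
    rewrite ler_pdivrMr; last by rewrite !mulr_gt0//; lra.
    rewrite mulrC ler_pdivlMr; last by rewrite exprn_gt0//; lra.
    rewrite [leLHS](_ : _ = ((k%:R + 1) * (k%:R + 1)) * (k%:R * (k%:R + 1))); last by ring.
    by rewrite ler_pM ?mulr_ge0//; first [nra | lra].
  have k0 : (0 < N.+1)%N by [].
  have k1 := natr_ge1 R k0.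
  rewrite normrM tail_probB// /G ltnn leqnn.
  have := gM 0 _ _ (inv_branch_itv k0 x0); rewrite lexx ler01 => /(_ isT).
  rewrite sub0r normrN [`|_^-1|]ger0_norm; last by rewrite invr_ge0//; lra.
  move=> gk; rewrite !normrM [`|N.+1%:R|]ger0_norm//.
  rewrite [`|_^-1|]ger0_norm; last by rewrite invr_ge0 mulr_ge0//; lra.
  apply: le_trans (ler_wpM2l _ gk) _; first by rewrite !mulr_ge0// invr_ge0 mulr_ge0//; lra.
  rewrite [leLHS](_ : _ = (M * `|s - x|) * (N.+1%:R /
       ((N.+1%:R + 1 + s) * (N.+1%:R + 1 + x) * (N.+1%:R + x)))); last first.
    by field; apply/and3P; split; lra.
  rewrite [leRHS]mulrC ler_wpM2l ?mulr_ge0//.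
  have -> : N%:R + 2 = N.+1%:R + 1 :> R by rewrite -natr1; ring.
  rewrite ler_pdivrMr; last by rewrite !mulr_gt0//; lra.
  rewrite mulrC ler_pdivlMr; last by rewrite exprn_gt0//; lra.
  rewrite [leLHS](_ : _ = ((N.+1%:R + 1) * (N.+1%:R + 1)) * N.+1%:R); last by ring.
  by rewrite ler_pM ?mulr_ge0//; first [nra | lra].
apply: le_trans (ler_normD _ _) _; apply: le_trans (lerD first_sum second_sum) _.
by rewrite -mulrDl -[leRHS]mulrA ler_wpM2r ?mulr_ge0//; lra.
Qed.

Lemma unit_lipschitz_iter_transfer M N n g : (1 < N)%N -> 0 <= M ->
  unit_lipschitz M g -> unit_lipschitz ((11 / 12) ^+ n * M) (iter n (transfer N) g).
Proof.
move=> N1 M0 gM; elim: n => [|n IH]; first by rewrite mul1r.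
by rewrite exprS -mulrA; apply: unit_lipschitz_transfer => //; rewrite mulr_ge0// exprn_ge0//; lra.
Qed.

End Contraction.

(** * The symmetric kernel and its Riemann sums *)

Section Duality.
Variable R : realType.
Implicit Types (s x y : R) (g : R -> R) (F : R -> R -> R) (k m n N : nat).

(** The vehicle for letting the number of branches tend to infinity; it likewise removes the mesh of
    the Riemann sums. *)
Lemma ler_addinv (a b C : R) m :
  (forall M, (m < M)%N -> a <= b + C / M%:R) -> a <= b.
Proof.
move=> ab; apply/ler_addgt0Pr => e e0.
pose M := (m + (Num.truncn (`|C| / e)).+1)%N.
have M0 : 0 < M%:R :> R by rewrite ltr0n /M addnS.
apply: le_trans (ab M _) _; first by rewrite /M -addn1 leq_add2l.
rewrite lerD2l ler_pdivrMr// mulrC -ler_pdivrMr//.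
apply: le_trans (_ : `|C| / e <= _); first by rewrite ler_pM2r ?invr_gt0// ler_norm.
by rewrite /M natrD; apply: ler_wpDl => //; apply/ltW/truncnS_gt.
Qed.

Lemma transferD N g h s :
  transfer N (fun x => g x + h x) s = transfer N g s + transfer N h s.
Proof.
rewrite /transfer mulrDr addrACA; congr (_ + _).
by rewrite -big_split; apply: eq_bigr => k _; rewrite mulrDr.
Qed.

(** Fubini for operators acting on the two arguments of [F], purely algebraic because the sums are
    finite. *)
Lemma transferC N F s x :
  transfer N (fun y => transfer N (F y) x) s = transfer N (fun z => transfer N (F^~ z) s) x.
Proof.
rewrite {2 3}/transfer transferD transferZ transfer_sum; congr (_ + _).
by apply: eq_bigr => k _; rewrite transferZ.
Qed.

Lemma transfer_iterC N n F s x :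
  transfer N (fun y => iter n (transfer N) (F y) x) s =
  iter n (transfer N) (fun z => transfer N (F^~ z) s) x.
Proof.
elim: n x => [//|n IH] x; rewrite iterS -[in LHS]/(transfer _ _ _).
rewrite (transferC N (fun y => iter n (transfer N) (F y))).
by congr transfer; apply/funext => z; exact: IH.
Qed.

(** This is [1 + x] times the derivative of [cond_cdf s] at [x]: the conditional density of [T^n y]
    relative to [dx / (1 + x)], the unnormalised Gauss measure. The factor [1 + x] is what makes it
    symmetric. *)
Definition gauss_kernel s x : R := (1 + s) * (1 + x) / (1 + s * x) ^+ 2.

Lemma gauss_kernelC s x : gauss_kernel s x = gauss_kernel x s.
Proof. by rewrite /gauss_kernel [(1 + s) * _]mulrC [s * x]mulrC. Qed.

Lemma gauss_kernel0 x : gauss_kernel 0 x = 1 + x.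
Proof. by rewrite /gauss_kernel mul0r !addr0 mul1r expr1n divr1. Qed.

Lemma transfer_gauss_kernel N s x : 0 <= s -> 0 <= x ->
  transfer N (gauss_kernel^~ x) s =
  \sum_(1 <= k < N) (1 + s) * (1 + x) / (k%:R + s + x) ^+ 2 + tail_prob N s * (1 + x).
Proof.
move=> s0 x0; rewrite /transfer gauss_kernel0; congr (_ + _).
apply: eq_big_nat => k /andP[k0 _]; have k1 := natr_ge1 R k0.
rewrite /branch_prob /gauss_kernel.
field; do ?[apply/andP; split]; nra.
Qed.

(* Both sides contain [\sum_k (1 + s) * (1 + x) / (k + s + x) ^+ 2], which is symmetric;
   only the truncated branches differ. *)
Lemma transfer_gauss_kernelC N s x : (0 < N)%N -> 0 <= s <= 1 -> 0 <= x <= 1 ->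
  `|transfer N (gauss_kernel^~ x) s - transfer N (gauss_kernel s) x| <= 4 / N%:R.
Proof.
move=> N0 s01 x01; have [/andP[s0 s1] /andP[x0 x1]] := (s01, x01).
have -> : gauss_kernel s = gauss_kernel^~ s.
  by apply/funext => y; exact: gauss_kernelC.
rewrite !transfer_gauss_kernel//.
have <- : \sum_(1 <= k < N) (1 + s) * (1 + x) / (k%:R + s + x) ^+ 2 =
    \sum_(1 <= k < N) (1 + x) * (1 + s) / (k%:R + x + s) ^+ 2.
  by apply: eq_bigr => k _; rewrite [(1 + s) * _]mulrC addrAC.
rewrite opprD addrACA subrr add0r.
have hs := tail_prob_le N0 s01; have hx := tail_prob_le N0 x01.
have hs0 := tail_prob_ge0 N s0; have hx0 := tail_prob_ge0 N x0.
have N4 : 4 / N%:R = 2 / N%:R * 2 :> R by ring.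
rewrite N4 ler_norml; set a := tail_prob N s in hs hs0 *.
set b := tail_prob N x in hx hx0 *; set c := 2 / N%:R in hs hx *.
have h1 : 0 <= a * (1 + x) <= c * 2 by apply/andP; split; [apply: mulr_ge0|apply: ler_pM]; lra.
have h2 : 0 <= b * (1 + s) <= c * 2 by apply/andP; split; [apply: mulr_ge0|apply: ler_pM]; lra.
by apply/andP; split; lra.
Qed.

(** One application of the operator in [s] is exchanged for one in [x] at the cost [4/N]; as
    operators in different variables commute, the exchange can be repeated under the remaining
    iterates. *)
Lemma iter_transfer_gauss_kernelC N n s x : (0 < N)%N -> 0 <= s <= 1 -> 0 <= x <= 1 ->
  `|iter n (transfer N) (gauss_kernel^~ x) s - iter n (transfer N) (gauss_kernel s) x|
    <= 4 / N%:R * n%:R.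
Proof.
move=> N0 s01 x01; elim: n s s01 => [|n IH] s s01.
  by rewrite /= subrr normr0 mulr0.
rewrite iterS -[n.+1%:R]natr1 mulrDr mulr1.
have := transfer_dist N0 s01 IH; rewrite transfer_iterC iterSr => h.
have := @iter_transfer_dist _ N n (fun z => transfer N (gauss_kernel^~ z) s)
  (transfer N (gauss_kernel s)) (4 / N%:R) x N0 x01.
move=> /(_ (fun z z01 => transfer_gauss_kernelC N0 s01 z01)) h'.
apply: le_trans (ler_distD _ _ _) (lerD h h').
Qed.

Lemma harmonic_block_ge M : (0 < M)%N -> ln 2 <= \sum_(0 <= i < M) (M + i)%:R^-1 :> R.
Proof.
move=> M0.
have lnE k : ln (M + k)%:R - ln M%:R <= \sum_(0 <= i < k) (M + i)%:R^-1 :> R.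
  elim: k => [|k IH]; first by rewrite addn0 subrr big_geq.
  rewrite big_nat_recr//= addnS.
  have Mk : 0 < (M + k)%:R :> R by rewrite ltr0n addn_gt0 M0.
  suff : ln (M + k).+1%:R <= ln (M + k)%:R + (M + k)%:R^-1 :> R by lra.
  have -> : (M + k).+1%:R = (M + k)%:R * (1 + (M + k)%:R^-1) :> R.
    by rewrite mulrDr mulr1 divff ?gt_eqF// natr1.
  rewrite lnM ?posrE ?addr_gt0 ?invr_gt0// lerD2l le_ln1Dx//.
  by rewrite (@lt_trans _ _ 0) ?invr_gt0// ltrN10.
have := lnE M; rewrite addnn -muln2 natrM lnM ?posrE ?ltr0n//.
by rewrite addrC addKr.
Qed.

Lemma harmonic_block_le M : (0 < M)%N -> \sum_(0 <= i < M) (M + i).+1%:R^-1 <= ln 2 :> R.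
Proof.
move=> M0.
have lnE k : \sum_(0 <= i < k) (M + i).+1%:R^-1 <= ln (M + k)%:R - ln M%:R :> R.
  elim: k => [|k IH]; first by rewrite addn0 subrr big_geq.
  rewrite big_nat_recr// addnS; apply: le_trans (lerD IH (lexx _)) _.
  have Mk : 0 < (M + k)%:R :> R by rewrite ltr0n addn_gt0 M0.
  have Mk1 : 1 <= (M + k)%:R :> R by rewrite (ler_nat R 1%N) addn_gt0 M0.
  suff : ln (M + k)%:R <= ln (M + k).+1%:R - (M + k).+1%:R^-1 :> R.
    by move: (ln _) (ln _) (_^-1) => a b c; lra.
  have -> : (M + k)%:R = (M + k).+1%:R * (1 - (M + k).+1%:R^-1) :> R.
    by rewrite mulrBr mulr1 divff ?pnatr_eq0// -natr1 addrK.
  have i1 : (M + k).+1%:R^-1 < 1 :> R.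
    by rewrite invf_lt1 ?ltr0n// (ltr_nat R 1%N) ltnS addn_gt0 M0.
  rewrite lnM ?posrE ?subr_gt0 ?ltr0n// lerD2l le_ln1Dx//.
  by rewrite ltrN2.
have := lnE M; rewrite addnn -muln2 natrM lnM ?posrE ?ltr0n//.
by rewrite [ln _ + _]addrC addrK.
Qed.

(* Distribution function of [T^n y] given [a_1, ..., a_n], where [s = q_(n-1) / q_n]
   (Borel and Levy). *)
Definition cond_cdf s x : R := (1 + s) * x / (1 + s * x).

Lemma cond_cdfB s x y : 0 <= s -> 0 <= x -> 0 <= y ->
  cond_cdf s y - cond_cdf s x = (1 + s) * (y - x) / ((1 + s * x) * (1 + s * y)).
Proof.
move=> s0 x0 y0; rewrite /cond_cdf; field.
by do ?[apply/andP; split]; nra.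
Qed.

(** The density [gauss_kernel s x / (1 + x) = (1 + s) / (1 + s x)^2] is nonincreasing in [x], so the
    mass of an interval lies between its length times the two end values. *)
Lemma cond_cdf_step s x d : 0 <= s <= 1 -> 0 <= x -> 0 <= d ->
  d / (1 + (x + d)) * gauss_kernel s (x + d) <= cond_cdf s (x + d) - cond_cdf s x
   <= d / (1 + x) * gauss_kernel s x.
Proof.
move=> /andP[s0 s1] x0 d0; rewrite cond_cdfB ?addr_ge0// /gauss_kernel.
have sx : 0 < 1 + s * x by nra.
have sxd : 0 < 1 + s * (x + d) by nra.
have le_sx : 1 + s * x <= 1 + s * (x + d) by nra.
have -> : d / (1 + (x + d)) * ((1 + s) * (1 + (x + d)) / (1 + s * (x + d)) ^+ 2) =
    (1 + s) * d / (1 + s * (x + d)) ^+ 2.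
  by field; do ?[apply/andP; split]; lra.
have -> : d / (1 + x) * ((1 + s) * (1 + x) / (1 + s * x) ^+ 2) =
    (1 + s) * d / (1 + s * x) ^+ 2.
  by field; do ?[apply/andP; split]; lra.
have -> : x + d - x = d by ring.
have sd : 0 <= (1 + s) * d by rewrite mulr_ge0//; lra.
apply/andP; split; rewrite ler_wpM2l// lef_pV2 ?posrE ?mulr_gt0// expr2.
  by rewrite ler_wpM2r// ltW.
by rewrite ler_wpM2l// ltW.
Qed.

End Duality.

(** * The limit of the iterates of [1 + x] *)

Section InvariantDensity.
Variable R : realType.
Implicit Types (s x y : R) (g : R -> R) (F : R -> R -> R) (k m n N M : nat).

Lemma iter_transfer1 N n c s : (0 < N)%N -> 0 <= s <= 1 ->
  iter n (transfer N) (fun=> c) s = c.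
Proof.
move=> N0 s01; apply/eqP; rewrite eq_le andbC; apply: iter_transfer_itv => // x _.
by rewrite lexx.
Qed.

Lemma harmonic_block_diff M : (0 < M)%N ->
  \sum_(0 <= i < M) (M + i)%:R^-1 <= \sum_(0 <= i < M) (M + i).+1%:R^-1 + M%:R^-1 :> R.
Proof.
move=> M0; rewrite -lerBlDl -sumrB.
rewrite (eq_bigr (fun i => - ((M + i.+1)%:R^-1) - - (M + i)%:R^-1)); last first.
  by move=> i _; rewrite opprK addrC addnS.
rewrite (telescope_sumr (fun i => - (M + i)%:R^-1))// addn0 opprK gerDr.
by rewrite oppr_le0 invr_ge0.
Qed.

(** A discrete form of the statement that the kernel integrates to 1 against [dx / (1 + x)]:
    [cond_cdf s] runs from 0 to 1, and [(M + i)^-1] is the mesh [1/M] divided by [1 + i/M]. *)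
Lemma kernel_partition s M : (0 < M)%N -> 0 <= s <= 1 ->
  \sum_(0 <= i < M) (M + i).+1%:R^-1 * gauss_kernel s (i.+1%:R / M%:R) <= 1
   <= \sum_(0 <= i < M) (M + i)%:R^-1 * gauss_kernel s (i%:R / M%:R).
Proof.
move=> M0 s01; have /andP[s0 s1] := s01.
have MR : 0 < M%:R :> R by rewrite ltr0n.
have cdf1 : cond_cdf s 1 = 1 by rewrite /cond_cdf !mulr1 divff//; lra.
have cdf0 : cond_cdf s 0 = 0 by rewrite /cond_cdf mulr0 mul0r.
have xS i : i.+1%:R / M%:R = i%:R / M%:R + M%:R^-1 :> R.
  by rewrite -natr1 mulrDl mul1r.
have Mi i : (M + i)%:R^-1 = M%:R^-1 / (1 + i%:R / M%:R) :> R.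
  have i0 : 0 <= i%:R :> R by [].
  by rewrite natrD; field; do ?[apply/andP; split]; lra.
have := @telescope_sumr _ 0%N M (fun i => cond_cdf s (i%:R / M%:R)) (leq0n _).
rewrite divff ?gt_eqF// mul0r cdf1 cdf0 subr0 => tel; rewrite -[X in _ <= X <= _]tel.
have step i := @cond_cdf_step _ s (i%:R / M%:R) M%:R^-1 s01.
apply/andP; split; apply: ler_sum => i _.
  rewrite -addnS Mi xS.
  by have /andP[] := step i (divr_ge0 (ler0n _ _) (ltW MR)) (ltW (etrans (invr_gt0 _) MR)).
rewrite Mi xS.
by have /andP[] := step i (divr_ge0 (ler0n _ _) (ltW MR)) (ltW (etrans (invr_gt0 _) MR)).
Qed.

Lemma unit_lipschitz_1D : unit_lipschitz 1 (fun x : R => 1 + x).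
Proof. by move=> x y _ _; rewrite mul1r opprD addrACA subrr add0r. Qed.

Lemma iter_transfer_1D_dist N n s x : (1 < N)%N -> 0 <= s <= 1 -> 0 <= x <= 1 ->
  `|iter n (transfer N) (fun x => 1 + x) s - iter n (transfer N) (fun x => 1 + x) x|
   <= (11 / 12) ^+ n.
Proof.
move=> N1 s01 x01.
have := unit_lipschitz_iter_transfer n N1 ler01 unit_lipschitz_1D s01 x01.
rewrite mulr1; move/le_trans; apply.
rewrite -[leRHS]mulr1 ler_wpM2l//.
by move: s01 x01 => /andP[? ?] /andP[? ?]; rewrite ler_norml; apply/andP; split; lra.
Qed.

(** Since [1 + x] is the kernel at [s = 0], duality makes [a x] nearly equal to the iterate of
    [1 + x] at the point [x], and contraction makes the latter nearly the constant [kap]. Iterating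
    [kernel_partition], whose middle term 1 is fixed by the operator, yields [kap] times a Riemann
    sum of [dx / (1 + x)]; this sum is near [ln 2], which forces [kap] near [1 / ln 2]. *)
Lemma iter_transfer_1D_limit N n s : (1 < N)%N -> 0 <= s <= 1 ->
  `|iter n (transfer N) (fun x => 1 + x) s - (ln 2)^-1| <=
  2 * (11 / 12) ^+ n + 4 / N%:R * n%:R.
Proof.
move=> N1 s01; have N0 := ltnW N1; have z01 : 0 <= (0 : R) <= 1 by rewrite lexx ler01.
set kap := iter n (transfer N) (fun x => 1 + x) 0.
pose e : R := (11 / 12) ^+ n + 4 / N%:R * n%:R.
have c0 : 0 <= (11 / 12) ^+ n :> R by rewrite exprn_ge0//; lra.
have e0 : 0 <= e by rewrite addr_ge0// mulr_ge0// divr_ge0.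
have ln20 : 0 < ln 2 :> R by rewrite ln_gt0// ltr1n.
have /andP[kap1 kap2] : 1 <= kap <= 2.
  by apply: iter_transfer_itv => // x /andP[? ?]; apply/andP; split; lra.
pose a x := iter n (transfer N) (fun y => gauss_kernel y x) 0.
have ae x : 0 <= x <= 1 -> kap - e <= a x <= kap + e.
  move=> x01; have h := iter_transfer_gauss_kernelC n N0 z01 x01.
  have k0E : gauss_kernel 0 = (fun x : R => 1 + x).
    by apply/funext => y; rewrite gauss_kernel0.
  rewrite k0E in h.
  have h' := iter_transfer_1D_dist n N1 x01 z01.
  have := le_trans (ler_distD _ _ _) (lerD h h').
  rewrite [X in _ <= X -> _]addrC -/e -/kap -/(a x) ler_norml => /andP[? ?].
  by apply/andP; split; lra.
have low M : (0 < M)%N ->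
    \sum_(0 <= i < M) (M + i).+1%:R^-1 * a (i.+1%:R / M%:R) <= 1.
  move=> M0; rewrite -[leRHS](@iter_transfer1 N n 1 0)//.
  under eq_bigr do rewrite /a -iter_transferZ.
  rewrite -iter_transfer_sum; apply: iter_transfer_mono => // x x01.
  by have /andP[] := kernel_partition M0 x01.
have upp M : (0 < M)%N ->
    1 <= \sum_(0 <= i < M) (M + i)%:R^-1 * a (i%:R / M%:R).
  move=> M0; rewrite -[leLHS](@iter_transfer1 N n 1 0)//.
  under eq_bigr do rewrite /a -iter_transferZ.
  rewrite -iter_transfer_sum; apply: iter_transfer_mono => // x x01.
  by have /andP[] := kernel_partition M0 x01.
have upper : 1 <= (kap + e) * ln 2.
  apply: (@ler_addinv _ _ _ (kap + e) 0%N) => M M0.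
  apply: le_trans (upp M M0) _; rewrite -mulrDr.
  apply: le_trans (_ : (\sum_(0 <= i < M) (M + i)%:R^-1) * (kap + e) <= _).
    rewrite mulr_suml big_nat_cond [leRHS]big_nat_cond ler_sum// => i /andP[/andP[_ iM] _].
    rewrite ler_wpM2l ?invr_ge0//.
    suff /ae/andP[] : 0 <= (i%:R / M%:R : R) <= 1 by [].
    by rewrite divr_ge0//= ler_pdivrMr ?ltr0n// mul1r ler_nat ltnW.
  rewrite mulrC; apply: ler_wpM2l; first by rewrite addr_ge0// (le_trans ler01).
  have := harmonic_block_diff M0; have := harmonic_block_le R M0.
  by move=> h1 h2; apply: le_trans h2 _; rewrite lerD2r.
have lower : (kap - e) * ln 2 <= 1.
  (* The comparison below multiplies by [kap - e], which must be nonnegative; otherwise the claim is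
     trivial. *)
  have [ke|ke] := leP e kap; last by apply: le_trans ler01; rewrite pmulr_lle0// subr_le0 ltW.
  apply: (@ler_addinv _ _ _ (kap - e) 0%N) => M M0.
  apply: le_trans (lerD (low M M0) (lexx _)).
  rewrite -lerBlDr -mulrBr.
  apply: le_trans (_ : (\sum_(0 <= i < M) (M + i).+1%:R^-1) * (kap - e) <= _); last first.
    rewrite mulr_suml big_nat_cond [leRHS]big_nat_cond ler_sum// => i /andP[/andP[_ iM] _].
    rewrite ler_wpM2l ?invr_ge0//.
    suff /ae/andP[] : 0 <= (i.+1%:R / M%:R : R) <= 1 by [].
    by rewrite divr_ge0//= ler_pdivrMr ?ltr0n// mul1r ler_nat.
  rewrite [leRHS]mulrC; apply: ler_wpM2l; first by rewrite subr_ge0.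
  have := harmonic_block_diff M0; have := harmonic_block_ge R M0.
  by move=> h1 h2; rewrite lerBlDr; apply: le_trans h1 h2.
have hk : `|kap - (ln 2)^-1| <= e.
  have iln : (ln 2)^-1 * ln 2 = 1 :> R by rewrite mulVf// gt_eqF.
  rewrite ler_norml; apply/andP; split.
    rewrite lerBrDr -(ler_pM2r ln20) mulrDl iln mulNr; lra.
  rewrite lerBlDr -(ler_pM2r ln20) mulrDl iln; lra.
have h' := iter_transfer_1D_dist n N1 s01 z01.
apply: le_trans (ler_distD kap _ _) _; apply: le_trans (lerD h' hk) _.
by rewrite /e; move: (_ ^+ n) (_ * n%:R) => u v; lra.
Qed.

End InvariantDensity.

(** * Laws of the digits *)

Section Measurability.
Variable R : realType.
Implicit Types (x : R) (k n : nat).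

(** Measurability is borrowed from real powers: the base [x ^+ 2] is nonnegative, and the factor [x]
    restores the sign and the value 0 at 0. *)
Lemma measurable_inv : measurable_fun [set: R] (fun x : R => x^-1).
Proof.
have -> : (fun x : R => x^-1) = (fun x => x * (x ^+ 2) `^ (-1)).
  apply/funext => x; rewrite powR_inv1 ?sqr_ge0//.
  by have [->|x0] := eqVneq x 0; [rewrite mul0r invr0|rewrite expr2 invfM mulVKf].
apply: measurable_funM => //; apply: (measurableT_comp (@measurable_powR R (-1))).
exact: exprn_measurable.
Qed.

Lemma measurable_truncn : measurable_fun [set: R] (fun x : R => (Num.truncn x)%:R : R).
Proof.
apply: nondecreasing_measurable => // x y xy; rewrite ler_nat.
exact: le_truncn.
Qed.

Lemma measurable_gauss : measurable_fun [set: R] (@gauss R).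
Proof.
apply: measurable_funB; first exact: measurable_inv.
by apply: (measurableT_comp measurable_truncn); exact: measurable_inv.
Qed.

Lemma measurable_iter_gauss n : measurable_fun [set: R] (iter n (@gauss R)).
Proof.
elim: n => [|n IH] /=; first exact: measurable_id.
by apply: (measurableT_comp measurable_gauss).
Qed.

Lemma measurable_preimage_gauss (B : set R) : measurable B -> measurable (@gauss R @^-1` B).
Proof. by move=> mB; rewrite -[X in measurable X]setTI; apply: measurable_gauss. Qed.

Lemma measurable_preimage_iter_gauss n (B : set R) :
  measurable B -> measurable (iter n (@gauss R) @^-1` B).
Proof. by move=> mB; rewrite -[X in measurable X]setTI; apply: measurable_iter_gauss. Qed.

Definition first_digit x := Num.truncn x^-1.

Lemma measurable_first_digit (A : set nat) : measurable (@first_digit @^-1` A).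
Proof.
have -> : first_digit @^-1` A = \bigcup_(k in A) first_digit @^-1` [set k].
  apply/seteqP; split => x /=; first by move=> Ax; exists (first_digit x).
  by move=> [k Ak ->].
apply: bigcup_measurable => k _.
have -> : first_digit @^-1` [set k] =
    [set: R] `&` (fun x => (first_digit x)%:R : R) @^-1` [set k%:R].
  rewrite setTI; apply/seteqP; split => x /=; first by move=> ->.
  by move/eqP; rewrite eqr_nat => /eqP.
by apply: (measurableT_comp measurable_truncn measurable_inv).
Qed.

End Measurability.

(** * Conditional laws as images of Lebesgue measure *)

Section ConditionalLaw.
Variable R : realType.
Implicit Types (s x u v : R) (k n N : nat) (B E : set R).
Local Notation leb := (@lebesgue_measure R).

(* The inverse of [cond_cdf s]. *)
Definition cond_quantile s u : R := u / (1 + s - s * u).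

Definition unit_itv : set R := [set` `[0, 1]%R].

(** Inverse transform: the law with distribution function [cond_cdf s] is the image of Lebesgue
    measure on [[0, 1]] under the quantile function. A change of state thereby becomes a change of
    variable. *)
Definition cond_law s B : R := fine (leb (unit_itv `&` cond_quantile s @^-1` B)).

Lemma measurable_cond_quantile s : measurable_fun [set: R] (cond_quantile s).
Proof.
apply: measurable_funM => //; apply: (measurableT_comp (@measurable_inv R)).
exact: measurable_funB.
Qed.

Lemma measurable_cond_law s B : measurable B ->
  measurable (unit_itv `&` cond_quantile s @^-1` B).
Proof.
move=> mB; apply: measurableI; first exact: measurable_itv.
by rewrite -[X in measurable X]setTI; apply: measurable_cond_quantile.
Qed.

Lemma lebesgue_unit_itv : leb unit_itv = 1%:E.
Proof. by rewrite /unit_itv lebesgue_measure_itv /= lte01 oppr0 adde0. Qed.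

Lemma cond_lawE s B : measurable B ->
  leb (unit_itv `&` cond_quantile s @^-1` B) = (cond_law s B)%:E.
Proof.
move=> mB; rewrite /cond_law fineK// ge0_fin_numE//.
apply: (@le_lt_trans _ _ (leb unit_itv)).
  apply: le_measure; rewrite ?inE; [exact: measurable_cond_law|exact: measurable_itv|].
  by apply: subIset; left.
by rewrite lebesgue_unit_itv ltry.
Qed.

Lemma cond_law_ge0 s B : 0 <= cond_law s B.
Proof. exact: fine_ge0. Qed.

Lemma cond_law_le s B E : measurable B -> measurable E -> B `<=` E ->
  cond_law s B <= cond_law s E.
Proof.
move=> mB mE BE; rewrite -lee_fin -!cond_lawE//.
apply: le_measure; rewrite ?inE; try exact: measurable_cond_law.
by apply: setIS => x; exact: BE.
Qed.

Lemma cond_law_setT s : cond_law s setT = 1.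
Proof.
by apply: EFin_inj; rewrite -cond_lawE// preimage_setT setIT lebesgue_unit_itv.
Qed.

Lemma cond_law_set0 s : cond_law s set0 = 0.
Proof. by rewrite /cond_law preimage_set0 setI0 measure0. Qed.

Lemma cond_law_le1 s B : measurable B -> cond_law s B <= 1.
Proof. by move=> mB; rewrite -(cond_law_setT s) cond_law_le. Qed.

Lemma cond_lawU s B E : measurable B -> measurable E -> B `&` E = set0 ->
  cond_law s (B `|` E) = cond_law s B + cond_law s E.
Proof.
move=> mB mE BE0; apply: EFin_inj; rewrite EFinD -!cond_lawE//; last exact: measurableU.
rewrite preimage_setU setIUr measureU//; try exact: measurable_cond_law.
apply/seteqP; split => // u [[_ Bu] [_ Eu]].
by have : (B `&` E) (cond_quantile s u) by []; rewrite BE0.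
Qed.

(** By uniqueness of Lebesgue measure, the rescaled image measure need only be checked on half-open
    intervals. The map reverses orientation, so their preimages are half open on the other side. *)
Lemma lebesgue_measure_reflect (c p : R) (A : set R) : 0 < p -> measurable A ->
  leb ((fun u => (c - u) / p) @^-1` A) = (p%:E * leb A)%E.
Proof.
move=> p0 mA.
have mf : measurable_fun [set: R] (fun u : R => (c - u) / p).
  by apply: measurable_funM => //; exact: measurable_funB.
have pp : 0 <= p^-1 by rewrite invr_ge0 ltW.
pose f : measurableTypeR R -> measurableTypeR R := fun u => (c - u) / p.
have mf' : measurable_fun setT f := mf.
pose nu : {measure set (measurableTypeR R) -> \bar R} :=
  measure_function_pushforward__canonical__measure_function_Measure leb mf'.
have -> : leb A = mscale (NngNum pp) nu A; last first.
  change (leb (f @^-1` A) = p%:E * ((p^-1)%:E * leb (f @^-1` A)))%E.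
  by rewrite muleA -EFinM divff ?gt_eqF// mul1e.
apply: lebesgue_measure_unique => // X [[a b]] _ <-.
change (leb `]a, b]%classic = (p^-1)%:E * leb (f @^-1` `]a, b]%classic))%E.
have -> : f @^-1` `]a, b]%classic = `[c - p * b, c - p * a[%classic.
  apply/seteqP; split => u; rewrite /f /= !in_itv/= ltr_pdivlMr// ler_pdivrMr//; lra.
rewrite !lebesgue_measure_itv/= !lte_fin.
have -> : (c - p * b < c - p * a) = (a < b) by rewrite ltrD2l ltrN2 ltr_pM2l.
case: ifP => _; last by rewrite mule0.
rewrite -!EFinD -EFinM; congr EFin.
by field; rewrite gt_eqF.
Qed.

End ConditionalLaw.

Section BranchLaw.
Variable R : realType.
Implicit Types (s x u v : R) (k n N : nat) (B E : set R).
Local Notation leb := (@lebesgue_measure R).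

Lemma first_digit_gt0P x k : (0 < k)%N ->
  first_digit x = k <-> k%:R <= x^-1 < k%:R + 1.
Proof.
move=> k0; rewrite /first_digit natr1; split.
  move=> xk; have x0 : 0 <= x^-1.
    by move: k0; rewrite -xk truncn_gt0; exact: le_trans.
  by rewrite -xk; exact: truncn_itv.
exact: truncn_def.
Qed.

(** The Markov property in coordinates: a decreasing affine change of [u] stretches the branch of
    digit [k] onto the unit interval, and there the Gauss map acts as the passage from state [s] to
    state [1/(k+s)]. *)
Lemma cond_quantile_branch s k u : (0 < k)%N -> 0 <= s -> 0 < u ->
  cond_quantile (k%:R + s)^-1 ((tail_prob k s - u) / branch_prob k s) =
  (cond_quantile s u)^-1 - k%:R.
Proof.
move=> /(natr_ge1 R) k1 s0 u0; rewrite /cond_quantile.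
have -> : (tail_prob k s - u) / branch_prob k s =
    (1 + s - (k%:R + s) * u) * (k%:R + 1 + s) / (1 + s).
  rewrite /tail_prob /branch_prob; field.
  by do ?[apply/andP; split]; lra.
have -> : 1 + (k%:R + s)^-1 -
    (k%:R + s)^-1 * ((1 + s - (k%:R + s) * u) * (k%:R + 1 + s) / (1 + s)) =
    (k%:R + 1 + s) * u / (1 + s).
  by field; do ?[apply/andP; split]; lra.
rewrite [(u / _)^-1]invf_div; field.
by do ?[apply/andP; split]; lra.
Qed.

Lemma cond_law_branch s k B : 0 <= s <= 1 -> (0 < k)%N -> measurable B ->
  cond_law s ((@first_digit R @^-1` [set k]) `&` (@gauss R @^-1` B)) =
  branch_prob k s * cond_law (k%:R + s)^-1 B.
Proof.
move=> /andP[s0 s1] k0 mB; have k1 := natr_ge1 R k0.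
have mD : measurable ((@first_digit R @^-1` [set k]) `&` (@gauss R @^-1` B)).
  by apply: measurableI; [exact: measurable_first_digit|exact: measurable_preimage_gauss].
have p0 : 0 < branch_prob k s by rewrite divr_gt0 ?mulr_gt0//; lra.
pose f u := (tail_prob k s - u) / branch_prob k s.
have mA' := measurable_cond_law (k%:R + s)^-1 mB.
have mA := measurable_cond_law s mD.
apply: EFin_inj; rewrite EFinM -!cond_lawE// -(lebesgue_measure_reflect (tail_prob k s) p0)//.
set A := @unit_itv R `&` _ in mA *; set A' := @unit_itv R `&` _ in mA' *.
have mf : measurable (f @^-1` A').
  rewrite -[X in measurable X]setTI.
  suff : measurable_fun [set: R] f by apply.
  by apply: measurable_funM => //; exact: measurable_funB.
(* At [u = e] the inverse of the quantile is exactly [k + 1], so the digit there is [k + 1],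
   although [f] sends [e] to the end 1 of the unit interval. The two sets are compared after adding
   this null point to both. *)
pose e := tail_prob k.+1 s.
have AE : A `|` [set e] = f @^-1` A' `|` [set e].
  have eE : e = (1 + s) / (k%:R + 1 + s) by rewrite /e /tail_prob -natr1.
  have fe u : (0 <= f u <= 1) = (e <= u <= tail_prob k s).
    rewrite /e /f; have pE := branch_probE k0 s0.
    rewrite ler_pdivrMr// ler_pdivlMr// mul0r mul1r pE andbC.
    by congr (_ && _); [rewrite lerD2l lerN2|rewrite subr_ge0].
  have key u : u != e -> A u <-> (f @^-1` A') u.
    move=> ue; rewrite /A /A' /unit_itv /= !in_itv/= fe.
    have [/andP[eu uc]|h] := boolP (e < u <= tail_prob k s).
      have e0 : 0 < e by rewrite eE divr_gt0//; lra.
      have u0 : 0 < u := lt_trans e0 eu.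
      have c1 : tail_prob k s <= 1 by rewrite /tail_prob ler_pdivrMr; lra.
      rewrite (ltW u0) (le_trans uc c1) (ltW eu) uc.
      have qE := cond_quantile_branch k0 s0 u0.
      have iq : (cond_quantile s u)^-1 = (1 + s) / u - s.
        by rewrite /cond_quantile invf_div; field; rewrite gt_eqF.
      have dig : first_digit (cond_quantile s u) = k.
        apply/first_digit_gt0P => //; rewrite iq.
        rewrite lerBrDr ler_pdivlMr// ltrBlDr ltr_pdivrMr//.
        move: eu uc; rewrite eE /tail_prob ltr_pdivrMr ?ler_pdivlMr; [|lra|lra].
        by move=> ? ?; apply/andP; split; nra.
      have gE : gauss (cond_quantile s u) = (cond_quantile s u)^-1 - k%:R.
        by rewrite /gauss -/(first_digit _) dig.
      by rewrite gE /f qE; split=> [[_ []]|[]].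
    split; last first.
      move=> [/andP[eu uc] _]; move: h; rewrite uc andbT -leNgt => ue'.
      by move: ue; rewrite eq_le ue' eu.
    move=> [/andP[u0 u1] [/first_digit_gt0P -/(_ k0) hq _]].
    move: h; apply: contraNP => _.
    have {}u0 : 0 < u.
      rewrite lt_neqAle u0 andbT; apply/eqP => u0'.
      by move: hq; rewrite -u0' /cond_quantile mul0r invr0; lra.
    have iq : (cond_quantile s u)^-1 = (1 + s) / u - s.
      by rewrite /cond_quantile invf_div; field; rewrite gt_eqF.
    move: hq; rewrite iq lerBrDr ler_pdivlMr// ltrBlDr ltr_pdivrMr// => /andP[h1 h2].
    rewrite eE /tail_prob; apply/andP; split.
      by rewrite ltr_pdivrMr; nra.
    by rewrite ler_pdivlMr; nra.
  apply/seteqP; split => u /=; have [->|/key ku] := eqVneq u e; try by right.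
    by case=> [/ku|->]; [left|right].
  by case=> [/ku|->]; [left|right].
have l0 : leb [set e] = 0%E by exact: lebesgue_measure_set1.
have mU X : measurable X -> leb (X `|` [set e]) = leb X.
  by move=> mX; rewrite measureU0.
by rewrite -(mU A)// AE mU.
Qed.

End BranchLaw.

(** * From the truncated operator to the laws of shifted events *)

Section Mixing.
Variable R : realType.
Implicit Types (s x u v : R) (k n N p q : nat) (B E F : set R) (A : pred nat).
Local Notation digit_in A := (@first_digit R @^-1` [set k | A k]).
Local Notation T := (@gauss R).

Lemma cond_law_split s N E : (0 < N)%N -> measurable E ->
  cond_law s E =
  \sum_(1 <= k < N) cond_law s (E `&` (@first_digit R @^-1` [set k])) +
  cond_law s (E `&` digit_in (fun k => ~~ (0 < k < N)%N)).
Proof.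
have mD := @measurable_first_digit R.
case: N => // N _ mE; elim: N => [|N IH].
  rewrite big_geq// add0r; congr (cond_law s _).
  by apply/seteqP; split => x /=; [move=> Ex; split=> //; lia|case].
rewrite big_nat_recr//= -addrA IH; congr (_ + _).
rewrite -cond_lawU; [|exact: measurableI|exact: measurableI|].
  congr (cond_law s _); apply/seteqP; split => x /=.
    move=> [Ex xN]; have [xk|xk] := eqVneq (first_digit x) N.+1; [by left|right].
    by split=> //; lia.
  by move=> [[Ex ->]|[Ex xN]]; split=> //; lia.
by apply/seteqP; split => // x /= [[_ ->] [_]]; lia.
Qed.

(** Computed as the complement of the branches [0 < k < N], so that points with digit 0 fall into
    the tail without being examined. *)
Lemma cond_law_tail s N : 0 <= s <= 1 -> (0 < N)%N ->
  cond_law s (digit_in (fun k => ~~ (0 < k < N)%N)) = tail_prob N s.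
Proof.
move=> s01 N0; have /andP[s0 _] := s01.
have := cond_law_split s N0 (@measurableT _ R); rewrite cond_law_setT setTI.
rewrite (eq_big_nat _ _ (F2 := fun k => branch_prob k s)); last first.
  move=> k /andP[k0 _]; rewrite setTI.
  have := cond_law_branch s01 k0 (@measurableT _ R).
  by rewrite preimage_setT setIT cond_law_setT mulr1.
by rewrite sum_branch_prob// tail_prob1//; lra.
Qed.

Lemma cond_law_digit s k : 0 <= s <= 1 -> (0 < k)%N ->
  cond_law s (@first_digit R @^-1` [set k]) = branch_prob k s.
Proof.
move=> s01 k0; have := cond_law_branch s01 k0 (@measurableT _ R).
by rewrite preimage_setT setIT cond_law_setT mulr1.
Qed.

(** The branches below [N] are exact, and what is neglected is an event inside the tail; hence an
    error of one sign. The general digit set [A] covers both the comparison with [transfer]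
    ([predT]) and bounds on digit events. *)
Lemma cond_law_digits_gauss s N A B : 0 <= s <= 1 -> (0 < N)%N -> measurable B ->
  0 <= cond_law s (digit_in A `&` T @^-1` B) -
    \sum_(1 <= k < N | A k) branch_prob k s * cond_law (k%:R + s)^-1 B <= tail_prob N s.
Proof.
move=> s01 N0 mB.
have mA (C : set nat) := @measurable_first_digit R C.
have mT := measurable_preimage_gauss mB.
rewrite (@cond_law_split s N)//; last exact: measurableI.
have -> : \sum_(1 <= k < N) cond_law s (digit_in A `&` T @^-1` B `&` @first_digit R @^-1` [set k])
    = \sum_(1 <= k < N | A k) branch_prob k s * cond_law (k%:R + s)^-1 B.
  rewrite [RHS]big_mkcond/=; apply: eq_big_nat => k /andP[k0 _].
  case: ifPn => Ak.
    rewrite -cond_law_branch//; congr (cond_law s _).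
    by apply/seteqP; split => x /=; [move=> [[]]|move=> [->]].
  rewrite -[RHS](cond_law_set0 s); congr (cond_law s _).
  by apply/seteqP; split => x //= -[[Ax _] xk]; move: Ax; rewrite xk (negbTE Ak).
rewrite addrC addKr cond_law_ge0 -cond_law_tail//.
by apply: cond_law_le => //; apply: measurableI => //; exact: measurableI.
Qed.

Lemma cond_law_gauss_transfer s N B : 0 <= s <= 1 -> (0 < N)%N -> measurable B ->
  `|cond_law s (T @^-1` B) - transfer N (fun x => cond_law x B) s| <= 2 / N%:R.
Proof.
move=> s01 N0 mB; have /andP[s0 _] := s01.
have := cond_law_digits_gauss predT s01 N0 mB.
have -> : digit_in predT = setT by apply/seteqP; split.
rewrite setTI; have t2 := tail_prob_le N0 s01; have t0 := tail_prob_ge0 N s0.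
rewrite /transfer opprD addrA; move: (_ - _) => d /andP[d0 d1].
have : 0 <= tail_prob N s * cond_law 0 B <= tail_prob N s.
  by rewrite mulr_ge0 ?cond_law_ge0//= ler_piMr// cond_law_le1.
move: (_ * cond_law 0 B) => c /andP[c0 c1].
by rewrite ler_norml; apply/andP; split; lra.
Qed.

Lemma cond_law_iter_gauss_transfer s N n B : 0 <= s <= 1 -> (0 < N)%N -> measurable B ->
  `|cond_law s (iter n T @^-1` B) - iter n (transfer N) (fun x => cond_law x B) s|
    <= 2 / N%:R * n%:R.
Proof.
move=> s01 N0 mB; elim: n s s01 => [|n IH] s s01.
  by rewrite mulr0 /= subrr normr0.
rewrite -[n.+1%:R]natr1 mulrDr mulr1.
have -> : iter n.+1 T @^-1` B = T @^-1` (iter n T @^-1` B).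
  by apply/seteqP; split => x; rewrite /= -iterSr.
have h1 := cond_law_gauss_transfer s01 N0 (measurable_preimage_iter_gauss n mB).
have h2 := transfer_dist N0 s01 IH.
by rewrite [leRHS]addrC; apply: le_trans (ler_distD _ _ _) (lerD h1 h2).
Qed.

(* Comparison principle: inequalities between the conditional laws of two events that
   hold for every [s] persist after the events are shifted. *)
Lemma cond_law_shift_le n r E F s : 0 <= s <= 1 -> measurable E -> measurable F ->
  (forall x, 0 <= x <= 1 -> cond_law x E <= r * cond_law x F) ->
  cond_law s (iter n T @^-1` E) <= r * cond_law s (iter n T @^-1` F).
Proof.
move=> s01 mE mF EF; apply: (@ler_addinv _ _ _ (2 * n%:R + `|r| * (2 * n%:R)) 0%N) => N N0.
have hE := cond_law_iter_gauss_transfer n s01 N0 mE.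
have hF := cond_law_iter_gauss_transfer n s01 N0 mF.
have hEF := iter_transfer_mono n N0 s01 EF; rewrite iter_transferZ in hEF.
set a := cond_law s _ in hE *; set b := cond_law s _ in hF *.
set a' := iter _ _ _ _ in hE hEF; set b' := iter _ _ _ _ in hF hEF.
have hrF : `|r * b - r * b'| <= `|r| * (2 / N%:R * n%:R).
  by rewrite -mulrBr normrM ler_wpM2l.
have -> : (2 * n%:R + `|r| * (2 * n%:R)) / N%:R =
  2 / N%:R * n%:R + `|r| * (2 / N%:R * n%:R) by ring.
move: hE hrF; rewrite !ler_norml; move: (_ / _ * _) (`|r| * _) => c d.
by move=> /andP[_ ?] /andP[? _]; lra.
Qed.

Lemma cond_law_shift_itv n a b E s : 0 <= s <= 1 -> measurable E ->
  (forall x, 0 <= x <= 1 -> a <= cond_law x E <= b) ->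
  a <= cond_law s (iter n T @^-1` E) <= b.
Proof.
move=> s01 mE Eab.
have h N : (0 < N)%N -> a <= iter n (transfer N) (fun x => cond_law x E) s <= b.
  by move=> N0; apply: iter_transfer_itv.
apply/andP; split; apply: (@ler_addinv _ _ _ (2 * n%:R) 0%N) => N N0;
  have := cond_law_iter_gauss_transfer n s01 N0 mE; rewrite mulrAC ler_norml;
  have := h N N0; move: (_ / N%:R) => c /andP[? ?] /andP[? ?]; lra.
Qed.

(** The contraction, carried over from the truncated operator to the true laws by letting [N] tend
    to infinity; [N] starts at 2 because the contraction requires it. *)
Lemma cond_law_shift_dist n M E s x : 0 <= s <= 1 -> 0 <= x <= 1 -> measurable E ->
  0 <= M -> unit_lipschitz M (fun x => cond_law x E) ->
  `|cond_law s (iter n T @^-1` E) - cond_law x (iter n T @^-1` E)| <= M * (11 / 12) ^+ n.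
Proof.
move=> s01 x01 mE M0 ME; apply: (@ler_addinv _ _ _ (4 * n%:R) 1%N) => N N1.
have N0 := ltnW N1.
have hs := cond_law_iter_gauss_transfer n s01 N0 mE.
have hx := cond_law_iter_gauss_transfer n x01 N0 mE.
have := unit_lipschitz_iter_transfer n N1 M0 ME s01 x01.
have hsx : `|s - x| <= 1.
  by move: s01 x01 => /andP[? ?] /andP[? ?]; rewrite ler_norml; apply/andP; split; lra.
move=> h; have {}h := le_trans h (ler_piMr _ hsx).
have {h} := h (mulr_ge0 (exprn_ge0 _ (divr_ge0 (ler0n _ _) (ler0n _ _))) M0).
rewrite [_ ^+ n * M]mulrC.
have -> : 4 * n%:R / N%:R = 2 / N%:R * n%:R + 2 / N%:R * n%:R :> R by ring.
move: hs hx; rewrite !ler_norml; move: (_ / _ * _) (M * _) => c d.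
by move=> /andP[? ?] /andP[? ?] /andP[? ?]; apply/andP; split; lra.
Qed.

(** After the first digit the future follows the law of some new state, and [r] bounds all of these,
    so it factors out without independence. *)
Lemma cond_law_digits_le A B r s : 0 <= s <= 1 -> measurable B -> 0 <= r ->
  (forall x, 0 <= x <= 1 -> cond_law x B <= r) ->
  cond_law s (digit_in A `&` T @^-1` B) <= r * cond_law s (digit_in A).
Proof.
move=> s01 mB r0 Br; have /andP[s0 _] := s01.
apply: (@ler_addinv _ _ _ 2 0%N) => N N0.
have /andP[_ h1] := cond_law_digits_gauss A s01 N0 mB.
have /andP[h2 _] := cond_law_digits_gauss A s01 N0 (@measurableT _ R).
have t2 := tail_prob_le N0 s01.
have h3 : \sum_(1 <= k < N | A k) branch_prob k s * cond_law (k%:R + s)^-1 B <=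
    r * \sum_(1 <= k < N | A k) branch_prob k s * cond_law (k%:R + s)^-1 setT.
  rewrite mulr_sumr big_nat_cond [leRHS]big_nat_cond ler_sum// => k /andP[/andP[k0 _] _].
  rewrite cond_law_setT mulr1 mulrC ler_wpM2r ?branch_prob_ge0//.
  by apply: Br; rewrite inv_branch_itv.
have h4 : r * \sum_(1 <= k < N | A k) branch_prob k s * cond_law (k%:R + s)^-1 setT <=
   r * cond_law s (digit_in A).
  by rewrite ler_wpM2l//; move: h2; rewrite preimage_setT setIT; lra.
by lra.
Qed.

End Mixing.

(** * One-digit and two-digit probabilities *)

Section DigitLaws.
Variable R : realType.
Implicit Types (s x y : R) (k n i j N p q : nat) (B E F : set R) (A : pred nat).
Local Notation T := (@gauss R).
Local Notation digit_in A := (@first_digit R @^-1` [set k | A k]).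
Local Notation digit_is k := (@first_digit R @^-1` [set k]).

(** The empty past is the state 0 ([q_(-1) = 0]), whose quantile function is the identity; so this
    is Lebesgue measure on the unit interval. *)
Definition digit_prob (E : set R) : R := cond_law 0 E.

Definition digit_event n A : set R := [set x | A (cf_digit n x)].

Let zero01 : 0 <= (0 : R) <= 1. Proof. by rewrite lexx ler01. Qed.

Lemma digit_eventE n A : digit_event n.+1 A = iter n T @^-1` digit_in A.
Proof. by []. Qed.

Lemma measurable_digit_event n A : measurable (digit_event n.+1 A).
Proof.
by rewrite digit_eventE; apply: measurable_preimage_iter_gauss; exact: measurable_first_digit.
Qed.

Lemma digit_in1 k : digit_in (pred1 k) = digit_is k.
Proof. by apply/seteqP; split => x /= /eqP. Qed.

(** The factor [k^-2] in the Lipschitz constant survives in the decorrelation bound; after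
    multiplication by the digit values it leaves covariances of order [1/(p q)]. *)
Lemma unit_lipschitz_branch_prob k : (0 < k)%N ->
  unit_lipschitz (4 / k%:R ^+ 2) (@branch_prob R k).
Proof.
move=> k0 x y /andP[x0 x1] /andP[y0 y1]; have k1 := natr_ge1 R k0.
rewrite /branch_prob; move: (k%:R : R) k1 => t t1.
have -> : (1 + x) / ((t + x) * (t + 1 + x)) - (1 + y) / ((t + y) * (t + 1 + y)) =
   (t * (t + 1) - (2 * t + 1) - x - y - x * y) /
   ((t + x) * (t + y) * ((t + 1 + x) * (t + 1 + y))) * (x - y).
  by field; do ?[apply/andP; split]; lra.
rewrite normrM ler_wpM2r// normrM.
have d1 : t ^+ 2 <= (t + x) * (t + y) by rewrite expr2 ler_pM//; lra.
have d2 : (t + 1) ^+ 2 <= (t + 1 + x) * (t + 1 + y) by rewrite expr2 ler_pM//; lra.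
have d0 : 0 < (t + x) * (t + y) * ((t + 1 + x) * (t + 1 + y)).
  by rewrite !mulr_gt0//; lra.
rewrite [`|_^-1|]gtr0_norm ?invr_gt0// ler_pdivrMr// mulrAC ler_pdivlMr; last first.
  by rewrite exprn_gt0//; lra.
have hn : `|t * (t + 1) - (2 * t + 1) - x - y - x * y| <= 4 * (t + 1) ^+ 2.
  by rewrite ler_norml; apply/andP; split; nra.
apply: le_trans (ler_wpM2r _ hn) _; first by rewrite exprn_ge0//; lra.
by rewrite -[leLHS]mulrA ler_wpM2l// [leLHS]mulrC ler_pM ?exprn_ge0//; lra.
Qed.

Lemma unit_lipschitz_cond_law_digit k : (0 < k)%N ->
  unit_lipschitz (4 / k%:R ^+ 2) (fun x => cond_law x (digit_is k)).
Proof.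
move=> k0 x y x01 y01; rewrite !cond_law_digit//.
exact: unit_lipschitz_branch_prob.
Qed.

(** To leading order the state enters through [1 + s] alone, whose iterates are known; the error
    [k^-3] stays summable after weighting by [k]. *)
Lemma branch_prob_approx k s : (0 < k)%N -> 0 <= s <= 1 ->
  `|branch_prob k s - (k%:R ^+ 2)^-1 * (1 + s)| <= 10 / k%:R ^+ 3.
Proof.
move=> k0 /andP[s0 s1]; have k1 := natr_ge1 R k0.
rewrite /branch_prob; move: (k%:R : R) k1 => t t1.
have -> : (1 + s) / ((t + s) * (t + 1 + s)) - (t ^+ 2)^-1 * (1 + s) =
   - ((1 + s) * (t + 2 * t * s + s + s ^+ 2)) / ((t + s) * (t + 1 + s) * t ^+ 2).
  by field; do ?[apply/andP; split]; lra.
have A0 : 0 <= (1 + s) * (t + 2 * t * s + s + s ^+ 2).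
  by apply: mulr_ge0; rewrite ?expr2; nra.
have D0 : 0 < (t + s) * (t + 1 + s) * t ^+ 2 by rewrite !mulr_gt0 ?exprn_gt0//; lra.
rewrite normrM normrN (ger0_norm A0) gtr0_norm ?invr_gt0// ler_pdivrMr//.
rewrite [leRHS]mulrAC ler_pdivlMr; last by rewrite exprn_gt0//; lra.
have -> : t ^+ 3 = t * t ^+ 2 by rewrite exprS.
have -> : 10 * ((t + s) * (t + 1 + s) * t ^+ 2) = 10 * ((t + s) * (t + 1 + s)) * t ^+ 2 by ring.
rewrite [leLHS]mulrA; apply: ler_wpM2r; first by rewrite exprn_ge0//; lra.
have h1 : (1 + s) * (t + 2 * t * s + s + s ^+ 2) <= 2 * (5 * t).
  by rewrite ler_pM//; rewrite ?expr2; nra.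
apply: (@le_trans _ _ (2 * (5 * t) * t)); first by apply: ler_wpM2r => //; lra.
have -> : 2 * (5 * t) * t = 10 * (t * t) by ring.
by apply: ler_wpM2l => //; apply: ler_pM; lra.
Qed.

Lemma digit_prob_le1 s n k : 0 <= s <= 1 -> (0 < k)%N ->
  cond_law s (digit_event n.+1 (pred1 k)) <= 2 / k%:R ^+ 2.
Proof.
move=> s01 k0; rewrite digit_eventE digit_in1.
have h x : 0 <= x <= 1 -> 0 <= cond_law x (digit_is k) <= 2 / k%:R ^+ 2.
  by move=> x01; rewrite cond_law_ge0 cond_law_digit//= branch_prob_le.
by have /andP[] := cond_law_shift_itv n s01 (@measurable_first_digit R [set k]) h.
Qed.

Lemma digit_prob_limit n k : (0 < k)%N ->
  `|digit_prob (digit_event n.+1 (pred1 k)) - (ln 2)^-1 / k%:R ^+ 2| <=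
  2 * (11 / 12) ^+ n / k%:R ^+ 2 + 10 / k%:R ^+ 3.
Proof.
move=> k0; have k1 := natr_ge1 R k0; rewrite digit_eventE digit_in1 /digit_prob.
apply: (@ler_addinv _ _ _ (2 * n%:R + (4 * n%:R) / k%:R ^+ 2) 1%N) => N N1.
have N0 := ltnW N1.
have h1 := cond_law_iter_gauss_transfer n zero01 N0 (@measurable_first_digit R [set k]).
have := @iter_transfer_dist _ N n (fun x => cond_law x (digit_is k))
  (fun x => (k%:R ^+ 2)^-1 * (1 + x)) (10 / k%:R ^+ 3) 0 N0 zero01.
have hb x : 0 <= x <= 1 ->
    `|cond_law x (digit_is k) - (k%:R ^+ 2)^-1 * (1 + x)| <= 10 / k%:R ^+ 3.
  by move=> x01; rewrite cond_law_digit//; exact: branch_prob_approx.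
move=> /(_ hb); rewrite iter_transferZ => h2.
have h3 := iter_transfer_1D_limit n N1 zero01.
have k2 : 0 <= (k%:R ^+ 2)^-1 :> R by rewrite invr_ge0 exprn_ge0.
have := ler_wpM2l k2 h3; rewrite -[X in X * `|_|]ger0_norm// -normrM mulrBr.
move=> {}h3; have := le_trans (ler_distD _ _ _) (lerD (le_trans (ler_distD _ _ _) (lerD h1 h2)) h3).
rewrite [(_ ^+ 2)^-1 * (ln 2)^-1]mulrC; move=> h; apply: le_trans h _.
by rewrite le_eqVlt; apply/orP; left; apply/eqP; ring.
Qed.

(** Once the digit [p] has been read, the state influences the probability of the later digit [q]
    only up to the exponential error, so it may be replaced by the unconditional one. This is shown
    for the first digit from an arbitrary state and then shifted by [i]. *)
Lemma digit_prob_pair i j p q : (i < j)%N -> (0 < p)%N -> (0 < q)%N ->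
  digit_prob (digit_event i.+1 (pred1 p) `&` digit_event j.+1 (pred1 q)) <=
  (digit_prob (digit_event j.+1 (pred1 q)) + 4 / q%:R ^+ 2 * (11 / 12) ^+ (j - i.+1)) *
  digit_prob (digit_event i.+1 (pred1 p)).
Proof.
move=> ij p0 q0; set d := (j - i.+1)%N.
have jE : j = (d + i.+1)%N by rewrite subnK.
pose B := iter d T @^-1` digit_is q.
have mB : measurable B := measurable_preimage_iter_gauss d (@measurable_first_digit R [set q]).
have mp := @measurable_first_digit R [set p].
have jB : digit_event j.+1 (pred1 q) = iter i.+1 T @^-1` B.
  by rewrite digit_eventE digit_in1 jE; apply/seteqP; split => x; rewrite /B /= iterD.
have -> : digit_event i.+1 (pred1 p) `&` digit_event j.+1 (pred1 q) =
    iter i T @^-1` (digit_in (pred1 p) `&` T @^-1` B).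
  by rewrite jB digit_eventE.
have mpB : measurable (digit_in (pred1 p) `&` T @^-1` B).
  by rewrite digit_in1; apply: measurableI => //; exact: measurable_preimage_gauss.
rewrite -(digit_in1 p) in mp.
set r := (X in X * _); apply: (@cond_law_shift_le R i r _ _ 0 zero01 mpB mp).
rewrite {}/r.
have c0 : 0 <= 4 / q%:R ^+ 2 * (11 / 12) ^+ d :> R by [].
move=> x x01; apply: cond_law_digits_le => //.
  by rewrite addr_ge0// cond_law_ge0.
move=> y y01; rewrite jB /digit_prob.
(* Every state [z] gives at least the value at [y] minus the error; hence so does the unconditional
   probability, which shifts [B] by [i.+1] from the state 0. *)
have h z : 0 <= z <= 1 -> cond_law y B - 4 / q%:R ^+ 2 * (11 / 12) ^+ d <= cond_law z B <= 1.
  move=> z01; rewrite cond_law_le1// andbT.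
  have q2 : 0 <= 4 / q%:R ^+ 2 :> R by [].
  have := cond_law_shift_dist d y01 z01 (@measurable_first_digit R [set q]) q2
    (unit_lipschitz_cond_law_digit q0).
  by rewrite ler_norml => /andP[_]; rewrite -/B; lra.
by have /andP[] := cond_law_shift_itv i.+1 zero01 mB h; lra.
Qed.

(** Since [r] bounds the probability from every state, the later event contributes a factor [r]
    whatever the past, even for adjacent digits. *)
Lemma digit_prob_pair_le i j A r : (i < j)%N ->
  (forall x, 0 <= x <= 1 -> cond_law x (digit_in A) <= r) ->
  digit_prob (digit_event i.+1 A `&` digit_event j.+1 A) <= r ^+ 2.
Proof.
move=> ij Ar; set d := (j - i.+1)%N.
have r0 : 0 <= r := le_trans (cond_law_ge0 _ _) (Ar _ zero01).
have jE : j = (d + i.+1)%N by rewrite subnK.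
have mA := @measurable_first_digit R [set k | A k].
pose B := iter d T @^-1` digit_in A.
have mB : measurable B := measurable_preimage_iter_gauss d mA.
have -> : digit_event i.+1 A `&` digit_event j.+1 A =
    iter i T @^-1` (digit_in A `&` T @^-1` B).
  by rewrite !digit_eventE jE; apply/seteqP; split => x; rewrite /B /= iterD.
have mAB : measurable (digit_in A `&` T @^-1` B).
  by apply: measurableI => //; exact: measurable_preimage_gauss.
have h x : 0 <= x <= 1 -> 0 <= cond_law x (digit_in A `&` T @^-1` B) <= r ^+ 2.
  move=> x01; rewrite cond_law_ge0/= expr2.
  apply: le_trans (ler_wpM2l r0 (Ar x x01)).
  apply: cond_law_digits_le => // y y01.
  have h z : 0 <= z <= 1 -> 0 <= cond_law z (digit_in A) <= r.
    by move=> z01; rewrite cond_law_ge0 Ar.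
  by have /andP[] := cond_law_shift_itv d y01 mA h.
by have /andP[] := cond_law_shift_itv i zero01 mAB h.
Qed.

Lemma cond_law_digits_bound A r s : 0 <= s <= 1 ->
  (forall N, \sum_(1 <= k < N | A k) (k%:R ^+ 2)^-1 <= r) ->
  cond_law s (digit_in A) <= 2 * r.
Proof.
move=> s01 Ar; apply: (@ler_addinv _ _ _ 2 0%N) => N N0.
have /andP[_] := cond_law_digits_gauss A s01 N0 (@measurableT _ R).
rewrite preimage_setT setIT lerBlDr => /le_trans; apply.
rewrite addrC lerD ?tail_prob_le//.
apply: le_trans (ler_wpM2l _ (Ar N)); last by [].
rewrite mulr_sumr big_nat_cond [leRHS]big_nat_cond ler_sum// => k /andP[/andP[k0 _] _].
by rewrite cond_law_setT mulr1 branch_prob_le.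
Qed.

Lemma digit_probE (E : set R) : measurable E ->
  lebesgue_measure (`]0%R, 1%R]%classic `&` E) = (digit_prob E)%:E.
Proof.
move=> mE; rewrite /digit_prob -cond_lawE//.
have -> : cond_quantile (0 : R) @^-1` E = E.
  by apply/seteqP; split => x; rewrite /cond_quantile /= addr0 mul0r subr0 divr1.
have mi : measurable (`]0%R, 1%R]%classic `&` E).
  exact: measurableI (measurable_itv _) mE.
have mi' : measurable (@unit_itv R `&` E) by exact: measurableI (measurable_itv _) mE.
have l0 : lebesgue_measure [set (0 : R)] = 0%E by exact: lebesgue_measure_set1.
have mU X : measurable X -> lebesgue_measure (X `|` [set (0 : R)]) = lebesgue_measure X.
  by move=> mX; rewrite measureU0.
rewrite -(mU _ mi) -(mU _ mi'); congr lebesgue_measure.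
apply/seteqP; split => x; rewrite /unit_itv /= !in_itv/=.
  move=> [[/andP[x0 x1] Ex]|->]; [left|by right].
  by rewrite (ltW x0) x1.
move=> [[/andP[x0 x1] Ex]|->]; last by right.
have [->|x0'] := eqVneq x 0; [by right|left].
by rewrite x1 lt_neqAle eq_sym x0' x0.
Qed.

End DigitLaws.

(** * Truncated sums of prime digits *)

Section SummableIntegrals.
Variable R : realType.
Variables (d : measure_display) (X : measurableType d) (mu : {measure set X -> \bar R}).
Variables (D : set X) (mD : measurable D).

(** Borel-Cantelli through monotone convergence: the series of the [f j] has a finite integral, so
    it converges almost everywhere and its terms tend to 0. *)
Lemma ae_cvg0_of_summable_integrals (f : nat -> X -> R) (B : R) :
  (forall j, measurable_fun D (f j)) -> (forall j x, 0 <= f j x) ->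
  (forall n, (\sum_(0 <= j < n) \int[mu]_(x in D) (f j x)%:E <= B%:E)%E) ->
  {ae mu, forall x, D x -> f j x @[j --> \oo] --> 0}.
Proof.
move=> mf f0 fB; pose g x := (\sum_(0 <= j <oo) (f j x)%:E)%E.
have mf' j : measurable_fun D (fun x => (f j x)%:E) by exact/measurable_EFinP.
have g0 x : (0 <= g x)%E by apply: nneseries_ge0 => n _ _; rewrite lee_fin.
have gint : mu.-integrable D g.
  apply/integrableP; split.
    by apply: ge0_emeasurable_sum => // j x _ _; rewrite lee_fin.
  under eq_integral do rewrite gee0_abs//.
  rewrite integral_nneseries//; last by move=> n x _; rewrite lee_fin.
  apply: (@le_lt_trans _ _ B%:E); last exact: ltry.
  apply: lime_le; last by apply: nearW => n; exact: fB.
  by apply: is_cvg_nneseries => n _ _; apply: integral_ge0 => x _; rewrite lee_fin.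
apply: filterS (integrable_ae mD gint) => x gx Dx.
apply: cvg_series_cvg_0; apply: nnseries_is_cvg => //.
by have := gx Dx; rewrite ge0_fin_numE.
Qed.

End SummableIntegrals.

Section WeightedIndicators.
Variable R : realType.
Local Notation leb := (@lebesgue_measure R).
Local Notation I01 := (`]0%R, 1%R]%classic : set R).
Variables (I : eqType).
Implicit Types (r : seq I) (c : I -> R) (E : I -> set R).

Definition indic_sum r c E (x : R) : R := \sum_(a <- r) c a * \1_(E a) x.

Lemma measurable_indic_sum r c E : (forall a, measurable (E a)) ->
  measurable_fun I01 (indic_sum r c E).
Proof.
move=> mE; apply: measurable_sum => a.
by apply: measurable_funM => //; exact: measurable_indic.
Qed.

Lemma indic_sum_ge0 r c E x : (forall a, 0 <= c a) -> 0 <= indic_sum r c E x.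
Proof. by move=> c0; apply: sumr_ge0 => a _; rewrite mulr_ge0// indicE. Qed.

Lemma integral_indic_sum r c E : (forall a, 0 <= c a) -> (forall a, measurable (E a)) ->
  (\int[leb]_(x in I01) (indic_sum r c E x)%:E = (\sum_(a <- r) c a * digit_prob (E a))%:E)%E.
Proof.
move=> c0 mE; have mI : measurable I01 by exact: measurable_itv.
have mc a : measurable_fun I01 (fun x : R => (c a * \1_(E a) x)%:E).
  by apply/measurable_EFinP; apply: measurable_funM => //; exact: measurable_indic.
under eq_integral do rewrite /indic_sum -sumEFin.
rewrite ge0_integral_sum//; last by move=> a x _; rewrite lee_fin mulr_ge0// indicE.
rewrite -sumEFin; apply: eq_bigr => a _.
under eq_integral do rewrite EFinM.
have mi : measurable_fun I01 (fun x : R => (\1_(E a) x : R)%:E).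
  by apply/measurable_EFinP; exact: measurable_indic.
rewrite ge0_integralZl_EFin//.
rewrite integral_indic//; [|exact: mE].
by rewrite EFinM; congr (_ * _)%E; rewrite setIC; exact: digit_probE (mE a).
Qed.

End WeightedIndicators.

Section Variance.
Variable R : realType.
Local Notation leb := (@lebesgue_measure R).
Local Notation I01 := (`]0%R, 1%R]%classic : set R).
Variables (I : eqType).
Implicit Types (r : seq I) (c : I -> R) (E : I -> set R).

Lemma indic_sum_sqr r c E x :
  indic_sum r c E x ^+ 2 =
  indic_sum [seq (a, b) | a <- r, b <- r] (fun ab => c ab.1 * c ab.2)
    (fun ab => E ab.1 `&` E ab.2) x.
Proof.
rewrite expr2 /indic_sum big_allpairs mulr_suml; apply: eq_bigr => a _.
rewrite mulr_sumr; apply: eq_bigr => b _ /=.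
by rewrite indicI /=; ring.
Qed.

Lemma integral_indic_sum_dev r c E : (forall a, 0 <= c a) -> (forall a, measurable (E a)) ->
  (\int[leb]_(x in I01) ((indic_sum r c E x - \sum_(a <- r) c a * digit_prob (E a)) ^+ 2)%:E =
  (\sum_(a <- r) \sum_(b <- r) c a * c b *
     (digit_prob (E a `&` E b) - digit_prob (E a) * digit_prob (E b)))%:E)%E.
Proof.
move=> c0 mE; have mI : measurable I01 by exact: measurable_itv.
set m := \sum_(a <- r) c a * digit_prob (E a); have m0 : 0 <= m.
  by apply: sumr_ge0 => a _; apply: mulr_ge0 => //; exact: cond_law_ge0.
have mS := measurable_indic_sum r c mE.
have mSm : measurable_fun I01 (fun x => ((indic_sum r c E x - m) ^+ 2)%:E).
  by apply/measurable_EFinP; apply: measurable_funX; exact: measurable_funB.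
have mS2 : measurable_fun I01 (fun x => (2 * m * indic_sum r c E x)%:E).
  by apply/measurable_EFinP; exact: measurable_funM.
have leb1 : leb I01 = 1%:E by rewrite lebesgue_measure_itv/= lte01 oppr0 adde0.
(* The square is expanded as [(S - m)^2 + 2 m S = S^2 + m^2], where all four terms are nonnegative,
   so that additivity for nonnegative integrands suffices; the linear term is cancelled at the
   end. *)
have h : (\int[leb]_(x in I01) ((indic_sum r c E x - m) ^+ 2)%:E +
    \int[leb]_(x in I01) (2 * m * indic_sum r c E x)%:E =
    \int[leb]_(x in I01) (indic_sum r c E x ^+ 2)%:E + \int[leb]_(x in I01) (m ^+ 2)%:E)%E.
  have dev0 x : I01 x -> (0 <= ((indic_sum r c E x - m) ^+ 2)%:E)%E by rewrite lee_fin sqr_ge0.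
  have lin0 x : I01 x -> (0 <= (2 * m * indic_sum r c E x)%:E)%E.
    by move=> _; rewrite lee_fin; apply: mulr_ge0; [apply: mulr_ge0|exact: indic_sum_ge0].
  have sq0 x : I01 x -> (0 <= (indic_sum r c E x ^+ 2)%:E)%E by rewrite lee_fin sqr_ge0.
  have cst0 x : I01 x -> (0 <= (m ^+ 2)%:E)%E by rewrite lee_fin sqr_ge0.
  have msq : measurable_fun I01 (fun x => (indic_sum r c E x ^+ 2)%:E).
    by apply/measurable_EFinP; apply: measurable_funX.
  rewrite -(ge0_integralD leb mI dev0 mSm lin0 mS2).
  rewrite -(ge0_integralD leb mI sq0 msq cst0 (measurable_cst _)).
  by apply: eq_integral => x _; rewrite -!EFinD; congr EFin; ring.
have int1 : (\int[leb]_(x in I01) (2 * m * indic_sum r c E x)%:E = (2 * m * m)%:E)%E.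
  under eq_integral do rewrite EFinM.
  rewrite ge0_integralZl_EFin//=; first by rewrite integral_indic_sum.
  - by move=> x _; rewrite lee_fin indic_sum_ge0.
  - exact/measurable_EFinP.
  - by rewrite mulr_ge0.
have int2 : (\int[leb]_(x in I01) (indic_sum r c E x ^+ 2)%:E =
   (\sum_(a <- r) \sum_(b <- r) c a * c b * digit_prob (E a `&` E b))%:E)%E.
  under eq_integral do rewrite indic_sum_sqr.
  rewrite integral_indic_sum//; first by rewrite big_allpairs.
  - by move=> ab; rewrite mulr_ge0.
  - by move=> ab; exact: measurableI.
have int3 : (\int[leb]_(x in I01) (m ^+ 2)%:E = (m ^+ 2)%:E)%E.
  transitivity ((m ^+ 2)%:E * leb I01)%E; last by rewrite leb1 mule1.
  exact: (integral_cst leb mI).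
have hm : \sum_(a <- r) \sum_(b <- r) c a * c b * (digit_prob (E a) * digit_prob (E b)) = m ^+ 2.
  rewrite expr2 /m mulr_suml; apply: eq_bigr => a _.
  by rewrite mulr_sumr; apply: eq_bigr => b _; ring.
move: h; rewrite int1 int2 int3 -EFinD => h.
have -> : (\sum_(a <- r) \sum_(b <- r) c a * c b *
     (digit_prob (E a `&` E b) - digit_prob (E a) * digit_prob (E b))) =
   \sum_(a <- r) \sum_(b <- r) c a * c b * digit_prob (E a `&` E b) + m ^+ 2 - 2 * m * m.
  have -> (u : R) : u + m ^+ 2 - 2 * m * m = u - m ^+ 2 by ring.
  rewrite -hm -sumrB; apply: eq_bigr => a _; rewrite -sumrB; apply: eq_bigr => b _.
  by rewrite mulrBr.
by rewrite EFinB -h addeK.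
Qed.

End Variance.

Section TruncatedSums.
Variable R : realType.
Local Notation leb := (@lebesgue_measure R).
Local Notation I01 := (`]0%R, 1%R]%classic : set R).
Implicit Types (i j k N n p q t : nat).

Definition truncation_index N t : seq (nat * nat) :=
  [seq (i, p) | i <- index_iota 0 N, p <- [seq p <- index_iota 0 t.+1 | prime p]].

(* Digits are shifted by one: the index [(i, p)] stands for the event [a_(i+1) = p]. *)
Definition index_event (a : nat * nat) : set R := digit_event a.1.+1 (pred1 a.2).

Lemma sum_truncation_index N t (F : nat * nat -> R) :
  \sum_(a <- truncation_index N t) F a =
  \sum_(0 <= i < N) \sum_(0 <= p < t.+1 | prime p) F (i, p).
Proof.
by rewrite /truncation_index big_allpairs; apply: eq_bigr => i _; rewrite big_filter.
Qed.

Definition truncated_sum N t : R -> R :=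
  indic_sum (truncation_index N t) (fun a => a.2%:R) index_event.

Definition truncated_mean N t : R :=
  \sum_(a <- truncation_index N t) a.2%:R * digit_prob (index_event a).

Lemma measurable_index_event a : measurable (index_event a).
Proof. exact: measurable_digit_event. Qed.

Let c : R := 11 / 12.

(** The first index is the earlier one, and the value is 0 otherwise. A covariance is then bounded
    through [decay i j + decay j i] in either order, and a sum over the earlier index is part of a
    geometric series. *)
Definition decay i j : R := if (i < j)%N then c ^+ (j - i.+1) else 0.

Lemma digit_prob_ge0 (E : set R) : 0 <= digit_prob E.
Proof. exact: cond_law_ge0. Qed.

Lemma decorrelation_lt i j p q : (i < j)%N -> prime p -> prime q ->
  p%:R * q%:R * (digit_prob (index_event (i, p) `&` index_event (j, q)) -
    digit_prob (index_event (i, p)) * digit_prob (index_event (j, q))) <=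
  8 * (p%:R^-1 * q%:R^-1) * decay i j.
Proof.
move=> ij pp pq; have [p0 q0] := (prime_gt0 pp, prime_gt0 pq).
have p1 : 1 <= p%:R :> R by exact: natr_ge1.
have q1 : 1 <= q%:R :> R by exact: natr_ge1.
rewrite /decay ij; have := digit_prob_pair R ij p0 q0.
have z01 : 0 <= (0 : R) <= 1 by rewrite lexx ler01.
have := @digit_prob_le1 R 0 i p z01 p0; rewrite -/(digit_prob _) /index_event /=.
have := digit_prob_ge0 (digit_event i.+1 (pred1 p)).
set P := digit_prob (digit_event i.+1 _); set Q := digit_prob (digit_event j.+1 _).
set PQ := digit_prob _; set d := 4 / _ * _ => P0 Pp hPQ.
have d0 : 0 <= d by rewrite /d mulr_ge0// exprn_ge0//; lra.
have h1 : PQ - P * Q <= d * (2 / p%:R ^+ 2).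
  have := ler_wpM2l d0 Pp; move: hPQ; rewrite mulrDl [Q * P]mulrC; lra.
apply: le_trans (ler_wpM2l _ h1) _; first by rewrite mulr_ge0.
rewrite /d le_eqVlt; apply/orP; left; apply/eqP; rewrite -/c; field.
by apply/andP; split; lra.
Qed.

(** Distinct positions decorrelate. At a single position, distinct primes give disjoint events and a
    nonpositive covariance, while [p = q] gives at most [p^2 * 2 / p^2 = 2]; hence the diagonal
    merely counts primes. *)
Lemma covariance_le i j p q : prime p -> prime q ->
  p%:R * q%:R * (digit_prob (index_event (i, p) `&` index_event (j, q)) -
    digit_prob (index_event (i, p)) * digit_prob (index_event (j, q))) <=
  (if i == j then if p == q then 2 else 0 else 0) +
    (8 * (p%:R^-1 * q%:R^-1) * decay i j + 8 * (p%:R^-1 * q%:R^-1) * decay j i).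
Proof.
move=> pp pq; have [p0 q0] := (prime_gt0 pp, prime_gt0 pq).
have p1 : 1 <= p%:R :> R by exact: natr_ge1.
have [ij|ji|<-] := ltngtP i j.
- rewrite add0r; apply: le_trans (decorrelation_lt ij pp pq) _.
  by rewrite /decay [(j < i)%N]ltnNge (ltnW ij) /= mulr0 addr0.
- rewrite add0r setIC [X in _ - X]mulrC [p%:R * q%:R]mulrC.
  apply: le_trans (decorrelation_lt ji pq pp) _.
  by rewrite /decay [(i < j)%N]ltnNge (ltnW ji) /= mulr0 add0r [q%:R^-1 * _]mulrC.
rewrite /decay ltnn !mulr0 !addr0; case: eqVneq => [<-|npq].
  rewrite setIid; apply: (@le_trans _ _ (p%:R * p%:R * (2 / p%:R ^+ 2))).
    rewrite ler_wpM2l ?mulr_ge0// lerBlDr.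
    apply: (@le_trans _ _ (2 / p%:R ^+ 2)); last by rewrite lerDl mulr_ge0// digit_prob_ge0.
    have z01 : 0 <= (0 : R) <= 1 by rewrite lexx ler01.
    exact: (@digit_prob_le1 R 0 i p z01 p0).
  by rewrite le_eqVlt; apply/orP; left; apply/eqP; field; lra.
have -> : index_event (i, p) `&` index_event (i, q) = set0.
  apply/seteqP; split => // x; rewrite /index_event /digit_event /= => -[/eqP -> /eqP pq'].
  by rewrite pq' eqxx in npq.
rewrite /(digit_prob set0) cond_law_set0 sub0r mulrN oppr_le0.
by rewrite !mulr_ge0// digit_prob_ge0.
Qed.

Lemma geometric_sum_le n : \sum_(0 <= k < n) c ^+ k <= 12.
Proof.
elim: n => [|n IH]; first by rewrite big_geq.
rewrite big_nat_recl//= expr0; under eq_bigr do rewrite exprS.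
by rewrite -mulr_sumr /c in IH *; lra.
Qed.

Lemma decay_sum_le N j : \sum_(0 <= i < N) decay i j <= 12.
Proof.
have h n : \sum_(0 <= i < n) c ^+ (n - i.+1) = \sum_(0 <= i < n) c ^+ i.
  rewrite [RHS]big_nat_rev add0n; exact: eq_big_nat.
have [Nj|jN] := leqP N j.
  apply: le_trans (geometric_sum_le j); rewrite -h (@big_cat_nat _ _ _ N 0 j)//=.
  rewrite ler_wpDr ?sumr_ge0//; last first.
    rewrite big_nat_cond [leRHS]big_nat_cond; apply: ler_sum => i /andP[/andP[_ iN] _].
    by rewrite /decay (leq_trans iN).
  by move=> i _; rewrite exprn_ge0// /c; lra.
rewrite (@big_cat_nat _ _ _ j 0 N)//=; last exact: ltnW.
rewrite [X in _ + X]big1_seq ?addr0; last first.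
  by move=> i; rewrite mem_index_iota => /andP[_ /andP[ji _]]; rewrite /decay ltnNge ji.
apply: le_trans (geometric_sum_le j); rewrite -h big_nat_cond [leRHS]big_nat_cond.
by apply: ler_sum => i /andP[/andP[_ iN] _]; rewrite /decay iN.
Qed.

(** The diagonal contributes 2 per index. Off the diagonal the prime sums factor into the square of
    [prime_recip_sum], and the two orders of the positions give [2 * 8 * 12 = 192]. *)
Lemma truncated_variance_le N t :
  (\int[leb]_(x in I01) ((truncated_sum N t x - truncated_mean N t) ^+ 2)%:E <=
   (2 * N%:R * prime_count R t + 192 * N%:R * prime_recip_sum R t ^+ 2)%:E)%E.
Proof.
rewrite /truncated_sum /truncated_mean integral_indic_sum_dev//; last first.
  exact: measurable_index_event.
rewrite lee_fin.
set H := prime_recip_sum R t; set C := prime_count R t.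
pose F i j p q : R := (if i == j then if p == q then 2 else 0 else 0) +
    (8 * (p%:R^-1 * q%:R^-1) * decay i j + 8 * (p%:R^-1 * q%:R^-1) * decay j i).
apply: (@le_trans _ _ (\sum_(0 <= i < N) \sum_(0 <= p < t.+1 | prime p)
   \sum_(0 <= j < N) \sum_(0 <= q < t.+1 | prime q) F i j p q)).
  rewrite sum_truncation_index; apply: ler_sum => i _; apply: ler_sum => p pp.
  rewrite sum_truncation_index; apply: ler_sum => j _; apply: ler_sum => q pq.
  exact: covariance_le.
have delta (a : R) m n k : 0 <= a -> \sum_(m <= j < n) (if k == j then a else 0) <= a.
  move=> a0; elim: n => [|n IH]; first by rewrite big_geq.
  have [mn|nm] := leqP m n; last by rewrite big_geq.
  rewrite big_nat_recr//=; case: eqVneq => [->|_]; last by rewrite addr0.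
  rewrite big1_seq ?add0r// => j; rewrite mem_index_iota => /andP[_ /andP[_ jn]].
  by rewrite gt_eqF.
have bound i p : prime p -> \sum_(0 <= j < N) \sum_(0 <= q < t.+1 | prime q) F i j p q <=
    2 + p%:R^-1 * (8 * H * (\sum_(0 <= j < N) decay i j) + 8 * H * \sum_(0 <= j < N) decay j i).
  move=> pp; rewrite /F.
  have -> : \sum_(0 <= j < N) \sum_(0 <= q < t.+1 | prime q)
      ((if i == j then if p == q then 2 else 0 else 0) +
      (8 * (p%:R^-1 * q%:R^-1) * decay i j + 8 * (p%:R^-1 * q%:R^-1) * decay j i)) =
     \sum_(0 <= j < N)
       (if i == j then \sum_(0 <= q < t.+1 | prime q) (if p == q then 2 else 0) else 0) +
     p%:R^-1 * (8 * H * (\sum_(0 <= j < N) decay i j) + 8 * H * \sum_(0 <= j < N) decay j i).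
    have dist h : p%:R^-1 * (8 * h * (\sum_(0 <= j < N) decay i j) +
        8 * h * \sum_(0 <= j < N) decay j i) =
        \sum_(0 <= j < N) p%:R^-1 * (8 * h * decay i j + 8 * h * decay j i).
      by rewrite mulrDr !mulr_sumr -big_split/=; apply: eq_bigr => j _; rewrite mulrDr.
    rewrite dist -big_split/=; apply: eq_bigr => j _.
    rewrite big_split/=; congr (_ + _).
      by case: eqP => // _; rewrite big1.
    transitivity (\sum_(0 <= q < t.+1 | prime q) 8 * p%:R^-1 * (decay i j + decay j i) * q%:R^-1).
      by apply: eq_bigr => q _; ring.
    by rewrite -mulr_sumr -/(prime_recip_sum R t) -/H; ring.
  rewrite lerD2r; apply: le_trans (delta 2 0%N N i _); last by [].
  apply: ler_sum => j _; case: ifP => // _.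
  apply: le_trans (delta 2 0%N t.+1 p _); last by [].
  by rewrite big_mkcond; apply: ler_sum => q _; case: ifP => // _; case: ifP.
(* Only the sum over the earlier position is bounded here; the other becomes of that kind after
   exchanging the order of summation. *)
apply: (@le_trans _ _ (\sum_(0 <= i < N) \sum_(0 <= p < t.+1 | prime p)
   (2 + p%:R^-1 * (8 * H * (\sum_(0 <= j < N) decay i j) + 8 * H * 12)))).
  apply: ler_sum => i _; apply: ler_sum => p pp; apply: le_trans (bound i p pp) _.
  rewrite lerD2l ler_wpM2l ?invr_ge0// lerD2l ler_wpM2l ?decay_sum_le//.
  by rewrite mulr_ge0// sumr_ge0// => q _; rewrite invr_ge0.
have H0 : 0 <= H by rewrite sumr_ge0// => q _; rewrite invr_ge0.
have -> : \sum_(0 <= i < N) \sum_(0 <= p < t.+1 | prime p)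
   (2 + p%:R^-1 * (8 * H * (\sum_(0 <= j < N) decay i j) + 8 * H * 12)) =
   2 * N%:R * C + 8 * H ^+ 2 * (\sum_(0 <= j < N) \sum_(0 <= i < N) decay i j) + 96 * N%:R * H ^+ 2.
  transitivity (\sum_(0 <= i < N) (2 * C + 96 * H ^+ 2 + 8 * H ^+ 2 * \sum_(0 <= j < N) decay i j)).
    apply: eq_bigr => i _; rewrite big_split/= -mulr_suml -/(prime_recip_sum R t) -/H.
    have -> : \sum_(0 <= p < t.+1 | prime p) 2 = 2 * C.
      by rewrite /C /prime_count mulr_sumr; apply: eq_bigr => p _; rewrite mulr1.
    by ring.
  rewrite big_split/= sumr_const_nat subn0 -mulr_sumr exchange_big/= -mulr_natr.
  by ring.
have : \sum_(0 <= j < N) \sum_(0 <= i < N) decay i j <= 12 * N%:R.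
  apply: (@le_trans _ _ (\sum_(0 <= j < N) (12 : R))).
    by apply: ler_sum => j _; exact: decay_sum_le.
  by rewrite sumr_const_nat subn0 mulr_natr.
move=> /(ler_wpM2l (_ : 0 <= 8 * H ^+ 2)) h; have {}h := h (mulr_ge0 (ler0n _ _) (sqr_ge0 _)).
have -> : 192 * N%:R * H ^+ 2 = 8 * H ^+ 2 * (12 * N%:R) + 96 * N%:R * H ^+ 2 by ring.
by rewrite -addrA lerD2l lerD2r.
Qed.

Lemma sum_inv_square_le n : \sum_(1 <= k < n.+2) (k%:R ^+ 2)^-1 <= 2 - (n.+1%:R)^-1 :> R.
Proof.
elim: n => [|n IH]; first by rewrite big_nat1 expr1n invr1; lra.
rewrite big_nat_recr//; apply: le_trans (lerD IH (lexx _)) _.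
rewrite -[n.+2%:R]natr1; have := natr_ge1 R (ltn0Sn n); move: (n.+1%:R) => x x1.
rewrite -subr_ge0.
have -> : 2 - (x + 1)^-1 - (2 - x^-1 + ((x + 1) ^+ 2)^-1) = (x * (x + 1) ^+ 2)^-1.
  by field; do ?[apply/andP; split]; lra.
by rewrite invr_ge0 mulr_ge0 ?exprn_ge0//; lra.
Qed.

Lemma sum_prime_inv_square_le t : \sum_(0 <= p < t.+1 | prime p) (p%:R ^+ 2)^-1 <= 2 :> R.
Proof.
apply: (@le_trans _ _ (\sum_(1 <= p < t.+2) (p%:R ^+ 2)^-1)); last first.
  by apply: le_trans (sum_inv_square_le t) _; rewrite gerBl invr_ge0.
rewrite [leRHS]big_nat_recr//= ler_wpDr ?invr_ge0 ?exprn_ge0//.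
rewrite big_ltn_cond//= [leRHS](_ : _ = \sum_(1 <= p < t.+1) (p%:R ^+ 2)^-1)//.
by rewrite big_mkcond; apply: ler_sum => p _; case: ifP => // _; rewrite invr_ge0 exprn_ge0.
Qed.

(** Weighted by [p], the relaxation error [2 (11/12)^i / p^2] sums over primes and positions to
    [2 * 12] times [prime_recip_sum]; the error [10 / p^3] gives [10 * 2] per position. *)
Lemma truncated_mean_approx N t :
  `|truncated_mean N t - (ln 2)^-1 * (N%:R * prime_recip_sum R t)| <=
  24 * prime_recip_sum R t + 20 * N%:R.
Proof.
rewrite /truncated_mean sum_truncation_index /=.
set H := prime_recip_sum R t; have H0 : 0 <= H by rewrite sumr_ge0// => q _; rewrite invr_ge0.
have -> : (ln 2)^-1 * (N%:R * H) =
    \sum_(0 <= i < N) \sum_(0 <= p < t.+1 | prime p) (ln 2)^-1 * p%:R^-1.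
  by rewrite sumr_const_nat subn0 -mulr_sumr -/(prime_recip_sum R t) -/H -[RHS]mulr_natr; ring.
rewrite -sumrB; apply: le_trans (ler_norm_sum _ _ _) _.
apply: (@le_trans _ _ (\sum_(0 <= i < N) (2 * H * c ^+ i + 20))).
  apply: ler_sum => i _; rewrite -sumrB; apply: le_trans (ler_norm_sum _ _ _) _.
  apply: (@le_trans _ _ (2 * H * c ^+ i +
      10 * \sum_(0 <= p < t.+1 | prime p) (p%:R ^+ 2)^-1)); last first.
    have h := sum_prime_inv_square_le t.
    have -> : 20 = 10 * 2 :> R by ring.
    by rewrite lerD2l ler_wpM2l.
  have -> : 2 * H * c ^+ i = \sum_(0 <= p < t.+1 | prime p) 2 * c ^+ i * p%:R^-1.
    by rewrite -mulr_sumr -/(prime_recip_sum R t) -/H; ring.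
  rewrite mulr_sumr -big_split/=; apply: ler_sum => p pp.
  have p0 := prime_gt0 pp; have p1 := natr_ge1 R p0.
  have := digit_prob_limit R i p0; rewrite -/(index_event (i, p)) => h.
  have -> : p%:R * digit_prob (index_event (i, p)) - (ln 2)^-1 / p%:R =
      p%:R * (digit_prob (index_event (i, p)) - (ln 2)^-1 / p%:R ^+ 2).
    by field; rewrite ?gt_eqF ?ln_gt0n//; lra.
  rewrite normrM [`|p%:R|]ger0_norm//.
  apply: le_trans (ler_wpM2l (ler0n R p) h) _.
  by rewrite /c le_eqVlt; apply/orP; left; apply/eqP; field; lra.
rewrite big_split/= -mulr_sumr sumr_const_nat subn0 -[20 *+ N]mulr_natr.
rewrite lerD2r; apply: le_trans (ler_wpM2l _ (geometric_sum_le N)) _.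
  by rewrite mulr_ge0.
by rewrite le_eqVlt; apply/orP; left; apply/eqP; ring.
Qed.

Definition large_prime t : pred nat := fun k => prime k && (t < k)%N.

(** A count of pairs rather than an event, so that its integral is a double sum; as it takes integer
    values, it is below 1 exactly when no pair occurs. *)
Definition pair_exceedances N t : R -> R :=
  indic_sum [seq (i, j) | i <- index_iota 0 N, j <- index_iota 0 N] (fun=> 1)
    (fun ij => if (ij.1 < ij.2)%N then
       digit_event ij.1.+1 (large_prime t) `&` digit_event ij.2.+1 (large_prime t)
     else set0).

Lemma pair_exceedances_le N t : (1 < t)%N ->
  (\int[leb]_(x in I01) (pair_exceedances N t x)%:E <=
   ((N%:R * (24 / (t%:R * ln t%:R))) ^+ 2)%:E)%E.
Proof.
move=> t1; rewrite integral_indic_sum//; last first.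
  by move=> a; case: ifP => // _; apply: measurableI; exact: measurable_digit_event.
rewrite lee_fin big_allpairs /=; set r := 24 / _.
have tail x : 0 <= x <= 1 -> cond_law x (@first_digit R @^-1` [set k | large_prime t k]) <= r.
  move=> x01; have -> : r = 2 * (12 / (t%:R * ln t%:R)) by rewrite /r mulrA; congr (_ / _); ring.
  apply: cond_law_digits_bound => // P; apply: le_trans (prime_square_tail R P t1).
  have [Pt|tP] := leqP P t.
    rewrite [leLHS]big_nat_cond [leLHS]big1; first by rewrite sumr_ge0.
    by move=> p; rewrite /large_prime => /andP[/andP[_ pP] /andP[_ tp]]; lia.
  rewrite (@big_cat_nat _ _ _ t.+1 1 P)//=.
  rewrite [X in X + _]big_nat_cond [X in X + _]big1 ?add0r; last first.
    by move=> p; rewrite /large_prime => /andP[/andP[_ pP] /andP[_ tp]]; lia.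
  rewrite big_mkcond [leRHS]big_mkcond; apply: ler_sum => p _ /=.
  by rewrite /large_prime; case: (prime p) => //=; case: ifP => // _; rewrite invr_ge0 exprn_ge0.
apply: (@le_trans _ _ (\sum_(0 <= i < N) \sum_(0 <= j < N) r ^+ 2)).
  apply: ler_sum => i _; apply: ler_sum => j _; rewrite mul1r /=.
  case: ifP => ij; first exact: digit_prob_pair_le.
  by rewrite /digit_prob cond_law_set0 sqr_ge0.
rewrite !sumr_const_nat subn0 -[leLHS]mulr_natr -[r ^+ 2 *+ N]mulr_natr.
by rewrite -[leLHS]mulrA -[N%:R * N%:R]expr2 [leLHS]mulrC -exprMn.
Qed.

End TruncatedSums.

(** * Deterministic comparison of trimmed and truncated sums *)

Section LargestTerm.
Implicit Types (Z : nat -> nat) (n m t i j : nat).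

Definition small_sum Z n t := (\sum_(0 <= i < n | Z i <= t) Z i)%N.
Definition large_sum Z n t := (\sum_(0 <= i < n | ~~ (Z i <= t)) Z i)%N.

Lemma small_large_sum Z n t : (small_sum Z n t + large_sum Z n t = \sum_(0 <= i < n) Z i)%N.
Proof. by rewrite /small_sum /large_sum [RHS](bigID (fun i => Z i <= t)%N). Qed.

Lemma small_sum_mono Z n m t t' : (n <= m)%N -> (t <= t')%N ->
  (small_sum Z n t <= small_sum Z m t')%N.
Proof.
move=> nm tt'; rewrite /small_sum (@big_cat_nat _ _ _ n 0 m)//=.
apply: leq_trans (leq_addr _ _); rewrite big_mkcond [leqRHS]big_mkcond.
by apply: leq_sum => i _; case: ifP => // it; rewrite (leq_trans it tt').
Qed.

Lemma large_sum_recr Z n t :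
  large_sum Z n.+1 t = (large_sum Z n t + if (Z n <= t)%N then 0 else Z n)%N.
Proof.
rewrite /large_sum big_mkcond big_nat_recr//= -big_mkcond; congr (_ + _)%N.
by case: (leqP (Z n) t).
Qed.

(** With at most one term above [t], [large_sum] is 0 or that single term. Together with
    [max_le_large_sum] this places the sum minus its maximum between [small_sum] minus [t] and
    [small_sum]. *)
Lemma large_sum_le_max Z n t :
  (forall i j, (i < j < n)%N -> (Z i <= t)%N || (Z j <= t)%N) ->
  (large_sum Z n t <= \max_(0 <= i < n) Z i)%N.
Proof.
elim: n => [|n IH] h; first by rewrite /large_sum !big_geq.
rewrite large_sum_recr big_nat_recr//=; case: (leqP (Z n) t) => [Zt|tZ].
  rewrite addn0 leq_max IH// => i j /andP[ij jn]; apply: h.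
  by rewrite ij ltnW.
rewrite [large_sum Z n t]big1_seq ?leq_maxr// => i.
rewrite mem_index_iota => /andP[/negP Zi /andP[_ i_n]]; exfalso; apply: Zi.
by have := h i n; rewrite i_n ltnSn => /(_ isT)/orP[//|]; rewrite leqNgt tZ.
Qed.

Lemma max_le_large_sum Z n t : (\max_(0 <= i < n) Z i <= t + large_sum Z n t)%N.
Proof.
elim: n => [|n IH]; first by rewrite !big_geq.
rewrite large_sum_recr big_nat_recr//= geq_max; case: (leqP (Z n) t) => Zt; lia.
Qed.

End LargestTerm.

Section TrimmedSum.
Variable R : realType.
Implicit Types (x : R) (n m N t i j : nat).

Lemma truncated_sumE N t x :
  truncated_sum N t x = (small_sum (fun i => prime_digit i.+1 x) N t)%:R.
Proof.
rewrite /truncated_sum /indic_sum sum_truncation_index /small_sum natr_sum [RHS]big_mkcond/=.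
apply: eq_bigr => i _; rewrite /index_event /prime_digit /=.
have indE p : \1_(digit_event i.+1 (pred1 p)) x = (cf_digit i.+1 x == p)%:R :> R.
  by rewrite indicE; congr (nat_of_bool _)%:R; apply/idP/idP; rewrite inE.
under eq_bigr do rewrite indE.
set d := cf_digit i.+1 x.
case: (boolP (prime d)) => dp; last first.
  rewrite leq0n big1// => p pp; case: eqVneq => [dE|_]; last by rewrite mulr0.
  by move: dp; rewrite dE pp.
have [dt|td] := leqP d t; last first.
  rewrite big_nat_cond big1// => p /andP[/andP[_ pt] _].
  by case: eqVneq => [dE|_]; [move: td; rewrite dE; lia|rewrite mulr0].
rewrite -big_filter (bigD1_seq d) ?filter_uniq ?iota_uniq ?mem_filter ?mem_index_iota ?dp//=.
rewrite eqxx mulr1 big1 ?addr0// => p.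
by move=> pd; rewrite eq_sym (negbTE pd) mulr0.
Qed.

Lemma pair_exceedances_lt1 N t x : pair_exceedances N t x < 1 ->
  forall i j, (i < j < N)%N -> (prime_digit i.+1 x <= t)%N || (prime_digit j.+1 x <= t)%N.
Proof.
move=> h i j /andP[ij jN]; apply: contraLR h; rewrite negb_or -!ltnNge -leNgt => /andP[ti tj].
rewrite /pair_exceedances /indic_sum.
have mem_ij : (i, j) \in [seq (i, j) | i <- index_iota 0 N, j <- index_iota 0 N].
  by apply: allpairs_f; rewrite mem_index_iota//= (ltn_trans ij).
rewrite (big_rem _ mem_ij)/= ij mul1r.
have large k : (t < prime_digit k.+1 x)%N -> large_prime t (cf_digit k.+1 x).
  by rewrite /prime_digit /large_prime; case: ifP.
have -> : \1_(digit_event i.+1 (large_prime t) `&`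
    digit_event j.+1 (large_prime t))%classic x = 1 :> R.
  by rewrite indicE mem_set//; split; exact: large.
by rewrite lerDl; apply: sumr_ge0 => a _; rewrite mul1r indicE.
Qed.

(** This fills the gap between two levels: small sums are monotone in length and cut, and a single
    exceedance condition, at the longer length [m] with the smaller cut [t], covers all [n] up to
    [m]. *)
Lemma trimmed_sum_bounds n N m t t' x : (N <= n <= m)%N -> (t <= t')%N ->
  pair_exceedances m t x < 1 ->
  truncated_sum N t x - t%:R <= (prime_digit_sum n x)%:R - (prime_digit_max n x)%:R
   <= truncated_sum m t' x.
Proof.
move=> /andP[Nn nm] tt' hx; pose Z i := prime_digit i.+1 x.
have SE : prime_digit_sum n x = (\sum_(0 <= i < n) Z i)%N.
  by rewrite /prime_digit_sum big_add1.
have ME : prime_digit_max n x = (\max_(0 <= i < n) Z i)%N.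
  by rewrite /prime_digit_max big_add1.
have one i j : (i < j < n)%N -> (Z i <= t)%N || (Z j <= t)%N.
  move=> /andP[ij jn]; apply: (pair_exceedances_lt1 hx).
  by rewrite ij (leq_trans jn).
have h1 := large_sum_le_max one; have h2 := max_le_large_sum Z n t.
rewrite SE ME -(small_large_sum Z n t) !truncated_sumE -/Z.
have h3 := small_sum_mono Z Nn (leqnn t); have h4 := small_sum_mono Z nm tt'.
move: h1 h2 h3 h4; rewrite -!(ler_nat R) natrD.
set a := (small_sum Z n t)%:R; set b := (large_sum Z n t)%:R; set c := (\max_(_ <= _ < _) _)%N%:R.
rewrite !natrD -/a -/b => *; apply/andP; split; lra.
Qed.

End TrimmedSum.

(** * Almost sure convergence along levels *)

Section Levels.
Variable R : realType.
Implicit Types (v y : R) (n m N t i j : nat).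

(* With [v = scale j], the ratio of consecutive [level_size] tends to 1, while both the
   relative variance of the sum truncated at [level_cut] and the probability of two larger
   prime digits are [O(v ^- 12) = O(j ^ (- 6 / 5))], hence summable. *)
Definition scale j : R := j.+1%:R `^ 10^-1.
Definition level_size j : nat := Num.truncn (expR (scale j ^+ 9)).
Definition level_cut j : nat := Num.truncn (expR (scale j ^+ 9) / scale j ^+ 3).

Lemma scale10 j : scale j ^+ 10 = j.+1%:R.
Proof.
by rewrite /scale -powR_mulrn ?powR_ge0// -powRrM mulVf ?powRr1// pnatr_eq0.
Qed.

Lemma scale_ge1 j : 1 <= scale j.
Proof.
rewrite /scale; have {1}<- : 1 `^ 10^-1 = 1 :> R by rewrite powR1.
by rewrite ge0_ler_powR ?nnegrE ?invr_ge0// (ler_nat R 1%N).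
Qed.

Lemma scale_gt0 j : 0 < scale j.
Proof. exact: lt_le_trans ltr01 (scale_ge1 j). Qed.

Lemma scale_le i j : (i <= j)%N -> scale i <= scale j.
Proof. by move=> ij; rewrite /scale ge0_ler_powR ?nnegrE ?invr_ge0// ler_nat. Qed.

Lemma scale9_step j : scale j.+1 ^+ 9 <= scale j ^+ 9 + (scale j)^-1.
Proof.
have v0 := scale_gt0 j; have vv' := scale_le (leqnSn j).
have h : scale j.+1 ^+ 10 = scale j ^+ 10 + 1 by rewrite !scale10 natr1.
rewrite -lerBlDl -[leRHS]mul1r ler_pdivlMr// mulrBl.
have -> : scale j ^+ 9 * scale j = scale j ^+ 10 by rewrite -exprSr.
suff : scale j.+1 ^+ 9 * scale j <= scale j.+1 ^+ 10 by lra.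
by rewrite [leRHS]exprSr ler_wpM2l// exprn_ge0// ltW// scale_gt0.
Qed.

Lemma ln_scale_step j : 9 * ln (scale j.+1) <= 9 * ln (scale j) + 1.
Proof.
have v0 := scale_gt0 j; have v1 := scale_gt0 j.+1.
have h : scale j.+1 ^+ 10 <= 2 * scale j ^+ 10.
  by rewrite !scale10 -natrM ler_nat; lia.
have : ln (scale j.+1 ^+ 10) <= ln (2 * scale j ^+ 10).
  by rewrite ler_ln ?posrE ?mulr_gt0 ?exprn_gt0.
rewrite lnM ?posrE ?exprn_gt0// !lnXn//.
rewrite -[ln (scale j.+1) *+ 10]mulr_natl -[ln (scale j) *+ 10]mulr_natl.
have l2 := ln2_le1 R.
by set a := ln (scale j.+1); set b := ln (scale j); lra.
Qed.

(** With [a], [b] the squares of consecutive scales, [b^5 - a^5 = 1] gives [b - a >= 1/(5 b^4)],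
    hence [1/a - 1/b >= 1/(5 b^6)]: a telescoping majorant for the series of [v^-12]. *)
Lemma scale_inv_step j : (scale j.+1 ^+ 12)^-1 <= 5 * ((scale j ^+ 2)^-1 - (scale j.+1 ^+ 2)^-1).
Proof.
have v0 := scale_gt0 j; have w0 := scale_gt0 j.+1; have vw := scale_le (leqnSn j).
have h : scale j.+1 ^+ 10 - scale j ^+ 10 = 1 by rewrite !scale10 -natr1 addrC addKr.
move: v0 w0 vw h; set v := scale j; set w := scale j.+1 => v0 w0 vw h.
have vw2 : v ^+ 2 <= w ^+ 2 by rewrite ler_sqr ?nnegrE// ltW.
have v20 : 0 < v ^+ 2 by rewrite exprn_gt0.
have w20 : 0 < w ^+ 2 by rewrite exprn_gt0.
have key : 1 <= (w ^+ 2 - v ^+ 2) * (5 * (w ^+ 2) ^+ 4).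
  have w10 : w ^+ 10 = (w ^+ 2) ^+ 5 by rewrite -exprM.
  have v10 : v ^+ 10 = (v ^+ 2) ^+ 5 by rewrite -exprM.
  rewrite -[leLHS]h w10 v10.
  move: vw2 v20 w20; move: (v ^+ 2) (w ^+ 2) => a b ab a0 b0.
  have -> : b ^+ 5 - a ^+ 5 =
      (b - a) * (b ^+ 4 + b ^+ 3 * a + b ^+ 2 * a ^+ 2 + b * a ^+ 3 + a ^+ 4) by ring.
  rewrite ler_wpM2l ?subr_ge0//.
  have e2 : a ^+ 2 <= b ^+ 2 by rewrite ler_sqr ?nnegrE// ltW.
  have e3 : a ^+ 3 <= b ^+ 3 by rewrite ler_pXn2r ?nnegrE// ltW.
  have e4 : a ^+ 4 <= b ^+ 4 by rewrite ler_pXn2r ?nnegrE// ltW.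
  have f1 : b ^+ 3 * a <= b ^+ 4 by rewrite [leRHS]exprSr ler_wpM2l ?exprn_ge0// ltW.
  have f2 : b ^+ 2 * a ^+ 2 <= b ^+ 4 by rewrite (exprD b 2 2) ler_wpM2l ?exprn_ge0// ltW.
  have f3 : b * a ^+ 3 <= b ^+ 4 by rewrite [leRHS]exprS ler_wpM2l// ltW.
  by lra.
have -> : (v ^+ 2)^-1 - (w ^+ 2)^-1 = (w ^+ 2 - v ^+ 2) / (v ^+ 2 * w ^+ 2).
  by field; apply/andP; split; rewrite gt_eqF.
have -> : w ^+ 12 = (w ^+ 2) ^+ 6 by rewrite -exprM.
move: key vw2 v20 w20; move: (v ^+ 2) (w ^+ 2) => a b key ab a0 b0.
rewrite mulrA ler_pdivlMr ?mulr_gt0// mulrC ler_pdivrMr ?exprn_gt0//.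
apply: (@le_trans _ _ (b ^+ 2)); first by rewrite expr2 ler_wpM2r// ltW.
have := ler_wpM2l (ltW (exprn_gt0 2 b0)) key; rewrite mulr1.
by move=> /le_trans; apply; rewrite le_eqVlt; apply/orP; left; apply/eqP; ring.
Qed.

Lemma scale_sum_le n : \sum_(0 <= j < n) (scale j.+1 ^+ 12)^-1 <= 5.
Proof.
apply: (@le_trans _ _ (5 * ((scale 0 ^+ 2)^-1 - (scale n ^+ 2)^-1))).
  elim: n => [|n IH]; first by rewrite big_geq// subrr mulr0.
  rewrite big_nat_recr//=; apply: le_trans (lerD IH (scale_inv_step n)) _.
  by rewrite -mulrDr addrA subrK.
have h : (scale 0 ^+ 2)^-1 <= 1 by rewrite invf_le1 ?exprn_gt0 ?scale_gt0// exprn_ege1// scale_ge1.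
have h' : 0 <= (scale n ^+ 2)^-1 by rewrite invr_ge0 exprn_ge0// ltW// scale_gt0.
by rewrite -[leRHS]mulr1 ler_wpM2l//; move: h h'; set a := _^-1; set b := _^-1; lra.
Qed.

Lemma scale_unbounded (M : R) : exists J, forall j, (J <= j)%N -> M <= scale j.
Proof.
exists (Num.truncn (`|M| ^+ 10)) => j Jj; apply: le_trans (ler_norm M) _.
rewrite -(@ler_pXn2r _ 10%N) ?nnegrE// ?scale10; last by rewrite ltW// scale_gt0.
apply: le_trans (ltW (truncnS_gt _)) _.
by rewrite ler_nat.
Qed.

Lemma truncn_half y : 1 <= y -> y / 2 <= (Num.truncn y)%:R <= y.
Proof.
move=> y1; have y0 : 0 <= y by lra.
have /andP[h1 h2] := truncn_itv y0.
have : 1 <= (Num.truncn y)%:R :> R by rewrite (ler_nat R 1%N) truncn_gt0.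
by rewrite -natr1 in h2; move=> h3; apply/andP; split; lra.
Qed.

Lemma expR_ge_sqr y : 0 <= y -> y ^+ 2 / 2 <= expR y.
Proof.
move=> y0; have := expR_ge1Dxn 1 y0; rewrite (_ : 2`!%N = 2)//; lra.
Qed.

Lemma loglog_itv v y : 2 <= v -> v ^+ 9 / 2 <= ln y <= v ^+ 9 ->
  9 * ln v - 1 <= ln (ln y) <= 9 * ln v.
Proof.
move=> v2 /andP[h1 h2]; have v0 : 0 < v by lra.
have v90 : 0 < v ^+ 9 by rewrite exprn_gt0.
have ly0 : 0 < ln y by apply: lt_le_trans h1; rewrite divr_gt0.
have l2 := ln2_le1 R.
have e9 : ln (v ^+ 9) = 9 * ln v by rewrite lnXn// mulr_natl.
have : ln (v ^+ 9 / 2) <= ln (ln y) by rewrite ler_ln ?posrE// divr_gt0.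
rewrite ln_div ?posrE// e9 => h3.
have : ln (ln y) <= ln (v ^+ 9) by rewrite ler_ln ?posrE.
by rewrite e9 => h4; apply/andP; split; lra.
Qed.

Section Level.
Variables (j : nat).
Hypothesis v2 : 2 <= scale j.
Let v := scale j.
Let E := expR (v ^+ 9).
Let N := level_size j.
Let t := level_cut j.

Let v0 : 0 < v. Proof. exact: scale_gt0. Qed.
Let E0 : 0 < E. Proof. exact: expR_gt0. Qed.

Lemma level_exp_ge : v ^+ 18 / 2 <= E.
Proof.
have := @expR_ge_sqr (v ^+ 9); rewrite -exprM; apply.
by rewrite exprn_ge0// ltW.
Qed.

Lemma level_size_itv : E / 2 <= N%:R <= E.
Proof.
apply: truncn_half; apply: le_trans (expR_ge1Dx _).
by rewrite lerDl exprn_ge0// ltW.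
Qed.

Let cut_ge : v ^+ 15 / 2 <= E / v ^+ 3.
Proof.
rewrite ler_pdivlMr ?exprn_gt0// mulrAC -exprD; exact: level_exp_ge.
Qed.

Lemma level_cut_itv : E / (2 * v ^+ 3) <= t%:R <= E / v ^+ 3.
Proof.
have -> : E / (2 * v ^+ 3) = E / v ^+ 3 / 2 by field; rewrite gt_eqF.
apply: truncn_half; apply: le_trans cut_ge.
have : 2 ^+ 15 <= v ^+ 15 by rewrite ler_pXn2r ?nnegrE// ltW.
have : 2 <= 2 ^+ 15 :> R by rewrite -[leLHS]expr1 ler_weXn2l//; lra.
by set a := 2 ^+ 15; lra.
Qed.

Lemma level_cut_gt1 : (1 < t)%N.
Proof.
rewrite -(ltr_nat R); have /andP[h _] := level_cut_itv; apply: lt_le_trans h.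
have -> : E / (2 * v ^+ 3) = E / v ^+ 3 / 2 by field; rewrite gt_eqF.
have h15 : 2 ^+ 15 <= v ^+ 15 by rewrite ler_pXn2r ?nnegrE// ltW.
have h16 : 2 ^+ 3 <= 2 ^+ 15 :> R by rewrite ler_weXn2l//; lra.
have -> : 1%:R = 2 ^+ 3 / 2 / 4 :> R by field.
have := cut_ge; set b := E / _; move: h15 h16; set a := 2 ^+ 15; set c := 2 ^+ 3.
have c0 : 0 < c by rewrite /c exprn_gt0.
lra.
Qed.

Lemma ln_level_size : v ^+ 9 / 2 <= ln N%:R <= v ^+ 9.
Proof.
have /andP[h1 h2] := level_size_itv.
have N0 : 0 < N%:R :> R by apply: lt_le_trans h1; rewrite divr_gt0.
have l2 := ln2_le1 R.
have v9 : 2 ^+ 9 <= v ^+ 9 by rewrite ler_pXn2r ?nnegrE// ltW.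
have v9' : 2 <= 2 ^+ 9 :> R by rewrite -[leLHS]expr1 ler_weXn2l//; lra.
have : ln (E / 2) <= ln N%:R by rewrite ler_ln ?posrE// divr_gt0.
have : ln N%:R <= ln E by rewrite ler_ln ?posrE.
rewrite ln_div ?posrE// expRK; move: v9 v9'; set c := 2 ^+ 9 => *.
by apply/andP; split; lra.
Qed.

Lemma ln_level_cut : v ^+ 9 / 2 <= ln t%:R <= v ^+ 9.
Proof.
have /andP[h1 h2] := level_cut_itv.
have v30 : 0 < v ^+ 3 by rewrite exprn_gt0.
have t0 : 0 < t%:R :> R by rewrite ltr0n ltnW// level_cut_gt1.
have v31 : 1 <= v ^+ 3 by apply: exprn_ege1; exact: scale_ge1.
have : ln (E / (2 * v ^+ 3)) <= ln t%:R by rewrite ler_ln ?posrE ?divr_gt0 ?mulr_gt0.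
rewrite ln_div ?posrE ?mulr_gt0// expRK => h3.
have h4 : ln (2 * v ^+ 3) <= 2 * v ^+ 3 by apply/ltW/ln_sublinear; rewrite mulr_gt0.
have h5 : 2 * v ^+ 3 <= v ^+ 9 / 2.
  have -> : v ^+ 9 = v ^+ 6 * v ^+ 3 by rewrite -exprD.
  have h6 : 2 ^+ 6 <= v ^+ 6 by rewrite ler_pXn2r ?nnegrE// ltW.
  have h7 : 4 <= 2 ^+ 6 :> R by rewrite -natrX ler_nat.
  rewrite mulrAC ler_wpM2r ?(ltW v30)//; move: h6 h7; set c := 2 ^+ 6; lra.
apply/andP; split; first lra.
have : ln t%:R <= ln E.
  rewrite ler_ln ?posrE//; apply: le_trans h2 _.
  by rewrite ler_pdivrMr// ler_peMr// ltW.
by rewrite expRK.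
Qed.

Lemma level_cut_le_size : (t <= N)%N.
Proof.
apply: le_truncn; rewrite ler_pdivrMr ?exprn_gt0// ler_peMr ?expR_ge0//.
by apply: exprn_ege1; exact: scale_ge1.
Qed.

End Level.

End Levels.

(** * Moments and growth at the levels *)

Section LevelEstimates.
Variable R : realType.
Local Notation scale := (scale R).
Local Notation level_size := (level_size R).
Local Notation level_cut := (level_cut R).
Implicit Types (v y : R) (n m N t i j : nat).

(** As [ln t] lies between [v^9 / 2] and [v^9], its logarithm is [9 ln v + O(1)]: cutting at [t]
    instead of [N] changes the Mertens sum by a bounded amount. *)
Lemma prime_recip_level : exists2 C : R, 0 <= C & forall j, 2 <= scale j ->
  `|prime_recip_sum R (level_cut j) - 9 * ln (scale j)| <= C.
Proof.
have [C [C0 hC]] := mertens2 R; exists (C + 1); first by rewrite addr_ge0.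
move=> j v2; have := hC _ (level_cut_gt1 v2).
have := loglog_itv v2 (ln_level_cut v2).
rewrite !ler_norml => /andP[h1 h2] /andP[h3 h4].
by apply/andP; split; lra.
Qed.

Lemma scale_pow_le v m n : 2 <= v -> (m <= n)%N -> v ^+ m <= v ^+ n.
Proof. by move=> v2 mn; rewrite ler_weXn2l//; lra. Qed.

Lemma ln_scale_itv j : 0 <= ln (scale j) <= scale j.
Proof. by rewrite ln_ge0 ?scale_ge1//= ltW// ln_sublinear// scale_gt0. Qed.

Lemma prime_recip_level_le : exists2 C : R, 0 <= C & forall j, 2 <= scale j ->
  0 <= prime_recip_sum R (level_cut j) <= C * scale j.
Proof.
have [C C0 hC] := prime_recip_level; exists (9 + C); first by rewrite addr_ge0.
move=> j v2; apply/andP; split; first by rewrite sumr_ge0// => p _; rewrite invr_ge0.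
have /andP[_ l] := ln_scale_itv j; have v1 := scale_ge1 R j.
have := hC j v2; rewrite ler_norml => /andP[_ h]; rewrite mulrDl.
have : C <= C * scale j by rewrite ler_peMr.
by lra.
Qed.

(** The primes up to [t] number [O(E / v^12)]: three powers of [v] come from the cut and nine from
    [ln t]. The off-diagonal part is [O(v^2 / E)], so the crude bound [O(v)] on the Mertens sum is
    enough. *)
Lemma variance_level : exists2 C : R, 0 <= C & forall j, 2 <= scale j ->
  ((level_size j)%:R ^+ 2)^-1 * (2 * (level_size j)%:R * prime_count R (level_cut j) +
    192 * (level_size j)%:R * prime_recip_sum R (level_cut j) ^+ 2) <= C / scale j ^+ 12.
Proof.
have [C C0 hC] := prime_recip_level_le; exists (128 + 768 * C ^+ 2).
  by apply: addr_ge0; [exact: ler0n|apply: mulr_ge0; [exact: ler0n|exact: sqr_ge0]].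
move=> j v2; have /andP[N1 _] := level_size_itv R j.
have /andP[H0 H1] := hC j v2; have /andP[t1 t2] := level_cut_itv v2.
have tgt1 := level_cut_gt1 v2; have pc := prime_count_le R tgt1.
have /andP[l1 _] := ln_level_cut v2; have E1 := level_exp_ge R j.
have v0 := scale_gt0 R j.
move: H0 H1 N1 t1 t2 pc l1 E1; set v := scale j in v2 v0 *; set E := expR (v ^+ 9).
set H := prime_recip_sum R _; set N : R := (level_size j)%:R.
set t := (level_cut j)%:R; set P := prime_count R _.
move=> H0 H1 N1 t1 t2 pc l1 E1.
have E0 : 0 < E by exact: expR_gt0.
have N0 : 0 < N by apply: lt_le_trans N1; rewrite divr_gt0.
have v90 : 0 < v ^+ 9 by rewrite exprn_gt0.
have v120 : 0 < v ^+ 12 by rewrite exprn_gt0.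
have v20 : 0 < v ^+ 2 by rewrite exprn_gt0.
have P1 : P <= 32 * E / v ^+ 12.
  apply: le_trans pc _.
  have lt0 : 0 < ln t by apply: lt_le_trans l1; rewrite divr_gt0.
  rewrite ler_pdivrMr//.
  apply: (@le_trans _ _ (16 * (E / v ^+ 3))); first by rewrite ler_wpM2l.
  have -> : 16 * (E / v ^+ 3) = 32 * E / v ^+ 12 * (v ^+ 9 / 2).
    by rewrite (exprD v 9 3); field; rewrite gt_eqF.
  by rewrite ler_wpM2l// divr_ge0 ?mulr_ge0// ltW.
have H2 : H ^+ 2 <= C ^+ 2 * v ^+ 2.
  by rewrite -exprMn ler_sqr ?nnegrE// mulr_ge0// ltW.
have NE : N^-1 <= 2 / E.
  by rewrite -invf_div lef_pV2 ?posrE// divr_gt0.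
have vE : v ^+ 2 * E^-1 <= 2 / v ^+ 12.
  rewrite ler_pdivrMr// mulrAC ler_pdivlMr//.
  have h14 : v ^+ 2 * v ^+ 12 <= v ^+ 18 by rewrite -exprD scale_pow_le.
  by lra.
have -> : (N ^+ 2)^-1 * (2 * N * P + 192 * N * H ^+ 2) = N^-1 * (2 * P + 192 * H ^+ 2).
  by field; rewrite gt_eqF.
have P0 : 0 <= P by rewrite sumr_ge0.
have S0 : 0 <= 2 * P + 192 * H ^+ 2.
  by apply: addr_ge0; apply: mulr_ge0; rewrite ?ler0n ?sqr_ge0.
apply: le_trans (ler_wpM2r S0 NE) _.
have S1 : 2 * P + 192 * H ^+ 2 <= 2 * (32 * E / v ^+ 12) + 192 * (C ^+ 2 * v ^+ 2).
  by apply: lerD; apply: ler_wpM2l; rewrite ?ler0n.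
have iE : 0 <= 2 / E by rewrite divr_ge0// ltW.
apply: le_trans (ler_wpM2l iE S1) _.
have -> : 2 / E * (2 * (32 * E / v ^+ 12) + 192 * (C ^+ 2 * v ^+ 2)) =
   128 / v ^+ 12 + 384 * C ^+ 2 * (v ^+ 2 * E^-1).
  by field; apply/andP; split; rewrite gt_eqF.
have k0 : 0 <= 384 * C ^+ 2 by apply: mulr_ge0; [exact: ler0n|exact: sqr_ge0].
have h := ler_wpM2l k0 vE.
apply: le_trans (lerD (lexx _) h) _.
by rewrite le_eqVlt; apply/orP; left; apply/eqP; field; rewrite gt_eqF.
Qed.

Lemma level_size_step j : 2 <= scale j ->
  (level_size j.+1)%:R <= expR (3 / scale j) * (level_size j)%:R :> R.
Proof.
move=> v2; have /andP[_ N2] := level_size_itv R j.+1; apply: le_trans N2 _.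
have st := scale9_step R j; have E1 := level_exp_ge R j; have v0 := scale_gt0 R j.
have NE := truncnS_gt (expR (scale j ^+ 9)); rewrite -natr1 -/(level_size j) in NE.
move: st E1 v0 NE; set v := scale j in v2 *; set E := expR (v ^+ 9).
set N : R := (level_size j)%:R => st E1 v0 NE.
have e1 : expR (scale j.+1 ^+ 9) <= E * expR v^-1 by rewrite -expRD ler_expR.
apply: le_trans e1 _.
(* Here [1/v] bounds the increment of the exponent [v^9], and [2/v] pays for rounding the level down
   to an integer. *)
have -> : 3 / v = v^-1 + 2 / v by field; rewrite gt_eqF.
rewrite expRD -mulrA mulrC ler_wpM2l ?expR_ge0//.
have vE : v * 2 <= E.
  apply: le_trans E1; have := scale_pow_le v2 (isT : 3 <= 18)%N.
  have -> : v ^+ 3 = v * v * v by rewrite !exprS expr0 mulr1 mulrA.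
  have : 4 <= v * v by nra.
  by nra.
have e2 := expR_ge1Dx (2 / v).
have N0 : 0 <= N by [].
apply: (@le_trans _ _ ((1 + 2 / v) * N)); last by rewrite ler_wpM2r.
have h : 2 <= 2 / v * N + 2 / v.
  have -> : 2 / v * N + 2 / v = (2 * N + 2) / v by field; rewrite gt_eqF.
  by rewrite ler_pdivlMr//; lra.
have i1 : 2 / v <= 1 by rewrite ler_pdivrMr//; lra.
by rewrite mulrDl mul1r; lra.
Qed.

Lemma exceedance_level : exists2 C : R, 0 <= C & forall j, 2 <= scale j ->
  ((level_size j.+1)%:R * (24 / ((level_cut j)%:R * ln (level_cut j)%:R))) ^+ 2 <=
  C / scale j ^+ 12.
Proof.
exists ((96 * expR 2) ^+ 2); first by rewrite sqr_ge0.
move=> j v2; have /andP[t1 _] := level_cut_itv v2; have /andP[l1 _] := ln_level_cut v2.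
have st := level_size_step v2; have /andP[_ N2] := level_size_itv R j.
have v0 := scale_gt0 R j.
move: t1 l1 st N2; set v := scale j in v2 v0 *; set E := expR (v ^+ 9).
move: (level_cut j) (level_size j) (level_size j.+1) => tj Nj Nj'.
set t : R := tj%:R; set N : R := Nj%:R; set N' : R := Nj'%:R.
move=> t1 l1 st N2; have E0 : 0 < E by exact: expR_gt0.
have N'E : N' <= expR 2 * E.
  apply: le_trans st _; rewrite ler_pM ?expR_ge0// ler_expR ler_pdivrMr//; lra.
have v30 : 0 < v ^+ 3 by rewrite exprn_gt0.
have v60 : 0 < v ^+ 6 by rewrite exprn_gt0.
have tl : E * v ^+ 6 / 4 <= t * ln t.
  have -> : E * v ^+ 6 / 4 = E / (2 * v ^+ 3) * (v ^+ 9 / 2).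
    rewrite (_ : v ^+ 9 = v ^+ 6 * v ^+ 3) -?exprD//; field; rewrite gt_eqF//.
  by rewrite ler_pM ?divr_ge0 ?mulr_ge0 ?exprn_ge0// ltW.
have q0 : 0 < E * v ^+ 6 / 4 by rewrite divr_gt0 ?mulr_gt0.
have tl0 : 0 < t * ln t by exact: lt_le_trans tl.
have -> : (96 * expR 2) ^+ 2 / v ^+ 12 = (96 * expR 2 / v ^+ 6) ^+ 2.
  by rewrite expr_div_n -exprM.
rewrite ler_sqr ?nnegrE; last 2 first.
- by rewrite mulr_ge0// divr_ge0// ltW.
- by rewrite divr_ge0 ?mulr_ge0 ?expR_ge0// ltW.
have h : 24 / (t * ln t) <= 24 / (E * v ^+ 6 / 4) by rewrite ler_wpM2l// lef_pV2 ?posrE.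
have -> : 96 * expR 2 / v ^+ 6 = expR 2 * E * (24 / (E * v ^+ 6 / 4)).
  by field; apply/andP; split; rewrite gt_eqF.
by rewrite ler_pM// divr_ge0// ltW.
Qed.

Lemma mean_level : exists2 C : R, 0 <= C & forall j, 2 <= scale j ->
  `|truncated_mean R (level_size j) (level_cut j) -
     (level_size j)%:R * (9 * ln (scale j) / ln 2)| <= C * (level_size j)%:R.
Proof.
have [C C0 hC] := prime_recip_level; have [D D0 hD] := prime_recip_level_le.
have l20 : 0 < ln 2 :> R by exact: ln_gt0n.
exists (24 * D + 20 + C / ln 2).
  apply: addr_ge0; last by rewrite divr_ge0// ltW.
  by apply: addr_ge0; [apply: mulr_ge0; rewrite ?ler0n|exact: ler0n].
move=> j v2; have h1 := truncated_mean_approx R (level_size j) (level_cut j).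
have h2 := hC j v2; have /andP[H0 H1] := hD j v2.
have /andP[N1 _] := level_size_itv R j; have E1 := level_exp_ge R j.
have v0 := scale_gt0 R j.
move: h1 h2 H0 H1 N1 E1; set v := scale j in v2 v0 *; set E := expR (v ^+ 9).
set H := prime_recip_sum R _; set N : R := (level_size j)%:R; set m := truncated_mean R _ _.
move=> h1 h2 H0 H1 N1 E1.
have vN : v <= N.
  apply: le_trans N1; have := scale_pow_le v2 (isT : 3 <= 18)%N.
  have -> : v ^+ 3 = v * v * v by rewrite !exprS expr0 mulr1 mulrA.
  have : 4 <= v * v by nra.
  by nra.
have N0 : 0 <= N by [].
have HN : 24 * H <= 24 * D * N.
  by rewrite -mulrA ler_wpM2l//; apply: le_trans H1 _; rewrite ler_wpM2l.
have h3 : `|(ln 2)^-1 * (N * H) - N * (9 * ln v / ln 2)| <= C / ln 2 * N.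
  have -> : (ln 2)^-1 * (N * H) - N * (9 * ln v / ln 2) = (H - 9 * ln v) * ((ln 2)^-1 * N).
    by field; rewrite gt_eqF.
  rewrite normrM [`|_ * N|]ger0_norm; last by rewrite mulr_ge0// invr_ge0 ltW.
  by rewrite -mulrA ler_wpM2r// mulr_ge0// invr_ge0 ltW.
apply: le_trans (ler_distD _ _ _) (le_trans (lerD h1 h3) _).
have -> : (24 * D + 20 + C / ln 2) * N = 24 * D * N + 20 * N + C / ln 2 * N by ring.
by rewrite lerD2r lerD2r.
Qed.

Lemma ln_mono (x y : R) : 0 < x -> x <= y -> ln x <= ln y.
Proof. by move=> x0 xy; rewrite ler_ln ?posrE// (lt_le_trans x0). Qed.

Lemma loglog_level n j : 2 <= scale j -> (level_size j <= n <= level_size j.+1)%N ->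
  9 * ln (scale j) - 1 <= ln (ln n%:R) <= 9 * ln (scale j) + 1.
Proof.
move=> v2 /andP[Nn nN].
have v2' : 2 <= scale j.+1 := le_trans v2 (scale_le R (leqnSn j)).
have /andP[a1 _] := loglog_itv v2 (ln_level_size v2).
have /andP[_ a2] := loglog_itv v2' (ln_level_size v2').
have a3 := ln_scale_step R j.
have v0 := scale_gt0 R j.
have lN : 0 < ln (level_size j)%:R :> R.
  have /andP[h _] := ln_level_size v2; apply: lt_le_trans h.
  by rewrite divr_gt0// exprn_gt0.
have N0 : (0 < level_size j)%N.
  by case: (level_size j) lN => //; rewrite ln0// ltxx.
have N0' : 0 < (level_size j)%:R :> R by rewrite ltr0n.
have n0 : 0 < n%:R :> R by rewrite ltr0n; exact: leq_trans N0 Nn.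
have b1 : ln (level_size j)%:R <= ln n%:R :> R by apply: ln_mono N0' _; rewrite ler_nat.
have b2 : ln n%:R <= ln (level_size j.+1)%:R :> R by apply: ln_mono n0 _; rewrite ler_nat.
have c1 := ln_mono lN b1.
have c2 := ln_mono (lt_le_trans lN b1) b2.
by rewrite (le_trans a1 c1) (le_trans c2 (le_trans a2 a3)).
Qed.

Lemma level_size_mono i j : (i <= j)%N -> (level_size i <= level_size j)%N.
Proof.
move=> ij; apply: le_truncn; rewrite ler_expR ler_pXn2r ?nnegrE ?(ltW (scale_gt0 _ _))//.
exact: scale_le.
Qed.

Lemma level_cut_mono j : 2 <= scale j -> (level_cut j <= level_cut j.+1)%N.
Proof.
move=> v2; apply: le_truncn; have v0 := scale_gt0 R j; have w0 := scale_gt0 R j.+1.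
have vw := scale_le R (leqnSn j).
move: v2 v0 w0 vw; set v := scale j; set w := scale j.+1 => v2 v0 w0 vw.
have v30 : 0 < v ^+ 3 by rewrite exprn_gt0.
have w30 : 0 < w ^+ 3 by rewrite exprn_gt0.
rewrite ler_pdivlMr// mulrAC ler_pdivrMr//.
have -> : expR (w ^+ 9) = expR (v ^+ 9) * expR (w ^+ 9 - v ^+ 9) by rewrite -expRD addrC subrK.
rewrite -mulrA ler_wpM2l ?expR_ge0//.
have a3 : v ^+ 3 <= w ^+ 3 by rewrite ler_pXn2r ?nnegrE ?(ltW v0) ?(ltW w0).
have v31 : 1 <= v ^+ 3 by apply: exprn_ege1; lra.
have a9 : w ^+ 3 - v ^+ 3 <= w ^+ 9 - v ^+ 9.
  have e9 (x : R) : x ^+ 9 = (x ^+ 3) ^+ 3 by rewrite -exprM.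
  rewrite !e9.
  move: a3 v31; move: (v ^+ 3) (w ^+ 3) => a b ab a1.
  have -> : b ^+ 3 - a ^+ 3 = (b - a) * (b * b + b * a + a * a) by ring.
  by rewrite ler_peMr ?subr_ge0//; nra.
have h := expR_ge1Dx (w ^+ 9 - v ^+ 9).
apply: (@le_trans _ _ ((1 + (w ^+ 9 - v ^+ 9)) * v ^+ 3)); last by rewrite ler_wpM2r// ltW.
move: a9 a3 v31 v30 w30; move: (w ^+ 9 - v ^+ 9) (v ^+ 3) (w ^+ 3) => d a b *.
nra.
Qed.

End LevelEstimates.

(** * Almost sure statements and interpolation between levels *)

Section AlmostSure.
Variable R : realType.
Local Notation leb := (@lebesgue_measure R).
Local Notation I01 := (`]0%R, 1%R]%classic : set R).
Local Notation scale := (scale R).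
Local Notation level_size := (level_size R).
Local Notation level_cut := (level_cut R).
Implicit Types (n m N t i j : nat) (x : R).

Lemma ae_mono (P Q : R -> Prop) : (forall x, P x -> Q x) ->
  {ae leb, forall x, P x} -> {ae leb, forall x, Q x}.
Proof.
move=> PQ; apply: (@filterS _ _ (@ae_filter_ringOfSetsType _ (measurableTypeR R) R leb)).
by move=> x; exact: PQ.
Qed.

(** The integral bounds hold only once [scale j >= 2], so the sequence is shifted by [J.+1];
    convergence to 0 is then used only in the form of eventual smallness below 1. *)
Lemma ae_level_small (f : nat -> R -> R) (C : R) :
  0 <= C -> (forall j, measurable_fun I01 (f j)) -> (forall j x, 0 <= f j x) ->
  (forall j, 2 <= scale j ->
    (\int[leb]_(x in I01) (f j x)%:E <= (C / scale j ^+ 12)%:E)%E) ->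
  {ae leb, forall x, I01 x -> exists J, forall j, (J <= j)%N -> f j x < 1}.
Proof.
move=> C0 mf f0 fC; have [J J2] := scale_unbounded (2 : R).
have mI : measurable I01 by exact: measurable_itv.
have bound n : (\sum_(0 <= j < n) \int[leb]_(x in I01) (f (j + J.+1)%N x)%:E <= (C * 5)%:E)%E.
  apply: (@le_trans _ _ (\sum_(0 <= j < n) C / scale j.+1 ^+ 12)%:E).
    rewrite -sumEFin; apply: lee_sum => j _.
    apply: (@le_trans _ _ (C / scale (j + J.+1) ^+ 12)%:E).
      by apply: fC; apply: J2; rewrite addnS leqW// leq_addl.
    rewrite lee_fin ler_wpM2l// lef_pV2 ?posrE ?exprn_gt0 ?scale_gt0//.
    rewrite ler_pXn2r ?nnegrE ?(ltW (scale_gt0 _ _))// scale_le//.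
    by rewrite addnS ltnS leq_addr.
  by rewrite lee_fin -mulr_sumr ler_wpM2l// scale_sum_le.
have := @ae_cvg0_of_summable_integrals R _ _ leb I01 mI (fun j => f (j + J.+1)%N) (C * 5)
  (fun j => mf (j + J.+1)%N) (fun j => f0 (j + J.+1)%N) bound.
apply: ae_mono => x fx Ix; have /cvgrPdist_lt := fx Ix.
move=> /(_ 1 ltr01)[J' _ hJ']; exists (J' + J.+1)%N => j Jj.
have := hJ' (j - J.+1)%N; rewrite /= sub0r normrN subnK; last lia.
rewrite ger0_norm//; apply; lia.
Qed.

(** A deviation as large as [N] is harmless against [N log log N], so the squared deviation is
    normalised by [N^-2] only. *)
Lemma ae_deviation : {ae leb, forall x, I01 x -> exists J, forall j, (J <= j)%N ->
  `|truncated_sum (level_size j) (level_cut j) x -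
    truncated_mean R (level_size j) (level_cut j)| <= (level_size j)%:R}.
Proof.
have [C C0 hC] := variance_level R.
pose f j x : R := ((level_size j)%:R ^+ 2)^-1 *
  (truncated_sum (level_size j) (level_cut j) x -
    truncated_mean R (level_size j) (level_cut j)) ^+ 2.
have mI : measurable I01 by exact: measurable_itv.
have mdev j : measurable_fun I01 (fun x : R => (truncated_sum (level_size j) (level_cut j) x -
    truncated_mean R (level_size j) (level_cut j)) ^+ 2).
  apply: measurable_funX; apply: measurable_funB => //.
  by apply: measurable_indic_sum; exact: measurable_index_event.
have mdev' j : measurable_fun I01 (fun x : R => ((truncated_sum (level_size j) (level_cut j) x -
    truncated_mean R (level_size j) (level_cut j)) ^+ 2)%:E) by exact/measurable_EFinP.
have dev0 j x : I01 x -> (0 <= ((truncated_sum (level_size j) (level_cut j) x -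
    truncated_mean R (level_size j) (level_cut j)) ^+ 2)%:E)%E.
  by move=> _; rewrite lee_fin sqr_ge0.
have s0 j : 0 <= ((level_size j)%:R ^+ 2)^-1 :> R by rewrite invr_ge0 sqr_ge0.
have f0 j x : 0 <= f j x by rewrite mulr_ge0// sqr_ge0.
have mf j : measurable_fun I01 (f j) by exact: measurable_funM.
have intf j : 2 <= scale j ->
    (\int[leb]_(x in I01) (f j x)%:E <= (C / scale j ^+ 12)%:E)%E.
  move=> v2; under eq_integral do rewrite /f EFinM.
  rewrite (ge0_integralZl_EFin leb mI (dev0 j) (mdev' j) (s0 j)).
  apply: le_trans (lee_wpmul2l _ (truncated_variance_le R (level_size j) (level_cut j))) _.
    by rewrite lee_fin; exact: s0.
  by rewrite -EFinM lee_fin hC.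
apply: ae_mono (ae_level_small C0 mf f0 intf) => x hx Ix.
have [J hJ] := hx Ix; have [J2 hJ2] := scale_unbounded (2 : R).
exists (maxn J J2) => j; rewrite geq_max => /andP[/hJ + /hJ2 v2].
have N0 : 0 < (level_size j)%:R :> R.
  have /andP[h _] := level_size_itv R j; apply: lt_le_trans h.
  by rewrite divr_gt0// expR_gt0.
rewrite /f mulrC ltr_pdivrMr ?exprn_gt0// mul1r => h.
by rewrite -ler_sqr ?nnegrE// real_normK ?num_real// ltW.
Qed.

Lemma ae_exceedance : {ae leb, forall x, I01 x -> exists J, forall j, (J <= j)%N ->
  pair_exceedances (level_size j.+1) (level_cut j) x < 1}.
Proof.
have [C C0 hC] := exceedance_level R.
apply: (ae_level_small C0).
- move=> j; apply: measurable_indic_sum => a; case: ifP => // _.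
  by apply: measurableI; exact: measurable_digit_event.
- by move=> j x; apply: indic_sum_ge0.
- move=> j v2; apply: le_trans (pair_exceedances_le R (level_size j.+1) (level_cut_gt1 v2)) _.
  by rewrite lee_fin hC.
Qed.

Lemma level_size_unbounded n : exists j, (n < level_size j)%N.
Proof.
have [J hJ] := scale_unbounded (n.+1%:R : R); exists J.
rewrite /level_size truncn_ge_nat ?expR_ge0//; apply: le_trans (hJ J (leqnn J)) _.
apply: le_trans (expR_ge1Dx _); apply: ler_wpDl => //.
by rewrite -[leLHS]expr1 ler_weXn2l ?scale_ge1.
Qed.

Lemma level_index J n : (level_size J <= n)%N ->
  exists2 j, (J <= j)%N & (level_size j <= n <= level_size j.+1)%N.
Proof.
move=> Jn; case: (ex_minnP (level_size_unbounded n)) => -[|k] nk kmin.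
  by have := level_size_mono R (leq0n J); lia.
have Jk : (J <= k)%N.
  by rewrite leqNgt; apply/negP => /(level_size_mono R); lia.
exists k => //; rewrite (ltnW nk) andbT leqNgt; apply/negP => /kmin; lia.
Qed.

(** The arithmetic of the sandwich with all quantities abstract: [l] is [ln 2], [g] and [g'] are
    [9 ln v] at consecutive levels, [N] and [N'] their sizes with ratio at most [e], [U] and [U']
    the truncated sums, [m] and [m'] their means, [t] the cut, [r] the length [n], [D] its
    [log log], and [A] the trimmed sum. *)
Lemma ratio_bounds (K l g g' e U U' m m' t N N' r D A : R) :
  0 <= K -> 0 < l <= 1 -> 0 < N -> N <= r <= N' -> N' <= e * N -> 0 < e -> t <= N ->
  g - 1 <= D <= g + 1 -> g' <= g + 1 -> K + 2 < g -> U - t <= A <= U' ->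
  `|m - N * (g / l)| <= K * N -> `|m' - N' * (g' / l)| <= K * N' ->
  `|U - m| <= N -> `|U' - m'| <= N' ->
  e^-1 * ((g - (K + 2)) / (g + 1)) <= l / (r * D) * A <= e * ((g + (K + 2)) / (g - 1)).
Proof.
move=> K0 /andP[l0 l1] N0 /andP[Nr rN] N'e e0 tN /andP[D1 D2] gg Kg /andP[A1 A2].
rewrite !ler_norml => /andP[m1 _] /andP[_ m2] /andP[U1 _] /andP[_ U2].
have r0 : 0 < r by lra.
have D0 : 0 < D by lra.
have rD0 : 0 < r * D by exact: mulr_gt0.
have lA1 : l * A <= e * r * (g + (K + 2)).
  have h1 : A <= N' * (g' / l) + (K + 1) * N' by lra.
  have h2 : l * (N' * (g' / l) + (K + 1) * N') = N' * (g' + l * (K + 1)).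
    by field; rewrite gt_eqF.
  apply: le_trans (ler_wpM2l (ltW l0) h1) _; rewrite h2.
  have h3 : g' + l * (K + 1) <= g + (K + 2).
    have : l * (K + 1) <= K + 1 by apply: ler_piMl => //; lra.
    lra.
  have N'0 : 0 <= N' by lra.
  apply: le_trans (ler_wpM2l N'0 h3) _; apply: ler_wpM2r; first lra.
  by apply: le_trans N'e _; apply: ler_wpM2l => //; exact: ltW.
have lA2 : e^-1 * r * (g - (K + 2)) <= l * A.
  have h1 : N * (g / l) - (K + 2) * N <= A by lra.
  have h2 : l * (N * (g / l) - (K + 2) * N) = N * (g - l * (K + 2)).
    by field; rewrite gt_eqF.
  apply: le_trans (ler_wpM2l (ltW l0) h1); rewrite h2.
  have h3 : g - (K + 2) <= g - l * (K + 2).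
    have : l * (K + 2) <= K + 2 by apply: ler_piMl => //; lra.
    lra.
  apply: le_trans (ler_wpM2l (ltW N0) h3); apply: ler_wpM2r; first lra.
  by rewrite mulrC ler_pdivrMr// mulrC; lra.
have -> : l / (r * D) * A = l * A / (r * D) by rewrite mulrAC.
apply/andP; split.
  rewrite ler_pdivlMr//; apply: le_trans lA2.
  have -> : e^-1 * ((g - (K + 2)) / (g + 1)) * (r * D) =
      e^-1 * r * (g - (K + 2)) * (D / (g + 1)).
    by field; apply/andP; split; lra.
  apply: ler_piMr; last by rewrite ler_pdivrMr; lra.
  by rewrite !mulr_ge0 ?invr_ge0//; lra.
rewrite ler_pdivrMr//; apply: le_trans lA1 _.
have -> : e * ((g + (K + 2)) / (g - 1)) * (r * D) =
    e * r * (g + (K + 2)) * (D / (g - 1)).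
  by field; lra.
apply: ler_peMr; last by rewrite ler_pdivlMr; lra.
by rewrite !mulr_ge0//; lra.
Qed.

Lemma trimmed_ratio_bounds : exists2 K : R, 0 <= K & forall j n x, 2 <= scale j ->
  (level_size j <= n <= level_size j.+1)%N ->
  pair_exceedances (level_size j.+1) (level_cut j) x < 1 ->
  `|truncated_sum (level_size j) (level_cut j) x -
    truncated_mean R (level_size j) (level_cut j)| <= (level_size j)%:R ->
  `|truncated_sum (level_size j.+1) (level_cut j.+1) x -
    truncated_mean R (level_size j.+1) (level_cut j.+1)| <= (level_size j.+1)%:R ->
  K + 2 < 9 * ln (scale j) ->
  (expR (3 / scale j))^-1 * ((9 * ln (scale j) - (K + 2)) / (9 * ln (scale j) + 1)) <=
  ln 2 / (n%:R * ln (ln n%:R)) * ((prime_digit_sum n x)%:R - (prime_digit_max n x)%:R) <=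
  expR (3 / scale j) * ((9 * ln (scale j) + (K + 2)) / (9 * ln (scale j) - 1)).
Proof.
have [K K0 hK] := mean_level R; exists K => // j n x v2 Nn hx d1 d2 gK.
have v2' : 2 <= scale j.+1 := le_trans v2 (scale_le R (leqnSn j)).
have l2 : 0 < (ln 2 : R) <= 1 by rewrite ln2_le1 ln_gt0n.
have N0 : 0 < (level_size j)%:R :> R.
  have /andP[h _] := level_size_itv R j; apply: lt_le_trans h.
  by rewrite divr_gt0// expR_gt0.
have Nr : (level_size j)%:R <= (n%:R : R) <= (level_size j.+1)%:R.
  by move: Nn => /andP[? ?]; rewrite !ler_nat; apply/andP.
have tN : (level_cut j)%:R <= (level_size j)%:R :> R by rewrite ler_nat level_cut_le_size.
exact: (ratio_bounds K0 l2 N0 Nr (level_size_step v2) (expR_gt0 _) tN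
  (loglog_level v2 Nn) (ln_scale_step R j) gK
  (trimmed_sum_bounds Nn (level_cut_mono v2) hx) (hK j v2) (hK j.+1 v2') d1 d2).
Qed.

Lemma expR_small (y d : R) : 0 <= y -> y <= d / 2 -> d <= 1 ->
  expR y <= 1 + d /\ 1 - d <= (expR y)^-1.
Proof.
move=> y0 yd d1; have h := expR_ge1Dx (- y); rewrite expRN in h.
have e0 := expR_gt0 y; split; last by lra.
have h' : (1 - y) * expR y <= 1 by rewrite -ler_pdivlMr// mul1r.
have h2 : 1 <= (1 - y) * (1 + d) by nra.
have h3 : 0 < 1 - y by lra.
by rewrite -(ler_pM2l h3); apply: le_trans h' h2.
Qed.

(** Both fractions are within [d] of 1 once [a + 1 <= d (g - 1)]; the 3 comes from
    [(1 + d)^2 <= 1 + 3 d] for [d <= 1]. *)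
Lemma near_one_of_bounds (d e r a g : R) : 0 < d -> d <= 1 -> 0 < e -> e <= 1 + d ->
  1 - d <= e^-1 -> 0 <= a -> a < g -> a + 1 <= d * (g - 1) ->
  e^-1 * ((g - a) / (g + 1)) <= r <= e * ((g + a) / (g - 1)) -> `|1 - r| <= 3 * d.
Proof.
move=> d0 d1 e0 e1 e2 a0 ag gd /andP[r1 r2].
have g1 : 0 < g - 1 by rewrite -(pmulr_rgt0 _ d0); lra.
have q1 : (g + a) / (g - 1) <= 1 + d by rewrite ler_pdivrMr//; lra.
have q2 : 1 - d <= (g - a) / (g + 1) by rewrite ler_pdivlMr; lra.
have q0 : 0 <= (g + a) / (g - 1) by rewrite divr_ge0//; lra.
have s1 := ler_pM (ltW e0) q0 e1 q1.
have dd : 0 <= 1 - d by rewrite subr_ge0.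
have s2 := ler_pM dd dd e2 q2.
have d2 : d * d <= d by rewrite ler_piMr// ltW.
have h1 : r <= (1 + d) * (1 + d) by exact: le_trans r2 s1.
have h2 : (1 - d) * (1 - d) <= r by exact: le_trans s2 r1.
have d20 : 0 <= d * d by rewrite mulr_ge0// ltW.
move: h1 h2 d2 d20; clear; rewrite !(mulrDl, mulrDr, mulrN, mulNr, mul1r, mulr1).
by move: (d * d) => dd *; rewrite ler_norml; apply/andP; split; lra.
Qed.

Lemma trimmed_ratio_cvg (x : R) :
  (exists J, forall j, (J <= j)%N ->
    `|truncated_sum (level_size j) (level_cut j) x -
      truncated_mean R (level_size j) (level_cut j)| <= (level_size j)%:R) ->
  (exists J, forall j, (J <= j)%N -> pair_exceedances (level_size j.+1) (level_cut j) x < 1) ->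
  (fun n : nat => (ln (2 : R) / (n%:R * ln (ln (n%:R : R)))
     * ((prime_digit_sum n x)%:R - (prime_digit_max n x)%:R) : R)) @ \oo --> (1 : R).
Proof.
move=> [J1 h1] [J2 h2]; have [K K0 hK] := trimmed_ratio_bounds.
apply/cvgrPdist_le => eps eps0.
pose d := Num.min 1 (eps / 3).
have d0 : 0 < d by rewrite /d lt_min ltr01 divr_gt0.
have d1 : d <= 1 by rewrite /d ge_min lexx.
have d3 : 3 * d <= eps.
  have : d <= eps / 3 by rewrite /d ge_min lexx orbT.
  lra.
(* A lower bound for [9 ln v]: the summand [(K + 3) / d] yields [K + 3 <= d (9 ln v - 1)], and the
   rest ensures [K + 2 < 9 ln v]. *)
pose M := 1 + (K + 3) / d + K + 2.
have Kd : 0 <= (K + 3) / d by rewrite divr_ge0 ?(ltW d0)// addr_ge0.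
(* Three thresholds added up: 2 for the level estimates, [6 / d] for [3 / v <= d / 2], and [expR M]
   for [M <= ln v]. *)
have [J3 h3] := scale_unbounded (2 + 6 / d + expR M).
exists (level_size (maxn J1 (maxn J2 J3))) => // n Jn.
have [j] := level_index Jn; rewrite !geq_max => /and3P[jJ1 jJ2 jJ3] Nn.
have v3 := h3 j jJ3.
have d6 : 0 <= 6 / d by rewrite divr_ge0// ltW.
have eM := expR_gt0 M.
have v0 := scale_gt0 R j.
have v2 : 2 <= scale j by lra.
have lM : M <= ln (scale j).
  rewrite -[leLHS]expRK; apply: ln_mono => //; lra.
have gM : M <= 9 * ln (scale j) by rewrite /M in lM *; lra.
have gK : K + 2 < 9 * ln (scale j) by rewrite /M in gM; lra.
have := hK j n x v2 Nn (h2 j jJ2) (h1 j jJ1) (h1 j.+1 (leqW jJ1)) gK.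
have y0 : 0 <= 3 / scale j by rewrite divr_ge0// ltW.
have yd : 3 / scale j <= d / 2.
  rewrite ler_pdivrMr//.
  have : 6 / d <= scale j by lra.
  rewrite ler_pdivrMr// => h6; lra.
have [e1 e2] := expR_small y0 yd d1.
have e0 : 0 < expR (3 / scale j) := expR_gt0 _.
have gd : K + 2 + 1 <= d * (9 * ln (scale j) - 1).
  by rewrite mulrC -ler_pdivrMr// -addrA; move: gM; rewrite /M; lra.
have K2 : 0 <= K + 2 by lra.
by move=> /(near_one_of_bounds d0 d1 (expR_gt0 _) e1 e2 K2 gK gd) /le_trans; apply.
Qed.

End AlmostSure.

Lemma cvg_pinfty_of_trimmed (R : realType) (S M : nat -> R) : (forall n, 0 <= M n) ->
  (fun n : nat => ln 2 / (n%:R * ln (ln n%:R)) * (S n - M n) : R) @ \oo --> (1 : R) ->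
  (fun n : nat => n%:R^-1 * S n : R) @ \oo --> +oo.
Proof.
move=> M0 /cvgrPdist_le /(_ (1 / 2)); rewrite divr_gt0// => /(_ isT)[n1 _ h1].
(* The iterated exponential forces [log log n >= 2 |A| + 1]. As the normalised trimmed sum is at
   least [1/2] and [ln 2 <= 1], the trimmed average is at least half of [log log n]. *)
apply/cvgryPge => A; exists (n1 + (Num.truncn (expR (expR (2 * `|A| + 1)))).+1)%N => // n /= hn.
have nn1 : (n1 <= n)%N := leq_trans (leq_addr _ _) hn.
have en : expR (expR (2 * `|A| + 1)) <= n%:R.
  apply: le_trans (ltW (truncnS_gt _)) _; rewrite ler_nat.
  exact: leq_trans (leq_addl _ _) hn.
have l1 : expR (2 * `|A| + 1) <= ln n%:R by rewrite -[leLHS]expRK; exact: ln_mono (expR_gt0 _) en.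
have l2 : 2 * `|A| + 1 <= ln (ln n%:R) by rewrite -[leLHS]expRK; exact: ln_mono (expR_gt0 _) l1.
have n0 : 0 < n%:R :> R := lt_le_trans (expR_gt0 _) en.
have A0 := ler_norm A; have A0' : 0 <= `|A| by [].
have ln20 : 0 < ln 2 :> R by exact: ln_gt0n.
have ln21 := ln2_le1 R.
have := h1 n nn1; rewrite /= ler_norml => /andP[_]; move: (M n) (M0 n) (S n) => m m0 s.
move: n0 l2 {hn en l1 h1 nn1}; move: (ln (ln _)) => D; move: (n%:R : R) => r r0 D1.
have D0 : 0 < D by lra.
move: ln20 ln21; move: (ln 2) => l l0 l1 h.
have {}h : 1 / 2 <= l / (r * D) * (s - m) by lra.
rewrite mulrAC ler_pdivlMr ?mulr_gt0// in h.
rewrite mulrC ler_pdivlMr//.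
have sm0 : 0 <= s - m.
  have : 0 < l * (s - m) by apply: lt_le_trans h; rewrite !mulr_gt0// divr_gt0.
  by rewrite pmulr_rgt0// => /ltW.
have h' : l * (s - m) <= s - m by apply: ler_piMl.
have : A * r <= 1 / 2 * (r * D).
  rewrite [r * D]mulrC mulrA; apply: ler_wpM2r; [exact: ltW|lra].
by lra.
Qed.

Theorem theorem2p6 (R : realType) :
  {ae (@lebesgue_measure R), forall x : R, x \in `]0, 1] ->
     (fun n : nat => ((n%:R)^-1 * (prime_digit_sum n x)%:R : R)) @ \oo --> +oo}
  /\
  {ae (@lebesgue_measure R), forall x : R, x \in `]0, 1] ->
     (fun n : nat => (ln (2 : R) / (n%:R * ln (ln (n%:R : R)))
        * ((prime_digit_sum n x)%:R - (prime_digit_max n x)%:R) : R)) @ \oo --> (1 : R)}.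
Proof.
have trimmed : {ae (@lebesgue_measure R), forall x : R, x \in `]0, 1] ->
     (fun n : nat => (ln (2 : R) / (n%:R * ln (ln (n%:R : R)))
        * ((prime_digit_sum n x)%:R - (prime_digit_max n x)%:R) : R)) @ \oo --> (1 : R)}.
  have := @filterI _ _ (@ae_filter_ringOfSetsType _ (measurableTypeR R) R lebesgue_measure)
    _ _ (ae_deviation R) (ae_exceedance R).
  apply: ae_mono => x [dev exc] x01.
  by apply: trimmed_ratio_cvg; [apply: dev|apply: exc]; rewrite inE in x01.
split=> //; apply: ae_mono trimmed => x + x01 => /(_ x01).
exact: (@cvg_pinfty_of_trimmed R (fun n => (prime_digit_sum n x)%:R)
  (fun n => (prime_digit_max n x)%:R)).
Qed.
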